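(* There exists a polynomial-time algorithm which, given $A\in\mathbb{Z}^{m\times n}$ of full row rank ($n\ge 2$) and $b\in\mathbb{Z}^m$, either computes a feasible solution to the system $Ax=b$, $x\ge 0$, or correctly reports that none exists, using $O\!\left(\frac{n^5}{\log n}\,L\right)$ arithmetic operations, where $L$ is the encoding size of the matrix $(A,b)$. In the course of its execution the algorithm makes $O\!\left(\frac{n}{\log n}\,L\right)$ calls to the basic subroutine described in the context.
   Context: The encoding size $L$ of $(A,b)$ is the number of bits needed to write the integer matrix $(A,b)$ in binary. ''Polynomial-time'' means that the number of arithmetic operations and the encoding sizes of all numbers occurring are bounded by polynomials in $n$ and $L$. The basic subroutine (called the Bubble algorithm) is a strongly polynomial algorithm which, for a system $Ax=b$, $x\ge0$ in $n$ variables (with $A$ of full row rank) and a vector $u\in\mathbb{R}^n$, $u>0$ componentwise, returns in $O(n^4)$ arithmetic operations one of the following: (1) a feasible solution to $Ax=b$, $x\geq 0$; (2) a vector $(v,w)\in\mathbb{R}^m\times\mathbb{R}^n_+$, $w\ne 0$, such that $(v^\top A+w^\top)\bar x< v^\top b+\frac{1}{2n}w^\top u$ for every $\bar x\in\mathbb{R}^n$ with $0\le \bar x\le u$. Calls may be made on systems obtained from the original one by fixing some variables to $0$ (i.e. deleting columns of $A$, and redundant equations), with $n$ replaced by the number of remaining variables. *)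

(* Defs.v *)
From HB Require Import structures.
From mathcomp Require Import all_boot all_order all_algebra.
From mathcomp Require Import reals exp.

Set Implicit Arguments.
Unset Strict Implicit.
Unset Printing Implicit Defensive.

Import Order.TTheory GRing.Theory Num.Theory.
Local Open Scope ring_scope.

(** * Linear systems and encoding sizes *)

Definition feasible (F : numDomainType) m n
    (A : 'M[F]_(m, n)) (b : 'cV[F]_m) (x : 'cV[F]_n) : Prop :=
  A *m x = b /\ forall j, 0 <= x j 0.

(* One sign bit and ceil (log2 (|z| + 1)) binary digits. *)
Definition int_size (z : int) : nat := (up_log 2 `|z|.+1).+1.

Definition rat_size (q : rat) : nat :=
  (int_size (numq q) + up_log 2 `|denq q|.+1)%N.

Definition mx_size (T : Type) (size : T -> nat) m n (A : 'M[T]_(m, n)) : nat :=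
  (\sum_(i < m) \sum_(j < n) size (A i j))%N.

Definition system_size m n (A : 'M[int]_(m, n)) (b : 'cV[int]_m) : nat :=
  mx_size int_size (row_mx A b).

(** * A programming language for exact rational arithmetic

   Programs are finite syntax trees, independent of the dimensions of the
   input.  The memory consists of arrays named by natural numbers, each of
   which is two-dimensional and unbounded and holds rational numbers; a scalar
   is cell (0, 0), and a vector is column 0.  There is no rounding operation,
   and execution is stuck on a division by zero and on an index whose value is
   not a natural number. *)

Definition memory : Type := nat -> nat -> nat -> rat.

Definition upd (s : memory) a i j q : memory := fun a' i' j' =>
  if [&& a' == a, i' == i & j' == j] then q else s a' i' j'.

Inductive arith : Type := Add | Sub | Mul | Div.

Inductive expr : Type :=
  | Cst of int
  | Get of nat & expr & expr
  | Op of arith & expr & expr.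

Inductive comparison : Type := Lt | Le | Eq.

Inductive test : Type := Cmp of comparison & expr & expr.

Inductive cmd : Type :=
  | Skip
  | Assign of nat & expr & expr & expr
  | Seq of cmd & cmd
  | If of test & cmd & cmd
  | While of test & cmd
  | Call.

Definition arith_sem (o : arith) (x y : rat) : rat :=
  match o with
  | Add => x + y | Sub => x - y | Mul => x * y | Div => x / y
  end.

Definition comparison_sem (c : comparison) (x y : rat) : bool :=
  match c with Lt => x < y | Le => x <= y | Eq => x == y end.

(* [ops] counts the operations +, -, *, / and the comparisons, those on array
   indices and loop counters included; reads, writes and jumps are free, but
   every round of a loop performs a comparison.  [bits] is the largest encoding
   size of a number occurring in the run. *)
Record cost : Type := Cost { ops : nat; calls : nat; bits : nat }.

Definition cost0 : cost := Cost 0 0 0.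

Definition cost_add (k l : cost) : cost :=
  Cost (ops k + ops l) (calls k + calls l) (maxn (bits k) (bits l)).

Definition value_cost (nops : nat) (q : rat) : cost := Cost nops 0 (rat_size q).

Inductive eval (s : memory) : expr -> rat -> cost -> Prop :=
  | eval_Cst z : eval s (Cst z) z%:~R (value_cost 0 z%:~R)
  | eval_Get a e1 e2 (i j : nat) k1 k2 :
      eval s e1 i%:R k1 -> eval s e2 j%:R k2 ->
      eval s (Get a e1 e2) (s a i j)
        (cost_add (cost_add k1 k2) (value_cost 0 (s a i j)))
  | eval_Op o e1 e2 x y k1 k2 :
      eval s e1 x k1 -> eval s e2 y k2 -> (o = Div -> y != 0) ->
      eval s (Op o e1 e2) (arith_sem o x y)
        (cost_add (cost_add k1 k2) (value_cost 1 (arith_sem o x y))).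

Inductive eval_test (s : memory) : test -> bool -> cost -> Prop :=
  | eval_Cmp c e1 e2 x y k1 k2 :
      eval s e1 x k1 -> eval s e2 y k2 ->
      eval_test s (Cmp c e1 e2) (comparison_sem c x y)
        (cost_add (cost_add k1 k2) (Cost 1 0 0)).

(* [exec call c s k s'] : run from memory [s], program [c] terminates in memory
   [s'] at cost [k], where [call] is the meaning of the command [Call]. *)
Inductive exec (call : memory -> cost -> memory -> Prop) :
    cmd -> memory -> cost -> memory -> Prop :=
  | exec_Skip s : exec call Skip s cost0 s
  | exec_Assign a e1 e2 e (i j : nat) q k1 k2 k s :
      eval s e1 i%:R k1 -> eval s e2 j%:R k2 -> eval s e q k ->
      exec call (Assign a e1 e2 e) s (cost_add (cost_add k1 k2) k) (upd s a i j q)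
  | exec_Seq c1 c2 s1 s2 s3 k1 k2 :
      exec call c1 s1 k1 s2 -> exec call c2 s2 k2 s3 ->
      exec call (Seq c1 c2) s1 (cost_add k1 k2) s3
  | exec_If t c1 c2 (r : bool) s s' k1 k2 :
      eval_test s t r k1 -> exec call (if r then c1 else c2) s k2 s' ->
      exec call (If t c1 c2) s (cost_add k1 k2) s'
  | exec_WhileF t c s k :
      eval_test s t false k -> exec call (While t c) s k s
  | exec_WhileT t c s1 s2 s3 k1 k2 k3 :
      eval_test s1 t true k1 -> exec call c s1 k2 s2 ->
      exec call (While t c) s2 k3 s3 ->
      exec call (While t c) s1 (cost_add (cost_add k1 k2) k3) s3
  | exec_Call s k s' : call s k s' -> exec call Call s k s'.

(** * Input, output and subroutine calls *)

Definition in_m : nat := 0.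
Definition in_n : nat := 1.
Definition in_A : nat := 2.
Definition in_b : nat := 3.
Definition in_u : nat := 4.
Definition out_answer : nat := 5.
Definition out_x : nat := 6.
Definition out_v : nat := 7.
Definition out_w : nat := 8.

Definition entry m n (M : 'M[rat]_(m, n)) (i j : nat) : rat :=
  match insub i, insub j with
  | Some i', Some j' => M i' j'
  | _, _ => 0
  end.

Definition block (s : memory) (a m n : nat) : 'M[rat]_(m, n) :=
  \matrix_(i, j) s a i j.

Definition input_mem m n (A : 'M[rat]_(m, n)) (b : 'cV[rat]_m)
    (u : 'cV[rat]_n) : memory := fun a =>
  if a == in_m then entry ((m%:R)%:M : 'M_1)
  else if a == in_n then entry ((n%:R)%:M : 'M_1)
  else if a == in_A then entry A
  else if a == in_b then entry b
  else if a == in_u then entry u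
  else fun _ _ => 0.

Definition return_mem (s s0 : memory) : memory := fun a =>
  if a \in [:: out_answer; out_x; out_v; out_w] then s0 a else s a.

Definition no_call (s : memory) (k : cost) (s' : memory) : Prop := False.

(* A call runs [B] in a private memory that holds only the arguments, taken from
   the input arrays of the caller, and then copies the output arrays back; the
   caller is charged for the whole run of [B]. *)
Inductive call_of (B : cmd) : memory -> cost -> memory -> Prop :=
  | call_of_intro (m n : nat) s s0 k :
      s in_m 0%N 0%N = m%:R -> s in_n 0%N 0%N = n%:R ->
      exec no_call B
        (input_mem (block s in_A m n) (block s in_b m 1) (block s in_u n 1))
        k s0 ->
      call_of B s (Cost (ops k) 1 (bits k)) (return_mem s s0).

(** * The basic subroutine *)

Definition subroutine_output (R : realType) m n (A : 'M[rat]_(m, n))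
    (b : 'cV[rat]_m) (u : 'cV[rat]_n) (s : memory) : Prop :=
  let x := block s out_x n 1 in
  let v := block s out_v m 1 in
  let w := block s out_w n 1 in
  (s out_answer 0%N 0%N = 1 /\ feasible A b x) \/
  (s out_answer 0%N 0%N = 0 /\
   [/\ forall j, 0 <= w j 0, w != 0 &
       forall xbar : 'cV[R]_n,
         (forall j, 0 <= xbar j 0 <= ratr (u j 0)) ->
         (map_mx ratr (v^T *m A + w^T) *m xbar) 0 0
           < ratr ((v^T *m b) 0 0 + (2 * n%:R)^-1 * (w^T *m u) 0 0)]).

(* [B] is a strongly polynomial algorithm with O(n^4) arithmetic operations. *)
Definition basic_subroutine (R : realType) (B : cmd) : Prop :=
  exists C c d : nat, forall m n (A : 'M[rat]_(m, n)) (b : 'cV[rat]_m)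
      (u : 'cV[rat]_n),
    (0 < m)%N -> (0 < n)%N -> row_free A -> (forall j, 0 < u j 0) ->
    exists k s,
      [/\ exec no_call B (input_mem A b u) k s,
          subroutine_output R A b u s,
          (ops k <= C * n ^ 4)%N &
          (bits k <=
             c * (mx_size rat_size (row_mx A b) + mx_size rat_size u) ^ d)%N].

(** * Solving [A x = b], [x >= 0] *)

(* Infeasibility is over the real numbers. *)
Definition solver_output (R : realType) m n (A : 'M[int]_(m, n))
    (b : 'cV[int]_m) (s : memory) : Prop :=
  (s out_answer 0%N 0%N = 1 /\
     feasible (map_mx intr A) (map_mx intr b) (block s out_x n 1)) \/
  (s out_answer 0%N 0%N = 0 /\
     ~ exists x : 'cV[R]_n, feasible (map_mx intr A) (map_mx intr b) x).

(** * Runs are unique, so "there is a run such that" speaks of the run *)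

Lemma natr_rat_inj (i j : nat) : i%:R = j%:R :> rat -> i = j.
Proof. by move/eqP; rewrite eqr_nat => /eqP. Qed.

Lemma eval_det s e x k y l : eval s e x k -> eval s e y l -> x = y /\ k = l.
Proof.
move=> H; elim: H y l => {e x k}
  [z|a e1 e2 i j k1 k2 _ IH1 _ IH2|o e1 e2 x1 x2 k1 k2 _ IH1 _ IH2 _] y l H.
- by inversion H.
- inversion H as [|a' e1' e2' i' j' l1 l2 E1 E2|]; subst.
  have [/natr_rat_inj -> ->] := IH1 _ _ E1.
  by have [/natr_rat_inj -> ->] := IH2 _ _ E2.
- inversion H as [| |o' e1' e2' y1 y2 l1 l2 E1 E2]; subst.
  by have [-> ->] := IH1 _ _ E1; have [-> ->] := IH2 _ _ E2.
Qed.

Lemma eval_test_det s t x k y l :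
  eval_test s t x k -> eval_test s t y l -> x = y /\ k = l.
Proof.
case=> c e1 e2 x1 x2 k1 k2 H1 H2 H.
inversion H as [c' e1' e2' y1 y2 l1 l2 E1 E2]; subst.
by have [-> ->] := eval_det H1 E1; have [-> ->] := eval_det H2 E2.
Qed.

Lemma exec_det (call : memory -> cost -> memory -> Prop) c s k s1 l s2 :
  (forall s k s1 l s2, call s k s1 -> call s l s2 -> k = l /\ s1 = s2) ->
  exec call c s k s1 -> exec call c s l s2 -> k = l /\ s1 = s2.
Proof.
move=> detc H; elim: H l s2 => {c s k s1}
  [s|a e1 e2 e i j q k1 k2 k s H1 H2 H3|c1 c2 s1 s2 s3 k1 k2 _ IH1 _ IH2
  |t c1 c2 r s s' k1 k2 Ht _ IH|t c s k Ht
  |t c s1 s2 s3 k1 k2 k3 Ht _ IH1 _ IH2|s k s' Hc] l s4 H.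
- by inversion H.
- inversion H as [|a' e1' e2' e' i' j' q' l1 l2 l0 s0 E1 E2 E3| | | | |]; subst.
  have [/natr_rat_inj -> ->] := eval_det H1 E1.
  have [/natr_rat_inj -> ->] := eval_det H2 E2.
  by have [-> ->] := eval_det H3 E3.
- inversion H as [| |c1' c2' t1 t2 t3 l1 l2 E1 E2| | | |]; subst.
  have [? ?] := IH1 _ _ E1; subst.
  by have [-> ->] := IH2 _ _ E2.
- inversion H as [| | |t' c1' c2' r' t1 t2 l1 l2 E1 E2| | |]; subst.
  have [? ?] := eval_test_det Ht E1; subst.
  by have [-> ->] := IH _ _ E2.
- inversion H as [| | | |t' c' t1 l1 E1|t' c' t1 t2 t3 l1 l2 l3 E1 E2 E3|]; subst.
  + by have [_ ->] := eval_test_det Ht E1.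
  + by have [] := eval_test_det Ht E1.
- inversion H as [| | | |t' c' t1 l1 E1|t' c' t1 t2 t3 l1 l2 l3 E1 E2 E3|]; subst.
  + by have [] := eval_test_det Ht E1.
  + have [_ ->] := eval_test_det Ht E1.
    have [? ?] := IH1 _ _ E2; subst.
    by have [-> ->] := IH2 _ _ E3.
- inversion H as [| | | | | |t1 l1 t2 E1]; subst.
  exact: detc Hc E1.
Qed.

Lemma call_of_det B s k s1 l s2 :
  call_of B s k s1 -> call_of B s l s2 -> k = l /\ s1 = s2.
Proof.
case=> m n {}s s0 {}k Hm Hn H H'.
inversion H' as [m' n' t t0 l' Em En E]; subst.
have /natr_rat_inj e1 : m%:R = m'%:R :> rat by rewrite -Hm -Em.
have /natr_rat_inj e2 : n%:R = n'%:R :> rat by rewrite -Hn -En.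
subst m' n'.
by have [|-> ->] := exec_det _ H E.
Qed.

(* Main.v *)
Require Import Defs.
From mathcomp Require Import all_boot all_order all_algebra all_fingroup.
From mathcomp Require Import zify ring lra.
From mathcomp Require Import boolp reals exp.

Set Implicit Arguments.
Unset Strict Implicit.
Unset Printing Implicit Defensive.
Import Order.TTheory GRing.Theory Num.Theory.
Local Open Scope ring_scope.

(** Every vertex [x] of the polyhedron satisfies [x <= U], and its nonzero
    coordinates are at least [4 / U], where [U] is a product over the entries of
    [(A, b)] that bounds the subdeterminants.
    The algorithm keeps upper bounds [u_j] that all vertices obey.
    A certificate [(v, w)] of the subroutine gives [w^T x < q := w^T u / (2n)],
    hence [x_j < q / w_j], so [u_j] may be lowered to [q / w_j].  It is
    lowered to a number [U (3/4)^e], which keeps the encoding short and loses less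
    than a factor [4/3].  A variable with [3 U u_j < 4] vanishes at every vertex and
    is deleted; if none appears, [prod_j u_j] is still multiplied by less than
    [1 / (1 + n/2)], since the numbers [2n w_j u_j / w^T u] have sum [2n].  With [k] variables
    left, at most [k O(L)] steps [3/4] are left and a call performs at least [log k]
    of them; splitting at [k = sqrt n] gives [O(n L / log n)] calls.

    The system is kept as a simplex tableau: its entries are quotients of
    determinants by Cramer's rule, so their size stays polynomial, and deleting a
    basic variable is a single pivot or the deletion of a redundant row. *)

(** The language has no rounding, so the exponent of a lowered bound cannot be computed; it is
    reached by repeated multiplication by [3/4]. One round may need many of these, so they are
    charged to the exponents, whose total growth is bounded, and not to the round. To keep every
    exponent at most a fixed [E], a target [q / w_j] below [1 / U] is raised to [1 / U]. The loop
    then ends with [3 U u_j < 4], so this happens only to variables that the next sweep deletes.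
    Hence either some variable dies, or all targets are the true [q / w_j] and the product argument
    applies. The number of steps left is not enough as a potential: with few variables a call is
    only sure to make one step. The potential therefore has a second term, capped at the number of
    steps that about [sqrt n] variables can have left, and a third one for deletions. The reduced
    systems need not be equivalent to the original one. They keep the solutions with the size bounds
    of a vertex, called [good], and a feasible system has a good solution. *)

(** * Heights of rational numbers *)

(* Unlike [rat_size], the height is submultiplicative for all four operations. *)
Definition hgt (q : rat) : nat := (`|numq q| + `|denq q|)%N.

Lemma absz_denq_gt0 q : (0 < `|denq q|)%N.
Proof. by rewrite absz_gt0 denq_neq0. Qed.

Lemma hgt_frac (p d : int) : d != 0 -> (hgt (p%:~R / d%:~R) <= `|p| + `|d|)%N.
Proof.
case: divqP => [|k x k0 _]; first by rewrite eqxx.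
rewrite !abszM -mulnDr leq_pmull // absz_gt0 //.
Qed.

Lemma hgt_int (z : int) : hgt z%:~R = `|z|.+1.
Proof. by rewrite /hgt numq_int denq_int addn1. Qed.

Lemma hgt_nat (n : nat) : hgt n%:R = n.+1.
Proof. by rewrite -[n%:R]/(n%:Z%:~R) hgt_int. Qed.

Lemma hgtN q : hgt (- q) = hgt q.
Proof. by rewrite /hgt numqN denqN abszN. Qed.

Lemma hgtD x y : (hgt (x + y) <= hgt x * hgt y)%N.
Proof.
have -> : x + y = (numq x * denq y + numq y * denq x)%:~R / (denq x * denq y)%:~R.
  rewrite rmorphD !rmorphM /=.
  have hx : (denq x)%:~R != 0 :> rat by rewrite intr_eq0 denq_neq0.
  have hy : (denq y)%:~R != 0 :> rat by rewrite intr_eq0 denq_neq0.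
  by rewrite -{1}[x]divq_num_den -{1}[y]divq_num_den; field; rewrite hx hy.
apply: leq_trans (hgt_frac _ _) _; first by rewrite mulf_neq0 ?denq_neq0.
rewrite /hgt; lia.
Qed.

Lemma hgtB x y : (hgt (x - y) <= hgt x * hgt y)%N.
Proof. by rewrite -[hgt y]hgtN hgtD. Qed.

Lemma hgtM x y : (hgt (x * y) <= hgt x * hgt y)%N.
Proof.
have -> : x * y = (numq x * numq y)%:~R / (denq x * denq y)%:~R.
  rewrite !rmorphM /=.
  have hx : (denq x)%:~R != 0 :> rat by rewrite intr_eq0 denq_neq0.
  have hy : (denq y)%:~R != 0 :> rat by rewrite intr_eq0 denq_neq0.
  by rewrite -{1}[x]divq_num_den -{1}[y]divq_num_den; field; rewrite hx hy.
apply: leq_trans (hgt_frac _ _) _; first by rewrite mulf_neq0 ?denq_neq0.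
rewrite /hgt; lia.
Qed.

Lemma hgtV x : (hgt x^-1 <= hgt x)%N.
Proof.
have [->|x0] := eqVneq x 0; first by rewrite invr0.
have -> : x^-1 = (denq x)%:~R / (numq x)%:~R.
  by rewrite -{1}[x]divq_num_den invf_div.
apply: leq_trans (hgt_frac _ _) _; first by rewrite numq_eq0.
by rewrite addnC.
Qed.

Lemma hgt_div x y : (hgt (x / y) <= hgt x * hgt y)%N.
Proof. by apply: leq_trans (hgtM _ _) _; rewrite leq_mul2l hgtV orbT. Qed.

(** The factor 2 is for the exponent 0, since [hgt 1] is 2. *)
Lemma hgtX x n : (hgt (x ^+ n) <= 2 * hgt x ^ n)%N.
Proof.
have -> : x ^+ n = (numq x ^+ n)%:~R / (denq x ^+ n)%:~R.
  by rewrite -{1}[x]divq_num_den expr_div_n !rmorphXn.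
apply: leq_trans (hgt_frac _ _) _; first by rewrite expf_neq0 ?denq_neq0.
rewrite !abszX mul2n -addnn; case: n => [|n]; first by rewrite !expn0.
by rewrite leq_add // leq_exp2r // ?leq_addl ?leq_addr.
Qed.

Lemma hgt_sum n (F : nat -> rat) S :
  (forall i, (i < n)%N -> (hgt (F i) <= 2 ^ S)%N) ->
  (hgt (\sum_(i < n) F i) <= 2 ^ (S * n))%N.
Proof.
elim: n => [|n IH] H; first by rewrite big_ord0 muln0.
rewrite big_ord_recr /= mulnS addnC expnD.
apply: leq_trans (hgtD _ _) _; apply: leq_mul; last exact: H.
by apply: IH => i hi; apply: H; rewrite ltnS ltnW.
Qed.

Lemma rat_size_hgt q S : (hgt q <= 2 ^ S)%N -> (rat_size q <= 2 * S + 2)%N.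
Proof.
rewrite /hgt => H; have hd := absz_denq_gt0 q.
have h1 : (up_log 2 `|numq q|.+1 <= S)%N by apply: up_log_min => //; lia.
have h2 : (up_log 2 `|denq q|.+1 <= S.+1)%N.
  by apply: up_log_min => //; rewrite expnS; have := expn_gt0 2 S; lia.
by rewrite /rat_size /int_size; lia.
Qed.

Lemma hgt_rat_size q : (hgt q <= 2 ^ rat_size q)%N.
Proof.
have h1 := @up_logP 2 `|numq q|.+1 isT.
have h2 := @up_logP 2 `|denq q|.+1 isT.
rewrite /rat_size /int_size /hgt expnD expnS.
have := expn_gt0 2 (up_log 2 `|numq q|.+1).
set X := expn _ _ in h1 *; set Y := expn _ _ in h2 *; nia.
Qed.

(** * A program logic with costs *)

(** A total reading of a value as an index; [safe] demands that it be faithful. *)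
Definition ix (q : rat) : nat := `|numq q|%N.

Lemma ix_nat n : ix n%:R = n.
Proof. by rewrite /ix -[n%:R]/(n%:Z%:~R) numq_int. Qed.

Fixpoint den (s : memory) (e : expr) : rat :=
  match e with
  | Cst z => z%:~R
  | Get a e1 e2 => s a (ix (den s e1)) (ix (den s e2))
  | Op o e1 e2 => arith_sem o (den s e1) (den s e2)
  end.

(** The bound 7 gives constants height at most [2 ^ 3], which is where [3 <= S] comes from. *)
Fixpoint safe (s : memory) (e : expr) : Prop :=
  match e with
  | Cst z => (`|z| <= 7)%N
  | Get _ e1 e2 => [/\ safe s e1, safe s e2,
      den s e1 = (ix (den s e1))%:R & den s e2 = (ix (den s e2))%:R]
  | Op o e1 e2 => [/\ safe s e1, safe s e2 & o = Div -> den s e2 != 0]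
  end.

Fixpoint eops (e : expr) : nat :=
  match e with
  | Cst _ => 0
  | Get _ e1 e2 => eops e1 + eops e2
  | Op _ e1 e2 => (eops e1 + eops e2).+1
  end.

(** In a memory bounded by [S], a value of width [w] has height at most [2 ^ (S * w)]. A read yields
    width 1 whatever its indices are, but the indices are themselves values of the run, hence the
    maximum. *)
Fixpoint ewidth (e : expr) : nat :=
  match e with
  | Cst _ => 1
  | Get _ e1 e2 => maxn 1 (maxn (ewidth e1) (ewidth e2))
  | Op _ e1 e2 => ewidth e1 + ewidth e2
  end.

Definition bounded (S : nat) (s : memory) : Prop :=
  forall a i j, (hgt (s a i j) <= 2 ^ S)%N.

Lemma hgt_arith o x y : (hgt (arith_sem o x y) <= hgt x * hgt y)%N.
Proof. by case: o; rewrite ?hgtD ?hgtB ?hgtM ?hgt_div. Qed.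

Lemma eval_den S s e : (3 <= S)%N -> bounded S s -> safe s e ->
  (hgt (den s e) <= 2 ^ (S * ewidth e))%N /\
  exists k, [/\ eval s e (den s e) k, ops k = eops e, calls k = 0%N &
                (bits k <= 2 * (S * ewidth e) + 2)%N].
Proof.
move=> S3 bs; elim: e => [z|a e1 IH1 e2 IH2|o e1 IH1 e2 IH2] /=.
- move=> hz; have hh : (hgt z%:~R <= 2 ^ (S * 1))%N.
    rewrite hgt_int muln1; apply: leq_trans (_ : 2 ^ 3 <= _)%N; first by [].
    by rewrite leq_exp2l.
  split=> //; exists (value_cost 0 z%:~R); split=> //; first exact: eval_Cst.
  exact: rat_size_hgt.
- case=> /IH1[h1 [k1 [v1 o1 c1 b1]]] /IH2[h2 [k2 [v2 o2 c2 b2]]] e1N e2N.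
  set w := maxn _ _; have w1 : (1 <= w)%N by rewrite leq_maxl.
  have hh : (hgt (s a (ix (den s e1)) (ix (den s e2))) <= 2 ^ (S * w))%N.
    by apply: leq_trans (bs _ _ _) _; rewrite leq_exp2l // leq_pmulr.
  split=> //.
  exists (cost_add (cost_add k1 k2)
     (value_cost 0 (s a (ix (den s e1)) (ix (den s e2))))); split.
  + by apply: eval_Get; [rewrite -e1N | rewrite -e2N].
  + by rewrite /= o1 o2 addn0.
  + by rewrite /= c1 c2.
  + rewrite /= !geq_max rat_size_hgt // andbT; apply/andP; split.
      apply: leq_trans b1 _; rewrite leq_add2r leq_mul2l /= leq_mul2l.
      by rewrite !leq_max leqnn !orbT.
    apply: leq_trans b2 _; rewrite leq_add2r leq_mul2l /= leq_mul2l.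
    by rewrite !leq_max leqnn !orbT.
- case=> /IH1[h1 [k1 [v1 o1 c1 b1]]] /IH2[h2 [k2 [v2 o2 c2 b2]]] nz.
  have hh : (hgt (arith_sem o (den s e1) (den s e2)) <=
      2 ^ (S * (ewidth e1 + ewidth e2)))%N.
    apply: leq_trans (hgt_arith _ _ _) _.
    by rewrite mulnDr expnD leq_mul.
  split=> //.
  exists (cost_add (cost_add k1 k2)
     (value_cost 1 (arith_sem o (den s e1) (den s e2)))); split.
  + exact: eval_Op.
  + by rewrite /= o1 o2 addn1.
  + by rewrite /= c1 c2.
  + have h := rat_size_hgt hh.
    by rewrite /= !geq_max h andbT; apply/andP; split; lia.
Qed.

Definition ev (s : memory) (e : expr) (q : rat) : Prop := safe s e /\ den s e = q.

Definition V x := Get x (Cst 0) (Cst 0).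
Definition G1 a x := Get a (V x) (Cst 0).
Definition G2 a x y := Get a (V x) (V y).

Lemma ev_N s (n : nat) : (n <= 7)%N -> ev s (Cst n) n%:R.
Proof. by []. Qed.

Lemma ev_get s a e1 e2 i j q : ev s e1 i%:R -> ev s e2 j%:R -> s a i j = q ->
  ev s (Get a e1 e2) q.
Proof. by case=> h1 d1 [h2 d2] <-; split; rewrite /= d1 d2 !ix_nat. Qed.

Lemma ev_V s x q : s x 0%N 0%N = q -> ev s (V x) q.
Proof. by apply: ev_get; apply: (@ev_N _ 0). Qed.

Lemma ev_G1 s a x i q : s x 0%N 0%N = i%:R -> s a i 0%N = q -> ev s (G1 a x) q.
Proof. by move=> h; apply: ev_get (ev_V h) (@ev_N _ 0 isT). Qed.

Lemma ev_G2 s a x y i j q : s x 0%N 0%N = i%:R -> s y 0%N 0%N = j%:R ->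
  s a i j = q -> ev s (G2 a x y) q.
Proof. by move=> h h'; apply: ev_get (ev_V h) (ev_V h'). Qed.

Lemma ev_add s e1 e2 x y : ev s e1 x -> ev s e2 y -> ev s (Op Add e1 e2) (x + y).
Proof. by case=> ? <- [? <-]; split. Qed.

Lemma ev_sub s e1 e2 x y : ev s e1 x -> ev s e2 y -> ev s (Op Defs.Sub e1 e2) (x - y).
Proof. by case=> ? <- [? <-]; split. Qed.

Lemma ev_mul s e1 e2 x y : ev s e1 x -> ev s e2 y -> ev s (Op Mul e1 e2) (x * y).
Proof. by case=> ? <- [? <-]; split. Qed.

Lemma ev_div s e1 e2 x y : y != 0 -> ev s e1 x -> ev s e2 y ->
  ev s (Op Div e1 e2) (x / y).
Proof. by move=> y0 [? <-] [? hy]; split; rewrite /= hy //; split. Qed.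

Fixpoint mods (c : cmd) : seq nat :=
  match c with
  | Skip => [::]
  | Assign a _ _ _ => [:: a]
  | Seq c1 c2 | If _ c1 c2 => mods c1 ++ mods c2
  | While _ c => mods c
  | Call => [:: out_answer; out_x; out_v; out_w]
  end.

Lemma exec_frame B c s k s' a : exec (call_of B) c s k s' ->
  a \notin mods c -> s' a = s a.
Proof.
move=> H; elim: H => {c s k s'} //=.
- by move=> a' e1 e2 e i j q k1 k2 k s _ _ _; rewrite inE /upd => /negPf ->.
- move=> c1 c2 s1 s2 s3 k1 k2 _ IH1 _ IH2; rewrite mem_cat negb_or.
  by case/andP => /IH1 <- /IH2.
- move=> t c1 c2 r s s' k1 k2 _ _ IH; rewrite mem_cat negb_or.
  by case: r IH => IH /andP[h1 h2]; rewrite IH.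
- by move=> t c s1 s2 s3 k1 k2 k3 _ _ IH1 _ IH2 h; rewrite IH2 ?IH1.
- by move=> s k s' [] m n {}s s0 {}k _ _ _ /negPf; rewrite /return_mem => ->.
Qed.

Definition Set1 x e := Assign x (Cst 0) (Cst 0) e.

Section Logic.
Variables (B : cmd) (S : nat).
Hypothesis S3 : (3 <= S)%N.

(** No expression of the solver is wider than 8, so one bound on the bits serves all commands. *)
Lemma budget w b : (w <= 8)%N -> (b <= 2 * (S * w) + 2)%N -> (b <= 16 * S + 2)%N.
Proof.
move=> hw hb; have h : (S * w <= S * 8)%N by rewrite leq_mul2l hw orbT.
lia.
Qed.

(* The continuation receives the accumulated numbers of operations and calls. *)
Definition wp (c : cmd) (o l : nat) (s : memory)
    (Q : nat -> nat -> memory -> Prop) : Prop :=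
  bounded S s -> exists k s', [/\ exec (call_of B) c s k s',
    (bits k <= 16 * S + 2)%N, bounded S s' & Q (o + ops k)%N (l + calls k)%N s'].

Lemma wp_conseq c o l s (Q Q' : nat -> nat -> memory -> Prop) :
  (forall o' l' s', bounded S s' ->
     (forall a, a \notin mods c -> s' a = s a) -> Q o' l' s' -> Q' o' l' s') ->
  wp c o l s Q -> wp c o l s Q'.
Proof.
move=> H h /h[k [s' [ek bk bs q]]]; exists k, s'; split=> //.
by apply: H q => // a; apply: exec_frame ek.
Qed.

(** The counters restart at 0, so that a loop body can be specified independently of the rounds
    before it. *)
Lemma wp_shift c o l s Q :
  wp c 0 0 s (fun o' l' => Q (o + o')%N (l + l')%N) -> wp c o l s Q.
Proof. by move=> h /h[k [s' [e b bs q]]]; exists k, s'; split. Qed.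

Lemma wp_skip o l s (Q : nat -> nat -> memory -> Prop) : Q o l s -> wp Skip o l s Q.
Proof.
by move=> q bs; exists cost0, s; rewrite !addn0; split=> //; apply: exec_Skip.
Qed.

Lemma wp_seq c1 c2 o l s Q :
  wp c1 o l s (fun o l s => wp c2 o l s Q) -> wp (Seq c1 c2) o l s Q.
Proof.
move=> h /h[k1 [s1 [e1 b1 bs1 h2]]]; have [k2 [s2 [e2 b2 bs2 q]]] := h2 bs1.
exists (cost_add k1 k2), s2; split=> //; first exact: exec_Seq e1 e2.
  by rewrite /= geq_max b1.
by rewrite /= !addnA.
Qed.

Lemma wp_assign a e1 e2 e i j q o l s (Q : nat -> nat -> memory -> Prop) :
  ev s e1 i%:R -> ev s e2 j%:R -> ev s e q ->
  (maxn (ewidth e) (maxn (ewidth e1) (ewidth e2)) <= 8)%N ->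
  (bounded S s -> (hgt q <= 2 ^ S)%N) ->
  Q (o + (eops e1 + eops e2 + eops e))%N l (upd s a i j q) ->
  wp (Assign a e1 e2 e) o l s Q.
Proof.
move=> [h1 d1] [h2 d2] [h d]; rewrite !geq_max => /and3P[w0 w1 w2] hq HQ bs.
have [_ [k1 [v1 o1 c1 b1]]] := eval_den S3 bs h1.
have [_ [k2 [v2 o2 c2 b2]]] := eval_den S3 bs h2.
have [_ [k [v o' c b]]] := eval_den S3 bs h.
rewrite d1 in v1; rewrite d2 in v2; rewrite d in v.
exists (cost_add (cost_add k1 k2) k), (upd s a i j q); split.
- exact: exec_Assign.
- by rewrite /= !geq_max (budget w1 b1) (budget w2 b2) (budget w0 b).
- move=> a' i' j'; rewrite /upd; case: ifP => _; [exact: hq | exact: bs].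
- by rewrite /= o1 o2 o' c1 c2 c !addn0.
Qed.

Lemma wp_set x e q o l s (Q : nat -> nat -> memory -> Prop) :
  ev s e q -> (ewidth e <= 8)%N -> (bounded S s -> (hgt q <= 2 ^ S)%N) ->
  Q (o + eops e)%N l (upd s x 0 0 q) -> wp (Set1 x e) o l s Q.
Proof.
move=> he we hq HQ.
by apply: wp_assign (@ev_N s 0 isT) (@ev_N s 0 isT) he _ hq _; rewrite // geq_max we.
Qed.

Lemma wp_if t1 t2 r c1 c2 x y o l s Q :
  ev s t1 x -> ev s t2 y -> (maxn (ewidth t1) (ewidth t2) <= 8)%N ->
  wp (if comparison_sem r x y then c1 else c2)
     (o + (eops t1 + eops t2).+1)%N l s Q ->
  wp (If (Cmp r t1 t2) c1 c2) o l s Q.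
Proof.
move=> [h1 d1] [h2 d2]; rewrite !geq_max => /andP[w1 w2] H bs.
have [_ [k1 [v1 o1 cc1 b1]]] := eval_den S3 bs h1.
have [_ [k2 [v2 o2 cc2 b2]]] := eval_den S3 bs h2.
rewrite d1 in v1; rewrite d2 in v2.
have [k [s' [ek bk bs' q]]] := H bs.
exists (cost_add (cost_add (cost_add k1 k2) (Cost 1 0 0)) k), s'; split=> //.
- by apply: exec_If ek; apply: eval_Cmp.
- by rewrite /= !geq_max bk (budget w1 b1) (budget w2 b2).
- by move: q; rewrite /= o1 o2 cc1 cc2 addn1 !addnA.
Qed.

(* [I v] is the loop invariant together with the value [v] of the variant. *)
Lemma wp_while (I : nat -> nat -> nat -> memory -> Prop) t1 t2 r c Q v o l s :
  (maxn (ewidth t1) (ewidth t2) <= 8)%N ->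
  (forall v o l s, I v o l s -> bounded S s ->
    exists x y, [/\ ev s t1 x, ev s t2 y &
      let o' := (o + (eops t1 + eops t2).+1)%N in
      if comparison_sem r x y then
        wp c o' l s (fun o l s => exists2 v', (v' < v)%N & I v' o l s)
      else Q o' l s]) ->
  I v o l s -> wp (While (Cmp r t1 t2) c) o l s Q.
Proof.
rewrite geq_max => /andP[w1 w2] H.
elim/ltn_ind: v o l s => v IH o l s Iv bs.
have [x [y [[h1 d1] [h2 d2] /=]]] := H _ _ _ _ Iv bs.
have [_ [k1 [v1 o1 cc1 b1]]] := eval_den S3 bs h1.
have [_ [k2 [v2 o2 cc2 b2]]] := eval_den S3 bs h2.
rewrite d1 in v1; rewrite d2 in v2.
have et := eval_Cmp r v1 v2.
have hb : (bits (cost_add (cost_add k1 k2) (Cost 1 0 0)) <= 16 * S + 2)%N.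
  by rewrite /= !geq_max (budget w1 b1) (budget w2 b2).
case: (comparison_sem r x y) et => et.
- move=> /(_ bs)[k [s' [ek bk bs' [v' ltv Iv']]]].
  have [k3 [s3 [ek3 bk3 bs3 q]]] := IH _ ltv _ _ _ Iv' bs'.
  exists (cost_add (cost_add (cost_add (cost_add k1 k2) (Cost 1 0 0)) k) k3), s3.
  split=> //; first exact: exec_WhileT et ek ek3.
    by rewrite 2!geq_max hb bk bk3.
  by move: q; rewrite /= o1 o2 cc1 cc2 addn1 !addnA.
- move=> q; exists (cost_add (cost_add k1 k2) (Cost 1 0 0)), s; split=> //.
    exact: exec_WhileF.
  by move: q; rewrite /= o1 o2 cc1 cc2 addn1 !addn0.
Qed.

End Logic.
Arguments wp_set {B S} S3 [x e q o l s Q].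
Arguments wp_assign {B S} S3 [a e1 e2 e i j q o l s Q].
Arguments wp_if {B S} S3 [t1 t2 r c1 c2 x y o l s Q].
Arguments wp_while {B S} S3 [I t1 t2 r c Q v o l s].

Definition For x lo y body :=
  Seq (Set1 x lo)
      (While (Cmp Lt (V x) (V y)) (Seq body (Set1 x (Op Add (V x) (Cst 1))))).

Definition frame (l : seq nat) (s s' : memory) : Prop :=
  forall a, a \notin l -> s' a = s a.

Lemma updE s a i j q a' i' j' : upd s a i j q a' i' j' =
  if [&& a' == a, i' == i & j' == j] then q else s a' i' j'.
Proof. by []. Qed.

Lemma upd_frame s a i j q a' : a' != a -> upd s a i j q a' = s a'.
Proof. by rewrite /upd => /negPf ->. Qed.

Section ForLoop.
Variables (B : cmd) (S : nat).
Hypothesis S3 : (3 <= S)%N.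

(* The second argument of the invariant is the cost exceeding [K] per round. *)
Lemma wp_for_amortized (I : nat -> nat -> memory -> Prop) (x : nat) lo (y : nat) body i0 n K o l s Q :
  x \notin mods body -> y \notin mods body -> x != y ->
  ev s lo i0%:R -> (ewidth lo <= 8)%N -> (i0 <= n)%N -> (n < 2 ^ S)%N ->
  s y 0%N 0%N = n%:R ->
  I i0 0%N (upd s x 0 0 i0%:R) ->
  (forall i t (s' : memory), (i0 <= i < n)%N -> s' x 0%N 0%N = i%:R -> I i t s' ->
    bounded S s' -> frame (x :: mods body) s s' ->
    wp B S body 0 0 s' (fun o l s'' => exists t', [/\ (o <= K + t')%N, l = 0%N &
       s'' x 0%N 0%N = i%:R -> I i.+1 (t + t')%N (upd s'' x 0 0 i.+1%:R)])) ->
  (forall o' t s', (o' <= o + eops lo + 1 + (n - i0) * (K + 2) + t)%N -> I n t s' ->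
    s' x 0%N 0%N = n%:R -> frame (x :: mods body) s s' -> Q o' l s') ->
  wp B S (For x lo y body) o l s Q.
Proof.
move=> xb yb xy elo wlo i0n nS sy I0 Ib IQ; apply: wp_seq.
have h0 : (hgt i0%:R <= 2 ^ S)%N by rewrite hgt_nat; lia.
apply: (wp_set S3 elo) => //.
(* A round costs [K] for the body, a comparison and an increment; the [+ 1] in the final bound is
   the failing comparison. *)
pose J v o' l' s' := exists i t, [/\ (v = n - i)%N /\ l' = l, (i0 <= i <= n)%N,
  I i t s' /\ s' x 0%N 0%N = i%:R, frame (x :: mods body) s s' &
  (o' <= o + eops lo + (i - i0) * (K + 2) + t)%N].
have yxb : y \notin x :: mods body by rewrite inE negb_or yb eq_sym xy.
apply: (wp_while S3 (I := J) (v := n - i0)) => //; last first.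
  exists i0, 0%N; split=> //; first by rewrite leqnn.
  - by rewrite updE !eqxx.
  - by move=> a; rewrite inE negb_or => /andP[h _]; apply: upd_frame.
  - by rewrite subnn !addn0.
move=> {I0} v o' l' s' [i [t [[-> ->] /andP[hi hin] [Ii sx] fr ho]]] bs.
exists i%:R, n%:R; split.
- exact: ev_V.
- by apply: ev_V; rewrite fr.
rewrite /= ltr_nat; case: ltnP => lin; last first.
  have e : i = n by lia.
  move: ho Ii sx; rewrite e => ho Ii sx; apply: (IQ _ t) => //.
  by lia.
apply: wp_seq; apply: wp_shift.
apply: wp_conseq (Ib i t s' _ sx Ii bs fr); last by rewrite hi lin.
move=> o1 l1 s1 bs1 fr1 [t' [ho1 -> I1]].
have s1x : s1 x 0%N 0%N = i%:R by rewrite fr1.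
apply: (wp_set S3 (ev_add (ev_V s1x) (@ev_N _ 1 isT))) => //.
  by rewrite natr1 hgt_nat => _; lia.
rewrite natr1; exists (n - i.+1)%N; first lia.
exists i.+1, (t + t')%N; split; [by rewrite addn0 | lia | | |].
- by split; [exact: I1 | rewrite updE !eqxx].
- move=> a ha; have := ha; rewrite inE negb_or => /andP[h h'].
  by rewrite upd_frame // fr1 // fr.
- rewrite /=.
  have -> : (i.+1 - i0 = (i - i0) + 1)%N by lia.
  nia.
Qed.

Lemma wp_for (I : nat -> memory -> Prop) (x : nat) lo (y : nat) body i0 n K o l s Q :
  x \notin mods body -> y \notin mods body -> x != y ->
  ev s lo i0%:R -> (ewidth lo <= 8)%N -> (i0 <= n)%N -> (n < 2 ^ S)%N ->
  s y 0%N 0%N = n%:R ->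
  I i0 (upd s x 0 0 i0%:R) ->
  (forall i (s' : memory), (i0 <= i < n)%N -> s' x 0%N 0%N = i%:R -> I i s' ->
    bounded S s' -> frame (x :: mods body) s s' ->
    wp B S body 0 0 s' (fun o l s'' => [/\ (o <= K)%N, l = 0%N &
       s'' x 0%N 0%N = i%:R -> I i.+1 (upd s'' x 0 0 i.+1%:R)])) ->
  (forall o' s', (o' <= o + eops lo + 1 + (n - i0) * (K + 2))%N -> I n s' ->
    s' x 0%N 0%N = n%:R -> frame (x :: mods body) s s' -> Q o' l s') ->
  wp B S (For x lo y body) o l s Q.
Proof.
move=> xb yb xy elo wlo i0n nS sy I0 Ib IQ.
apply: (wp_for_amortized (K := K) (I := fun i t s' => t = 0%N /\ I i s')
  xb yb xy elo wlo i0n nS sy (conj erefl I0)).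
  move=> i t s' hi sx [-> Ii] bs fr.
  apply: wp_conseq (Ib i s' hi sx Ii bs fr) => o' l' s'' _ _ [ho hl I'].
  by exists 0%N; rewrite addn0; split=> // /I'.
by move=> o' t s' ho [t0 In]; rewrite t0 addn0 in ho; apply: IQ.
Qed.

End ForLoop.
Arguments wp_for_amortized {B S} S3 [I x lo y body i0 n K o l s Q].
Arguments wp_for {B S} S3 [I x lo y body i0 n K o l s Q].

(** * Determinants, Cramer's rule and vertices *)

Lemma absz_sum (I : finType) (F : I -> int) :
  (absz (\sum_i F i)%R <= \sum_i `|F i|)%N.
Proof.
elim/big_ind2: _ => // x1 x2 y1 y2 h1 h2.
by apply: leq_trans (leq_add h1 h2); lia.
Qed.

Lemma absz_prod (I : finType) (F : I -> int) :
  (absz (\prod_i F i)%R = \prod_i `|F i|)%N.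
Proof. by elim/big_ind2: _ => // x1 x2 y1 y2 <- <-; rewrite abszM. Qed.

(** Expanding the product of the row sums gives one term for each map from rows to columns, and the
    permutations are among these maps. *)
Lemma absz_det k (M : 'M[int]_k) :
  (absz (\det M)%R <= \prod_(i < k) \sum_(j < k) `|M i j|)%N.
Proof.
rewrite /determinant; apply: leq_trans (absz_sum _) _.
rewrite bigA_distr_bigA /=.
under eq_bigr => s _ do rewrite abszM absz_prod abszX abszN1 exp1n mul1n.
pose h (s : 'S_k) := [ffun i => s i].
have hi : injective h by move=> s t /ffunP e; apply/permP => i; have := e i; rewrite !ffunE.
rewrite [leqRHS](bigID (mem (h @: setT))) /=.
apply: leq_trans (leq_addr _ _); rewrite big_imset /=; last by move=> ? ? _ _; apply: hi.
rewrite (eq_bigl _ _ (@in_setT _)); apply: eq_leq; apply: eq_bigr => s _.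
by apply: eq_bigr => i _; rewrite ffunE.
Qed.

Lemma sum_le_prod_succ (I : finType) (F : I -> nat) :
  (1 + \sum_i F i <= \prod_i (F i).+1)%N.
Proof.
elim/big_rec2: _ => // i x y _ h; nia.
Qed.

Lemma prod_inj_le (I J : finType) (f : I -> J) (F : J -> nat) :
  injective f -> (forall j, (0 < F j)%N) -> (\prod_i F (f i) <= \prod_j F j)%N.
Proof.
move=> fi F0; rewrite [leqRHS](bigID (mem (f @: setT))) /=.
rewrite big_imset /=; last by move=> ? ? _ _; apply: fi.
by rewrite (eq_bigl _ _ (@in_setT _)) leq_pmulr // prodn_gt0.
Qed.

(** All factors are at least 1, so the product dominates its restriction to any rows and columns. It
    thereby bounds all minors at once, and a program can compute it with a few operations per
    entry. *)
Definition entry_bound m n (A : 'M[int]_(m, n)) (b : 'cV[int]_m) : nat :=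
  (\prod_i (`|b i 0%R|.+1 * \prod_j `|A i j|.+1))%N.

Section Minors.
Variables (m n : nat) (A : 'M[int]_(m, n)) (b : 'cV[int]_m).

Lemma entry_bound_gt0 : (0 < entry_bound A b)%N.
Proof. by apply: prodn_gt0 => i; rewrite muln_gt0 /= prodn_gt0. Qed.

Lemma minor_bound k (g : 'I_k -> 'I_m) (f : 'I_k -> 'I_n) :
  injective g -> injective f -> (absz (\det (mxsub g f A))%R <= entry_bound A b)%N.
Proof.
move=> gi fi; apply: leq_trans (absz_det _) _.
apply: leq_trans (prod_inj_le gi (F := fun r => (`|b r 0%R|.+1 * \prod_j `|A r j|.+1)%N) _); last first.
  by move=> r; rewrite muln_gt0 /= prodn_gt0.
apply: leq_prod => i _; apply: leq_trans (leq_pmull _ _) => //.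
apply: leq_trans (prod_inj_le fi (F := fun c => `|A (g i) c|.+1) _) => //.
apply: leq_trans (sum_le_prod_succ _); rewrite leqW // eq_leq //.
by apply: eq_bigr => j _; rewrite mxE.
Qed.

Lemma cofactor_bound k (g : 'I_k -> 'I_m) (f : 'I_k -> 'I_n) i j :
  injective g -> injective f -> (absz (cofactor (mxsub g f A) i j) <= entry_bound A b)%N.
Proof.
move=> gi fi; rewrite /cofactor abszM abszX abszN1 exp1n mul1n.
have -> : row' i (col' j (mxsub g f A)) = mxsub (g \o lift i) (f \o lift j) A.
  by apply/matrixP => r c; rewrite !mxE.
by apply: minor_bound; apply: inj_comp => //; apply: lift_inj.
Qed.

(** The right-hand side in Cramer's rule will be [b] for the solution and a column of [A] for a
    tableau entry. In both cases row [r] of the product has a factor at least [|y r| + 1]. *)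
Lemma col_sum_bound k (g : 'I_k -> 'I_m) (y : 'I_m -> int) :
  injective g -> (forall r, `|y r| <= `|b r 0%R| \/ exists c, y r = A r c)%N ->
  (\sum_i `|y (g i)| <= entry_bound A b)%N.
Proof.
move=> gi hy; apply: leq_trans (_ : \prod_i `|y (g i)|.+1 <= _)%N.
  by apply: leq_trans (sum_le_prod_succ _); rewrite leqW.
apply: leq_trans (prod_inj_le gi (F := fun r => `|y r|.+1) _) _ => //.
apply: leq_prod => r _; case: (hy r) => [h|[c ->]].
  by apply: leq_trans (leq_pmulr _ _) => //; rewrite prodn_gt0.
apply: leq_trans (leq_pmull _ _) => //.
by rewrite (bigD1 c) //= leq_pmulr // prodn_gt0.
Qed.

(** In the product of the adjugate with [y], each cofactor is at most the entry bound and so is the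
    sum of the absolute values of [y], hence the square. *)
Lemma cramer_bound (F : numFieldType) k (g : 'I_k -> 'I_m) (f : 'I_k -> 'I_n)
    (y : 'I_m -> int) (x : 'cV[F]_k) :
  injective g -> injective f ->
  (forall r, `|y r| <= `|b r 0%R| \/ exists c, y r = A r c)%N ->
  (map_mx intr (mxsub g f A) : 'M[F]_k) \in unitmx ->
  (map_mx intr (mxsub g f A) : 'M[F]_k) *m x = \col_i (y (g i))%:~R ->
  exists (N : 'cV[int]_k) (d : int), [/\ d != 0, (`|d| <= entry_bound A b)%N,
    forall i, (absz (N i 0%R) <= entry_bound A b * entry_bound A b)%N &
    x = \col_i ((N i 0)%:~R / d%:~R)].
Proof.
move=> gi fi hy; set M := mxsub g f A => Mu Mx.
exists (\adj M *m \col_i y (g i)), (\det M).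
have d0 : \det M != 0.
  by move: Mu; rewrite unitmxE det_map_mx unitfE intr_eq0.
split=> //.
- exact: minor_bound.
- move=> i; rewrite mxE; apply: leq_trans (absz_sum _) _.
  apply: leq_trans (_ : \sum_j entry_bound A b * `|y (g j)| <= _)%N.
    by apply: leq_sum => j _; rewrite abszM leq_mul // !mxE ?cofactor_bound.
  by rewrite -big_distrr /= leq_mul2l col_sum_bound // orbT.
- have dF : (\det M)%:~R != 0 :> F by rewrite intr_eq0.
  apply/matrixP => i j; rewrite ord1 [RHS]mxE; apply: (mulIf dF); rewrite mulfVK //.
  have : map_mx intr (\adj M) *m (map_mx intr M *m x) =
         map_mx intr (\adj M) *m \col_i (y (g i))%:~R by rewrite Mx.
  rewrite mulmxA -map_mxM mul_adj_mx map_scalar_mx mul_scalar_mx.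
  move=> /matrixP/(_ i 0). rewrite mxE mulrC => ->.
  rewrite !mxE rmorph_sum /=; apply: eq_bigr => l _.
  by rewrite rmorphM /=; congr (_ * _); rewrite !mxE.
Qed.

End Minors.

(** The ratio test: [x] moves along [- d] until the first coordinate with [d j > 0] reaches 0.
    Coordinates that are already 0 stay so, because [d] vanishes there. *)
Lemma shrink_support (F : realFieldType) m n (A : 'M[F]_(m, n)) b x
    (d : 'cV[F]_n) j0 :
  feasible A b x -> A *m d = 0 -> (forall j, x j 0 = 0 -> d j 0 = 0) ->
  0 < d j0 0 ->
  exists x', feasible A b x' /\
    (#|[set j | x' j 0%R != 0%R]| < #|[set j | x j 0%R != 0%R]|)%N.
Proof.
move=> [Ax x0] Ad hd d0.
case: (@arg_minP _ _ _ j0 (fun j => 0 < d j 0) (fun j => x j 0 / d j 0) d0) => j1 dj1 hmin.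
exists (x - (x j1 0 / d j1 0) *: d); split.
  split; first by rewrite mulmxBr -scalemxAr Ad scaler0 subr0.
  move=> j; rewrite !mxE subr_ge0.
  have t0 : 0 <= x j1 0 / d j1 0 by rewrite divr_ge0 // ltW.
  have [hj|hj] := ltP 0 (d j 0); last by rewrite (le_trans (mulr_ge0_le0 t0 hj)).
  by rewrite -ler_pdivlMr // hmin.
apply: proper_card; apply/properP; split.
  apply/subsetP => j; rewrite !inE !mxE; apply: contra_neq => xj.
  by rewrite (hd j xj) xj mulr0 subr0.
exists j1; rewrite !inE ?mxE; first by apply: contraTneq dj1 => /hd ->; rewrite ltxx.
by rewrite negbK divfK ?subrr // gt_eqF.
Qed.

(** As long as the columns in the support are dependent, the support can shrink. *)
Lemma feasible_independent_support (F : realFieldType) m n (A : 'M[F]_(m, n)) b x :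
  feasible A b x -> exists x', feasible A b x' /\
    forall d : 'cV[F]_n, A *m d = 0 -> (forall j, x' j 0 = 0 -> d j 0 = 0) -> d = 0.
Proof.
move: {2}#|_| (leqnn #|[set j | x j 0%R != 0%R]|) => k.
elim: k x => [|k IH] x hk fx.
  exists x; split=> // d _ hd; apply/matrixP => j j'; rewrite ord1 mxE; apply: hd.
  move: hk; rewrite leqn0 cards_eq0 => /eqP/setP/(_ j).
  by rewrite !inE => /negbFE/eqP.
have [h|/existsNP[d /not_implyP[Ad /not_implyP[hd /eqP d0]]]] := pselect (forall d : 'cV[F]_n, A *m d = 0 ->
  (forall j, x j 0 = 0 -> d j 0 = 0) -> d = 0); first by exists x.
have [j dj] : exists j, d j 0 != 0.
  have /matrix0Pn[j [j' dj]] : d != 0 by [].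
  by exists j; rewrite ord1 in dj.
have [x' [fx' hx']] : exists x', feasible A b x' /\
    (#|[set j | x' j 0%R != 0%R]| < #|[set j | x j 0%R != 0%R]|)%N.
  (* One of [d] and [- d] is positive at [j]. *)
  have [h|h] := ltP 0 (d j 0); first exact: shrink_support fx Ad hd h.
  apply: (@shrink_support _ _ _ _ _ _ (- d) j) => //.
  - by rewrite mulmxN Ad oppr0.
  - by move=> i /hd hi; rewrite mxE hi oppr0.
  - by rewrite mxE oppr_gt0 lt_neqAle dj.
by apply: IH fx'; rewrite -ltnS; apply: leq_trans hx' hk.
Qed.

(* The witness is a solution of minimal support, given by Cramer's rule. *)
Lemma rational_vertex (F : realFieldType) m n (A : 'M[int]_(m, n)) (b : 'cV[int]_m) :
  (exists x : 'cV[F]_n, feasible (map_mx intr A) (map_mx intr b) x) ->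
  let U := entry_bound A b in
  exists x : 'cV[rat]_n, feasible (map_mx intr A) (map_mx intr b) x /\
    forall j, x j 0 <= (U * U)%:R /\ (x j 0 != 0 -> 1 <= U%:R * x j 0).
Proof.
move=> [x0 /feasible_independent_support[{}x0 [[Ax xge] indep]]] U.
pose AF : 'M[F]_(m, n) := map_mx intr A.
pose Sx := [set j | x0 j 0%R != 0%R].
pose f (i : 'I_#|Sx|) := enum_val i.
have fi : injective f by apply: enum_val_inj.
have full : row_full (colsub f AF).
  rewrite -[row_full _]/(\rank _ == _) -mxrank_tr; apply: inj_row_free => v hv.
  (* A dependency [v] of the columns in the support is extended by 0; each sum has at most one
     term. *)
  pose d : 'cV[F]_n := \col_j \sum_(i | f i == j) v 0 i.
  have fv i : d (f i) 0 = v 0 i.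
    by rewrite mxE (bigD1 i) //= big1 ?addr0 // => i' /andP[/eqP/fi ->]; rewrite eqxx.
  suff d0 : d = 0 by apply/matrixP => i j; rewrite ord1 -fv d0 !mxE.
  apply: indep; last first.
    move=> j xj; rewrite mxE big1 // => i /eqP fj.
    by have := enum_valP i; rewrite -/(f i) fj inE xj eqxx.
  apply/matrixP => r c; rewrite ord1 [LHS]mxE [RHS]mxE.
  have := congr1 (fun M : 'rV_m => M 0 r) hv; rewrite !mxE => h; rewrite -[RHS]h.
  under eq_bigr => j _ do rewrite [d _ _]mxE mulr_sumr.
  rewrite (exchange_big_dep xpredT) //=; apply: eq_bigr => i _.
  by rewrite (big_pred1 (f i)) => [|j]; rewrite ?[in LHS]mxE /= 1?eq_sym // !mxE mulrC.
(* Independent columns contain an invertible square block, to which Cramer's rule applies. *)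
pose g := fullrankfun full.
have gi : injective g by apply: fullrankfun_inj.
have Mu : (map_mx intr (mxsub g f A) : 'M[F]_#|Sx|) \in unitmx.
  have -> : map_mx intr (mxsub g f A) = rowsub g (colsub f AF).
    by apply/matrixP => i j; rewrite !mxE.
  exact: fullrowsub_unit.
pose xS : 'cV[F]_#|Sx| := \col_i x0 (f i) 0.
have hx0 j : j \notin Sx -> x0 j 0 = 0 by rewrite inE negbK => /eqP.
have sumS (V : zmodType) (G : 'I_n -> V) :
    (forall j, j \notin Sx -> G j = 0) -> \sum_j G j = \sum_i G (f i).
  move=> G0; rewrite (bigID (mem Sx)) /= [X in _ + X]big1 // addr0.
  exact: big_enum_val.
have MxS : (map_mx intr (mxsub g f A) : 'M[F]_#|Sx|) *m xS = \col_i (b (g i) 0)%:~R.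
  apply/matrixP => i j; rewrite ord1 !mxE.
  have := congr1 (fun M : 'cV_m => M (g i) 0) Ax; rewrite !mxE => <-.
  rewrite sumS => [|l /hx0 ->]; last by rewrite mulr0.
  by apply: eq_bigr => l _; rewrite !mxE.
have [N [d [d0 db Nb xSE]]] := cramer_bound (b := b) (y := fun r => b r 0) gi fi
  (fun r => or_introl (leqnn _)) Mu MxS.
rewrite -/U in db Nb.
pose x : 'cV[rat]_n := \col_j (\sum_(i | f i == j) (N i 0)%:~R / d%:~R).
have xf i : x (f i) 0 = (N i 0)%:~R / d%:~R.
  by rewrite mxE (bigD1 i) //= big1 ?addr0 // => i' /andP[/eqP/fi ->]; rewrite eqxx.
have xn j : j \notin Sx -> x j 0 = 0.
  move=> hj; rewrite mxE big1 // => i /eqP fj.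
  by move: hj; rewrite -fj enum_valP.
have dF0 : d%:~R != 0 :> F by rewrite intr_eq0.
have dQ0 : d%:~R != 0 :> rat by rewrite intr_eq0.
have xE j : x0 j 0 = ratr (x j 0).
  have [jS|jS] := boolP (j \in Sx); last by rewrite hx0 // xn // rmorph0.
  have -> : j = f (enum_rank_in jS j) by rewrite /f enum_rankK_in.
  set i := enum_rank_in _ _; rewrite xf fmorph_div /= !ratr_int.
  by have := congr1 (fun M : 'cV_#|Sx| => M i 0) xSE; rewrite !mxE.
exists x; split; first split.
- apply/matrixP => r c; rewrite ord1; apply: (fmorph_inj (@ratr F)).
  have := congr1 (fun M : 'cV_m => M r 0) Ax; rewrite !mxE rmorph_sum /= ratr_int => <-.
  by apply: eq_bigr => j _; rewrite rmorphM /= -xE !mxE ratr_int.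
- by move=> j; rewrite -(ler0q F) -xE.
- move=> j; have xj0 : 0 <= x j 0 by rewrite -(ler0q F) -xE.
  have [jS|jS] := boolP (j \in Sx); last first.
    by rewrite xn // eqxx; split.
  move: xj0.
  have -> : j = f (enum_rank_in jS j) by rewrite /f enum_rankK_in.
  set i := enum_rank_in _ _; rewrite xf => xj0.
  (* The quotient is nonnegative, so absolute values may be taken. Then [|d| >= 1] gives the upper
     bound, and [|N i| >= 1] the lower one. *)
  have normE : (N i 0)%:~R / d%:~R = (absz (N i 0))%:R / (absz d)%:R :> rat.
    by rewrite -[LHS]ger0_norm // normf_div !natr_absz !intr_norm.
  have dp : 0 < (absz d)%:R :> rat by rewrite ltr0n absz_gt0.
  split.
    rewrite normE ler_pdivrMr // -natrM ler_nat.
    by apply: leq_trans (Nb i) _; rewrite leq_pmulr // absz_gt0.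
  rewrite normE mulf_eq0 negb_or => /andP[N0 _].
  rewrite mulrA ler_pdivlMr // mul1r -natrM ler_nat.
  apply: leq_trans db _; rewrite leq_pmulr //.
  by move: N0; rewrite pnatr_eq0 lt0n.
Qed.

(** * Tableaux *)

Lemma sumD1 (V : nmodType) n (F : nat -> V) j : (j < n)%N ->
  \sum_(i < n) F i = F j + \sum_(i < n | i != j :> nat) F i.
Proof. by move=> jn; rewrite (bigD1 (Ordinal jn)). Qed.

(** Deleting position [k] moves the last position into the gap, as the program does. *)
Lemma sum_drop (V : nmodType) n (F : nat -> V) k : (k < n)%N ->
  \sum_(j < n) F j = F k + \sum_(j < n.-1) F (if j == k :> nat then n.-1 else j).
Proof.
case: n => // n; rewrite ltnS => kn /=; rewrite big_ord_recr /= addrC.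
have [->|nk] := eqVneq k n.
  by congr (_ + _); apply: eq_bigr => j _; rewrite ltn_eqF.
have {kn}nk : (k < n)%N by rewrite ltn_neqAle nk.
rewrite (sumD1 _ nk) (sumD1 (fun j => F (if j == k then n else j)) nk) eqxx.
rewrite addrCA; congr (_ + (_ + _)).
by apply: eq_bigr => j /negPf ->.
Qed.

Definition swap (j k c : nat) : nat := if c == j then k else if c == k then j else c.

Lemma swap_lt j k n c : (j < n -> k < n -> c < n -> swap j k c < n)%N.
Proof. by move=> *; rewrite /swap; case: ifP => _ //; case: ifP. Qed.

Lemma swapK j k : involutive (swap j k).
Proof.
move=> c; rewrite /swap; case: (eqVneq c j) => [->|cj].
  by rewrite eqxx; case: (eqVneq k j).
by case: (eqVneq c k) => [->|ck]; rewrite ?eqxx // (negPf cj) (negPf ck).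
Qed.

Lemma sum_swap (V : nmodType) n (F : nat -> V) j k : (j < n)%N -> (k < n)%N ->
  \sum_(c < n) F (swap j k c) = \sum_(c < n) F c.
Proof.
move=> jn kn; pose h (c : 'I_n) := Ordinal (swap_lt jn kn (ltn_ord c)).
have hi : injective h.
  by apply: (can_inj (g := h)) => c; apply: val_inj; rewrite /= swapK.
by rewrite [RHS](reindex_inj hi).
Qed.

Lemma sum_position (V : nmodType) n N (p : nat -> nat) (F : nat -> V) :
  (forall j, j < n -> p j < N)%N ->
  (forall i j, i < n -> j < n -> p i = p j -> i = j)%N ->
  (forall c, (c < N)%N -> (forall j, (j < n)%N -> p j != c) -> F c = 0) ->
  \sum_(c < N) F c = \sum_(j < n) F (p j).
Proof.
move=> pN pi F0; pose h (j : 'I_n) := Ordinal (pN _ (ltn_ord j)).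
have hi : injective h.
  by move=> i j /(congr1 val) /= e; apply: val_inj; apply: pi e.
rewrite (bigID (mem (h @: setT))) /= big_imset /=; last by move=> ? ? _ _; apply: hi.
rewrite (eq_bigl _ _ (@in_setT _)) [X in _ + X]big1 ?addr0 // => c hc.
apply: F0 => // j jn; apply: contraNneq hc => e.
by apply/imsetP; exists (Ordinal jn) => //; apply: val_inj; rewrite /= e.
Qed.

Section Tableau.
Variables (m0 N0 : nat) (a : nat -> nat -> rat) (b : nat -> rat).

(* Position [j] of the tableau holds column [p j] of the system, and the first
   [m] positions form the basis. *)
Record tableau (m n : nat) (T : nat -> nat -> rat) (be : nat -> rat)
    (p : nat -> nat) : Prop := Tableau {
  tab_mn : (m <= n)%N;
  tab_lt : forall j, (j < n)%N -> (p j < N0)%N;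
  tab_inj : forall i j, (i < n)%N -> (j < n)%N -> p i = p j -> i = j;
  tab_id : forall i j, (i < m)%N -> (j < m)%N -> T i j = (i == j)%:R;
  tab_dec : forall r j, (r < m0)%N -> (j < n)%N ->
    \sum_(i < m) a r (p i) * T i j = a r (p j);
  tab_decb : forall r, (r < m0)%N -> \sum_(i < m) a r (p i) * be i = b r;
  tab_indep : forall y : nat -> rat,
    (forall r, (r < m0)%N -> \sum_(i < m) a r (p i) * y i = 0) ->
    forall i, (i < m)%N -> y i = 0 }.

Definition solves (m n : nat) (T : nat -> nat -> rat) (be : nat -> rat)
    (x : nat -> rat) : Prop :=
  forall i, (i < m)%N -> \sum_(j < n) T i j * x j = be i.

Lemma tab_ext m n T be p T' be' p' : tableau m n T be p ->
  (forall i j, (i < m)%N -> (j < n)%N -> T' i j = T i j) ->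
  (forall i, (i < m)%N -> be' i = be i) ->
  (forall j, (j < n)%N -> p' j = p j) -> tableau m n T' be' p'.
Proof.
move=> [mn pl pi id dec decb ind] hT hb hp; have lmn := fun i h => @leq_trans m i n h mn.
split=> //.
- by move=> j jn; rewrite hp ?pl.
- by move=> i j li lj; rewrite !hp //; apply: pi.
- by move=> i j li lj; rewrite hT ?id // (lmn j.+1).
- move=> r j hr hj; rewrite hp // -(dec _ _ hr hj).
  by apply: eq_bigr => i _; rewrite hT // hp // (lmn i.+1).
- move=> r hr; rewrite -(decb _ hr).
  by apply: eq_bigr => i _; rewrite hb // hp // (lmn i.+1).
- move=> y hy; apply: ind => r hr; rewrite -[RHS](hy _ hr).
  by apply: eq_bigr => i _; rewrite hp // (lmn i.+1).
Qed.

Lemma solves_ext m n T be x T' be' x' : solves m n T be x ->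
  (forall i j, (i < m)%N -> (j < n)%N -> T' i j = T i j) ->
  (forall i, (i < m)%N -> be' i = be i) ->
  (forall j, (j < n)%N -> x' j = x j) -> solves m n T' be' x'.
Proof.
move=> h hT hb hx i li; rewrite hb // -(h _ li).
by apply: eq_bigr => j _; rewrite hT // hx.
Qed.

(** The basis columns times the tableau give back all columns, and times [be] they give [b]. *)
Lemma tab_solves m n T be p x : tableau m n T be p -> solves m n T be x ->
  forall r, (r < m0)%N -> \sum_(j < n) a r (p j) * x j = b r.
Proof.
move=> t sx r hr; rewrite -(tab_decb t hr).
under eq_bigr => j _ do rewrite -(tab_dec t hr (ltn_ord j)) mulr_suml.
rewrite exchange_big /=; apply: eq_bigr => i _.
by rewrite -(sx _ (ltn_ord i)) mulr_sumr; apply: eq_bigr => j _; rewrite mulrA.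
Qed.

Definition moved (k l j : nat) : nat := if j == k then l else j.

Lemma tab_drop m n T be p k : tableau m n T be p -> (m <= k < n)%N ->
  tableau m n.-1 (fun i j => T i (moved k n.-1 j)) be (fun j => p (moved k n.-1 j)).
Proof.
move=> [mn pl pi id dec decb ind] /andP[mk kn]; rewrite /moved.
have lt j : (j < n.-1)%N -> ((if j == k then n.-1 else j) < n)%N by case: ifP; lia.
have le i : (i < m)%N -> (if i == k then n.-1 else i) = i by case: ifP; lia.
split.
- lia.
- by move=> j /lt/pl.
- move=> i j hi hj /(pi _ _ (lt _ hi) (lt _ hj)).
  by do 2!case: eqP; lia.
- by move=> i j hi hj; rewrite le // id.
- move=> r j hr /lt hj; rewrite -(dec _ _ hr hj).
  by apply: eq_bigr => i _; rewrite le.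
- by move=> r hr; rewrite -(decb _ hr); apply: eq_bigr => i _; rewrite le.
- move=> y hy; apply: ind => r hr; rewrite -[RHS](hy _ hr).
  by apply: eq_bigr => i _; rewrite le.
Qed.

Lemma solves_drop m n T be x k : solves m n T be x -> (k < n)%N -> x k = 0 ->
  solves m n.-1 (fun i j => T i (moved k n.-1 j)) be (fun j => x (moved k n.-1 j)).
Proof.
move=> sx kn xk i li; rewrite -(sx _ li) (sum_drop (fun j => T i j * x j) kn).
by rewrite xk mulr0 add0r.
Qed.

Definition pivoted (T : nat -> nat -> rat) (j k : nat) (f : nat -> rat) (i : nat) : rat :=
  if i == j then f j / T j k else f i - T i k * (f j / T j k).

(** Here [al] holds the old basis columns and the inner sum is the entering column written in that
    basis. The identity says that [pivoted] turns coordinates for the old basis into coordinates for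
    the new one. *)
Lemma pivotedE m (al T : nat -> nat -> rat) j k f r : (j < m)%N -> T j k != 0 ->
  \sum_(i < m) (if i == j :> nat then \sum_(l < m) al r l * T l k else al r i) *
    pivoted T j k f i = \sum_(i < m) al r i * f i.
Proof.
move=> jm T0.
rewrite (sumD1 (fun i => (if i == j then _ else al r i) * pivoted T j k f i) jm).
rewrite (sumD1 (fun i => al r i * f i) jm) /pivoted !eqxx.
rewrite (sumD1 (fun l => al r l * T l k) jm).
rewrite [X in _ + X = _](_ : _ = \sum_(i < m | i != j :> nat) al r i * f i -
    (\sum_(i < m | i != j :> nat) al r i * T i k) * (f j / T j k)).
  by field.
rewrite mulr_suml -sumrB; apply: eq_bigr => i /negPf ->.
by ring.
Qed.

Lemma tab_pivot m n T be p j k : tableau m n T be p ->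
  (j < m)%N -> (m <= k < n)%N -> T j k != 0 ->
  tableau m n (fun i c => pivoted T j k (T ^~ (swap j k c)) i)
    (pivoted T j k be) (fun c => p (swap j k c)).
Proof.
move=> [mn pl pi id dec decb ind] jm /andP[mk kn] T0.
have jn : (j < n)%N by lia.
have psw r i : (r < m0)%N -> (i < m)%N -> a r (p (swap j k i)) =
    if i == j then \sum_(l < m) a r (p l) * T l k else a r (p i).
  move=> hr hi; rewrite /swap; case: eqP => _; first by rewrite dec.
  by case: eqP => //; lia.
have key r f : (r < m0)%N -> \sum_(i < m) a r (p (swap j k i)) * pivoted T j k f i
    = \sum_(i < m) a r (p i) * f i.
  move=> hr; rewrite -(@pivotedE m (fun r i => a r (p i)) T j k f r jm T0).
  by apply: eq_bigr => i _; rewrite psw.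
split=> //.
- by move=> c cn; apply: pl; apply: swap_lt.
- move=> c d hc hd /pi e; apply: (can_inj (swapK j k)); apply: e; exact: swap_lt.
- move=> i c im cm; rewrite /pivoted /swap; case: (eqVneq c j) => [->|cj].
    by case: eqP => _; rewrite divff ?mulr1 ?subrr.
  have -> : (c == k) = false by lia.
  rewrite (id i c) // (id j c) // [j == c]eq_sym (negPf cj) mul0r mulr0 subr0.
  by case: eqP => // ->; rewrite eq_sym (negPf cj).
- by move=> r c hr hc; rewrite key // dec // swap_lt.
- by move=> r hr; rewrite key // decb.
(* A dependency [y] of the new basis, rewritten as a dependency [z] of the old one. *)
- move=> y hy; pose z i := (if i == j then 0 else y i) + T i k * y j.
  have z0 i : (i < m)%N -> z i = 0.
    apply: ind => r hr; rewrite -[RHS](hy _ hr).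
    rewrite (sumD1 (fun i => a r (p i) * z i) jm) /z eqxx add0r.
    rewrite (sumD1 (fun i => a r (p (swap j k i)) * y i) jm) psw // eqxx.
    rewrite (sumD1 (fun l => a r (p l) * T l k) jm) mulrDl mulrA -addrA.
    congr (_ + _); rewrite mulr_suml -big_split /=; apply: eq_bigr => l /negPf lj.
    by rewrite lj psw // lj mulrDr mulrA addrC.
  have yj : y j = 0.
    by have /eqP := z0 j jm; rewrite /z eqxx add0r mulf_eq0 (negPf T0) => /eqP.
  move=> i im; have := z0 i im; rewrite /z yj mulr0 addr0.
  by case: eqP => [->|].
Qed.

Lemma solves_pivot m n T be x j k : solves m n T be x ->
  (j < m)%N -> (j < n)%N -> (k < n)%N ->
  solves m n (fun i c => pivoted T j k (T ^~ (swap j k c)) i)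
    (pivoted T j k be) (fun c => x (swap j k c)).
Proof.
move=> sx jm jn kn i im.
rewrite (sum_swap (fun c => pivoted T j k (T ^~ c) i * x c) jn kn) /pivoted.
case: eqP => _.
  rewrite -(sx _ jm) mulr_suml; apply: eq_bigr => c _; ring.
rewrite -(sx _ jm) -(sx _ im) mulr_suml mulr_sumr -sumrB.
by apply: eq_bigr => c _; ring.
Qed.

(** Rows are exchanged along with positions, which keeps the identity block. This brings a row that
    is to be deleted to the end. *)
Lemma tab_swap_basis m n T be p j k : tableau m n T be p ->
  (j < m)%N -> (k < m)%N ->
  tableau m n (fun i c => T (swap j k i) (swap j k c)) (fun i => be (swap j k i))
    (fun c => p (swap j k c)).
Proof.
move=> [mn pl pi id dec decb ind] jm km.
have jn : (j < n)%N by lia.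
have kn : (k < n)%N by lia.
split=> //.
- by move=> c cn; apply: pl; apply: swap_lt.
- move=> c d hc hd /pi e; apply: (can_inj (swapK j k)); apply: e; exact: swap_lt.
- by move=> i c im cm; rewrite id ?swap_lt // (can_eq (swapK j k)).
- move=> r c hr hc; rewrite (sum_swap (fun i => a r (p i) * T i (swap j k c)) jm km).
  by rewrite dec // swap_lt.
- by move=> r hr; rewrite (sum_swap (fun i => a r (p i) * be i) jm km) decb.
- move=> y hy i im; rewrite -[i](swapK j k).
  apply: (ind (fun i => y (swap j k i))); last exact: swap_lt.
  move=> r hr; rewrite -[RHS](hy _ hr).
  rewrite -(sum_swap (fun i => a r (p i) * y (swap j k i)) jm km).
  by apply: eq_bigr => l _; rewrite swapK.
Qed.

Lemma solves_swap_basis m n T be x j k : solves m n T be x ->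
  (j < m)%N -> (k < m)%N -> (m <= n)%N ->
  solves m n (fun i c => T (swap j k i) (swap j k c)) (fun i => be (swap j k i))
    (fun c => x (swap j k c)).
Proof.
move=> sx jm km mn i im; rewrite -(sx _ (swap_lt jm km im)).
by rewrite (sum_swap (fun c => T (swap j k i) c * x c)) ?(leq_trans jm) ?(leq_trans km).
Qed.

(** No other column and not [b] has a component along the last basis column, so that column can
    leave the basis without a replacement. *)
Lemma tab_delete_last_row m n T be p : tableau m n T be p -> (0 < m)%N ->
  (forall c, (m <= c < n)%N -> T m.-1 c = 0) -> be m.-1 = 0 ->
  tableau m.-1 n.-1 (fun i c => T i (moved m.-1 n.-1 c)) be
    (fun c => p (moved m.-1 n.-1 c)).
Proof.
case: m => // m [mn pl pi id dec decb ind] _ /= T0 b0; rewrite /moved.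
have lt j : (j < n.-1)%N -> ((if j == m then n.-1 else j) < n)%N by case: ifP; lia.
have le i : (i < m)%N -> (if i == m then n.-1 else i) = i by case: ifP; lia.
split.
- lia.
- by move=> j /lt/pl.
- move=> i j hi hj /(pi _ _ (lt _ hi) (lt _ hj)).
  by do 2!case: eqP; lia.
- by move=> i j hi hj; rewrite le // id // ltnW.
- move=> r j hr hj; rewrite -(dec _ _ hr (lt _ hj)) big_ord_recr /=.
  have -> : T m (if j == m then n.-1 else j) = 0.
    case: eqP => [jm|/eqP jm]; first by rewrite T0 //; lia.
    case: (ltnP j m) => h; first by rewrite (id _ _ _ (leqW h)) // gtn_eqF.
    by rewrite T0 //; lia.
  by rewrite mulr0 addr0; apply: eq_bigr => i _; rewrite le.
- move=> r hr; rewrite -(decb _ hr) big_ord_recr /= b0 mulr0 addr0.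
  by apply: eq_bigr => i _; rewrite le.
- move=> y hy i im.
  have := ind (fun i => if (i < m)%N then y i else 0) _ i (ltnW im); rewrite im; apply.
  move=> r hr; rewrite -[RHS](hy _ hr) big_ord_recr /= ltnn mulr0 addr0.
  by apply: eq_bigr => l _; rewrite le // ltn_ord.
Qed.

Lemma solves_delete_last_row m n T be x : solves m n T be x -> (0 < m <= n)%N ->
  (forall i, (i < m.-1)%N -> T i m.-1 = 0) ->
  solves m.-1 n.-1 (fun i c => T i (moved m.-1 n.-1 c)) be
    (fun c => x (moved m.-1 n.-1 c)).
Proof.
move=> sx /andP[m1 mn] T0 i im.
have im' : (i < m)%N by lia.
rewrite -(sx _ im') (sum_drop (fun j => T i j * x j) (k := m.-1)); last lia.
by rewrite T0 // mul0r add0r.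
Qed.

(** Such a row reads [x j = be j]. *)
Lemma solves_zero_row m n T be p x j : tableau m n T be p -> solves m n T be x ->
  (j < m)%N -> (forall c, (m <= c < n)%N -> T j c = 0) -> x j = 0 -> be j = 0.
Proof.
move=> t sx jm T0 xj; rewrite -(sx _ jm) big1 // => c _.
case: (ltnP c m) => h; last by rewrite T0 ?mul0r // h ltn_ord.
by rewrite (tab_id t) //; case: eqP => [<-|]; rewrite ?xj ?mulr0 ?mul0r.
Qed.

End Tableau.

(** These values solve systems with the basis columns, so Cramer's rule bounds numerators by [U ^ 2]
    and denominators by [U]. The bound does not depend on the operations that led to the tableau. *)
Lemma tab_hgt m0 N0 (a : nat -> nat -> int) (b : nat -> int) m n T be p :
  tableau m0 N0 (fun r c => (a r c)%:~R) (fun r => (b r)%:~R) m n T be p ->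
  let U := entry_bound (\matrix_(r < m0, c < N0) a r c) (\col_(r < m0) b r) in
  (forall i j, (i < m)%N -> (j < n)%N -> (hgt (T i j) <= 2 * U ^ 2)%N) /\
  (forall i, (i < m)%N -> (hgt (be i) <= 2 * U ^ 2)%N).
Proof.
move=> [mn pl pi id dec decb ind] /=.
set A := \matrix_(r, c) _; set bb := \col_r _; pose U := entry_bound A bb.
rewrite -/U.
have ltn (i : 'I_m) : (i < n)%N by apply: leq_trans mn.
pose f (i : 'I_m) : 'I_N0 := Ordinal (pl _ (ltn i)).
have fi : injective f.
  by move=> i j /(congr1 val) /= e; apply: val_inj; apply: pi e.
pose AF : 'M[rat]_(m0, N0) := map_mx intr A.
have full : row_full (colsub f AF).
  rewrite -[row_full _]/(\rank _ == _) -mxrank_tr; apply: inj_row_free => v hv.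
  pose y i := if insub i is Some i' then v 0 i' else 0.
  apply/matrixP => i0 i; rewrite ord1 mxE.
  have -> : v 0 i = y i by rewrite /y valK.
  apply: ind (ltn_ord i) => r hr.
  have := congr1 (fun M : 'rV_m0 => M 0 (Ordinal hr)) hv; rewrite !mxE => h.
  rewrite -[RHS]h; apply: eq_bigr => l _.
  by rewrite /y valK !mxE mulrC.
pose g := fullrankfun full.
have gi : injective g by apply: fullrankfun_inj.
have Mu : (map_mx intr (mxsub g f A) : 'M[rat]_m) \in unitmx.
  have -> : map_mx intr (mxsub g f A) = rowsub g (colsub f AF).
    by apply/matrixP => i j; rewrite !mxE.
  exact: fullrowsub_unit.
have U1 : (0 < U)%N by apply: entry_bound_gt0.
have main (y : 'I_m0 -> int) (z : nat -> rat) :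
    (forall r, absz (y r) <= absz (bb r 0%R) \/ exists c, y r = A r c)%N ->
    (forall r : 'I_m0, \sum_(i < m) (a r (p i))%:~R * z i = (y r)%:~R) ->
    forall i, (i < m)%N -> (hgt (z i) <= 2 * U ^ 2)%N.
  move=> hy hz i im.
  have hM : (map_mx intr (mxsub g f A) : 'M[rat]_m) *m (\col_i z i) = \col_i (y (g i))%:~R.
    apply/matrixP => r c; rewrite ord1 [LHS]mxE [RHS]mxE -hz.
    by apply: eq_bigr => l _; rewrite !mxE.
  have [N [d [d0 db Nb /matrixP/(_ (Ordinal im) 0)]]] := cramer_bound gi fi hy Mu hM.
  rewrite !mxE /= => ->; apply: leq_trans (hgt_frac _ d0) _.
  have := Nb (Ordinal im); rewrite -/U in db *; nia.
split=> [i j im jn|i im].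
- apply: (main (fun r => A r (Ordinal (pl _ jn))) (T ^~ j)) => // [r|r].
    by right; exists (Ordinal (pl _ jn)).
  by rewrite dec // mxE.
- apply: (main (fun r => bb r 0) be) => // [r|r]; first by left.
  by rewrite decb // mxE.
Qed.

(** * The potential *)

(** The induction step is [(P - 1) (z n - 1) >= 0] for the product [P] of the earlier factors. *)
Lemma sum_le_prod (F : realFieldType) (n : nat) (z : nat -> F) : (forall j, 1 <= z j) ->
  \sum_(j < n) z j + 1 <= n%:R + \prod_(j < n) z j.
Proof.
move=> z1; elim: n => [|n IH]; first by rewrite !big_ord0 !add0r.
rewrite !big_ord_recr /= -natr1; have := z1 n.
have : 1 <= \prod_(j < n) z j by elim/big_ind: _ => // x y hx hy; apply: mulr_ege1.
set P := \prod_(j < n) _ in IH *; set Q := \sum_(j < n) _ in IH *.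
nra.
Qed.

(** Put [z_j = (4/3)^(d_j)]. One more step would pass below [q / w_j], so [w_j u_j < (4/3) q z_j].
    Summation gives [sum z_j > 3n/2], and [sum_le_prod] turns this into [prod z_j > n/2 + 1]. *)
Lemma shrink_progress (F : realFieldType) n (u w : nat -> F) (d : nat -> nat) q : (0 < n)%N -> 0 < q ->
  \sum_(j < n) w j * u j = q * (2 * n%:R) ->
  (forall j, (j < n)%N -> w j * u j * (3 / 4) ^+ (d j).+1 < q) ->
  (n < 2 ^ (\sum_(j < n) d j))%N.
Proof.
move=> n0 q0 Hs Hd; set D := (\sum_(j < n) d j)%N.
pose z j : F := (4 / 3) ^+ d j.
have z1 j : 1 <= z j by rewrite exprn_ege1 //; lra.
have wz j : (j < n)%N -> w j * u j < q * (4 / 3) * z j.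
  move=> /Hd; rewrite exprS => h.
  have e : z j * (3 / 4) ^+ d j = 1.
    by rewrite -exprMn (_ : 4 / 3 * (3 / 4) = 1) ?expr1n //; field.
  have z0 : 0 < z j by apply: lt_le_trans (z1 j).
  have h34 : 0 < 3 / 4 :> F by lra.
  rewrite -(ltr_pM2r h34).
  have -> : q * (4 / 3) * z j * (3 / 4) = q * z j by field.
  have -> : w j * u j * (3 / 4) = (w j * u j * (3 / 4 * (3 / 4) ^+ d j)) * z j.
    by rewrite -!mulrA [_ ^+ _ * z j]mulrC e mulr1.
  by rewrite ltr_pM2r.
have zP : \prod_(j < n) z j = (4 / 3) ^+ D by rewrite /D -expr_sum.
have hS : q * (2 * n%:R) < q * (4 / 3) * \sum_(j < n) z j.
  rewrite -Hs mulr_sumr; apply: ltr_sum; first by apply/hasP; exists (Ordinal n0); rewrite // mem_index_enum.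
  by move=> j _; apply: wz.
have := sum_le_prod n z1; rewrite zP => h1.
set y : F := (4 / 3) ^+ D in h1.
have hS' : 2 * n%:R < 4 / 3 * \sum_(j < n) z j.
  by rewrite -(ltr_pM2l q0) [ltRHS]mulrA.
have y1 : n%:R / 2 + 1 < y by lra.
have n1 : 1 <= n%:R :> F by rewrite ler1n.
have : n%:R < (2 ^ D)%:R :> F; last by rewrite ltr_nat.
(* Squaring passes to base 2: [(4/3)^2 <= 2], while [(n/2 + 1)^2 > n]. *)
have yy : y ^+ 2 <= 2 ^+ D.
  by rewrite -exprM mulnC exprM lerXn2r ?nnegrE //; lra.
rewrite natrX; apply: lt_le_trans yy.
have : (n%:R / 2 + 1) ^+ 2 < y ^+ 2 by rewrite ltr_pXn2r ?nnegrE //; lra.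
rewrite !expr2; nra.
Qed.

Lemma weighted_decrease rho s s' x x' d : (s' + d = s)%N -> (x' <= x)%N ->
  (x' < x)%N \/ (rho <= 2 * d)%N -> (2 * s' + rho * x' + rho <= 2 * s + rho * x)%N.
Proof.
move=> <- hx [h|h].
  have : (rho * x'.+1 <= rho * x)%N by rewrite leq_mul2l h orbT.
  rewrite mulnS; lia.
have : (rho * x' <= rho * x)%N by rewrite leq_mul2l hx orbT.
lia.
Qed.

Section Potential.
Variables (n E rho q : nat).
Hypothesis rq : (rho <= 2 * q)%N.

Definition steps (e : nat -> nat) : nat := (\sum_(c < n) (E - e c))%N.
Definition alive (e : nat -> nat) : nat := (\sum_(c < n) (e c < E))%N.
(** A round must lower this by [rho]. If more than [E * 2 ^ q] steps are left, over [2 ^ q]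
    variables are alive, and a call that kills none of them makes more than [q] steps, worth [rho]
    in the first term. Otherwise a single step lowers the minimum. A death lowers [alive]. *)
Definition potential (e : nat -> nat) : nat :=
  (2 * steps e + rho * (minn (steps e) (E * 2 ^ q) + alive e))%N.

Lemma steps_alive e : (steps e <= alive e * E)%N.
Proof.
rewrite /alive big_distrl /=; apply: leq_sum => c _.
by case: ltnP => h; rewrite ?mul1n ?leq_subr // mul0n leqn0 subn_eq0.
Qed.

Lemma potential_decrease e e' d :
  (forall c, (c < n)%N -> (e c <= e' c)%N) ->
  (steps e' + d = steps e)%N ->
  (exists2 c, (c < n)%N & (e c < E <= e' c)%N) \/ (0 < alive e /\ alive e < 2 ^ d)%N ->
  (potential e' + rho <= potential e)%N.
Proof.
move=> ee' sd; rewrite /potential.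
have ha : (alive e' <= alive e)%N.
  by apply: leq_sum => c _; case: (ltnP (e' c)) => // h; rewrite (leq_ltn_trans (ee' _ _) h).
have hs : (minn (steps e') (E * 2 ^ q) <= minn (steps e) (E * 2 ^ q))%N.
  by rewrite leq_min geq_minr andbT geq_min -sd leq_addr.
move=> H; apply: (weighted_decrease sd); first exact: leq_add.
case: H => [[c0 cn /andP[h1 h2]]|[a0 ad]].
  have h : (alive e' < alive e)%N.
    rewrite /alive (bigD1 (Ordinal cn)) //= [ltnRHS](bigD1 (Ordinal cn)) //= h1.
    have -> : (e' c0 < E)%N = false by lia.
    rewrite add0n ltnS; apply: leq_sum => c _.
    by case: (ltnP (e' c)) => // h; rewrite (leq_ltn_trans (ee' _ _) h).
  by left; lia.
have d0 : (0 < d)%N by case: d ad {sd} => //; lia.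
have [hT|hT] := leqP (steps e) (E * 2 ^ q); first by left; lia.
right; have hq : (q < d)%N.
  rewrite -(ltn_exp2l _ _ (isT : 1 < 2)%N); apply: leq_ltn_trans ad.
  have h := leq_trans hT (steps_alive e); rewrite mulnC in h.
  by move: h; rewrite ltn_mul2r => /andP[_ /ltnW].
lia.
Qed.

End Potential.

(** The power is about [sqrt n]. With [q] one less than the rounded half, [2 ^ (2 q) <= 2 n] and
    [rho <= 2 * 2 ^ q], which gives the factor 8. *)
Lemma sqrt_log_bound n : (2 <= n)%N ->
  let rho := up_log 2 n in
  [/\ (0 < rho)%N, (rho <= n)%N, (rho <= 2 * uphalf rho)%N &
      (rho * 2 ^ uphalf rho <= 8 * n)%N].
Proof.
move=> n2 rho; have r0 : (0 < rho)%N by rewrite up_log_gt0.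
have hn : (2 ^ rho.-1 < n)%N by apply: up_log_gtn.
have rn : (rho <= n)%N.
  by have := ltn_expl rho.-1 (isT : 1 < 2)%N; lia.
have hq : (rho <= 2 * uphalf rho)%N by rewrite mul2n uphalfK; lia.
split=> //; set q := uphalf rho in hq *.
have hq' : (2 * q <= rho.+1)%N.
  by rewrite mul2n /q uphalfK; case: (odd rho); lia.
case: q hq hq' => [|q] hq hq'; first by lia.
have h1 : (2 ^ (2 * q) <= 2 * n)%N.
  apply: leq_trans (_ : 2 ^ rho <= _)%N; first by rewrite leq_exp2l //; lia.
  by rewrite -(prednK r0) expnS; lia.
have h2 := ltn_expl q (isT : 1 < 2)%N.
move: h1; rewrite mul2n -addnn expnD expnS => h1.
nia.
Qed.

(** Since [(3/4)^3 <= 1/2], [6 La] steps divide by at least [U^2], which leaves [3 < 4]. The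
    exponent is known to the analysis only; the program tests the inequality. *)
Lemma threshold_exponent (F : realFieldType) (U La : nat) : (2 <= U)%N -> (U <= 2 ^ La)%N ->
  exists E : nat, [/\ (0 < E <= 6 * La)%N &
    forall e, (e < E)%N = (4 <= 3 * U%:R * (U%:R * (3 / 4) ^+ e) :> F)].
Proof.
move=> U2 UL; pose P e := 3 * U%:R * (U%:R * (3 / 4) ^+ e) < 4 :> F.
have P1 : P (6 * La)%N.
  rewrite /P.
  have h : (3 / 4) ^+ (6 * La) <= ((2 ^ La)%:R ^+ 2)^-1 :> F.
    rewrite natrX -exprM -exprVn (_ : (6 * La = 3 * (La * 2))%N); last lia.
    by rewrite exprM lerXn2r ?nnegrE //; lra.
  have hU : (U%:R : F) ^+ 2 <= (2 ^ La)%:R ^+ 2.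
    by rewrite lerXn2r ?nnegrE // ler_nat.
  have p0 : 0 < ((2 ^ La)%:R : F) ^+ 2 by rewrite exprn_gt0 // ltr0n expn_gt0.
  have U0 : 0 < U%:R :> F by rewrite ltr0n; lia.
  have : U%:R ^+ 2 * (3 / 4) ^+ (6 * La) <= 1 :> F.
    apply: le_trans (_ : (2 ^ La)%:R ^+ 2 * ((2 ^ La)%:R ^+ 2)^-1 <= _); last first.
      by rewrite divff // gt_eqF.
    by apply: ler_pM => //; rewrite exprn_ge0 //; lra.
  by rewrite expr2; lra.
have ex : exists e, P e by exists (6 * La)%N.
exists (ex_minn ex); case: ex_minnP => E PE Emin; split.
  rewrite Emin // andbT lt0n; apply: contraTneq PE => ->.
  rewrite /P -leNgt expr0 mulr1.
  have : 2 <= U%:R :> F by rewrite ler_nat.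
  nra.
move=> e; apply/idP/idP => h.
  by rewrite leNgt; apply: contraL h => /Emin; rewrite leqNgt.
rewrite ltnNge; apply: contraL h => h; rewrite -ltNge; apply: le_lt_trans PE.
rewrite ler_wpM2l ?mulr_ge0 ?ler0n // ler_wpM2l // ler_wiXn2l //; lra.
Qed.

(** As [ln 2 <= 1], the natural logarithm is at most [up_log 2]. *)
Lemma div_ln_bound (R : realType) (n k X : nat) : (2 <= n)%N ->
  (up_log 2 n * k <= X)%N -> (k%:R : R) <= X%:R / ln n%:R.
Proof.
move=> n2 h.
have n0 : 0 < n%:R :> R by rewrite ltr0n; lia.
have l0 : 0 < ln n%:R :> R by rewrite ln_gt0 // ltr1n.
have l1 : ln n%:R <= (up_log 2 n)%:R :> R.
  have h1 : (n%:R : R) <= 2 ^+ up_log 2 n by rewrite -natrX ler_nat up_logP.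
  apply: le_trans (_ : ln (2 ^+ up_log 2 n) <= _).
    by rewrite ler_ln ?posrE // exprn_gt0.
  rewrite lnXn //.
  have h2 : ln 2 <= 1 :> R.
    by have := @le_ln1Dx R 1 _; rewrite -[1 + 1]/(2%:R); apply; lra.
  by rewrite -[leRHS]mulr1 -[leLHS]mulr_natr mulrC ler_wpM2l.
rewrite ler_pdivlMr //; apply: le_trans (_ : (up_log 2 n * k)%:R <= _); last by rewrite ler_nat.
by rewrite natrM mulrC ler_wpM2r.
Qed.

(** * The program *)

(* The arrays from 9 on are private: [aTop] holds [U], [aP] the original column of
   each position, [aS] a copy of [A], and [aY] the solution in the original order. *)
Notation aM := 0%N (only parsing).
Notation aN := 1%N (only parsing).
Notation aA := 2%N (only parsing).
Notation aB := 3%N (only parsing).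
Notation aU := 4%N (only parsing).
Notation aAns := 5%N (only parsing).
Notation aX := 6%N (only parsing).
Notation aW := 8%N (only parsing).
Notation aN0 := 9%N (only parsing).
Notation aTop := 10%N (only parsing).
Notation aP := 11%N (only parsing).
Notation aY := 12%N (only parsing).
Notation aRun := 13%N (only parsing).
Notation aI := 14%N (only parsing).
Notation aJ := 15%N (only parsing).
Notation aK := 16%N (only parsing).
Notation aQ := 17%N (only parsing).
Notation aC := 18%N (only parsing).
Notation aS := 19%N (only parsing).
Notation aM0 := 20%N (only parsing).
Notation aTot := 21%N (only parsing).
Notation aT := 22%N (only parsing).

Definition put1 a x e := Assign a (V x) (Cst 0) e.
Definition put2 a x y e := Assign a (V x) (V y) e.

Definition drop_column : cmd :=
  Seq (Set1 aN (Op Defs.Sub (V aN) (Cst 1)))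
  (Seq (For aI (Cst 0) aM (put2 aA aI aK (G2 aA aI aN)))
  (Seq (put1 aP aK (G1 aP aN)) (put1 aU aK (G1 aU aN)))).

(** The basic block is the identity before and after, so the columns below [aM] are not touched. The
    leaving column is not stored at position [aK], because [drop_column] removes that position at
    once. The factor of a row is saved in [aQ], since the loop also overwrites column [aK]. *)
Definition pivot : cmd :=
  Seq (Set1 aQ (G2 aA aJ aK))
  (Seq (For aC (V aM) aN (put2 aA aJ aC (Op Div (G2 aA aJ aC) (V aQ))))
  (Seq (put1 aB aJ (Op Div (G1 aB aJ) (V aQ)))
  (Seq (For aI (Cst 0) aM
         (If (Cmp Eq (V aI) (V aJ)) Skip
           (Seq (Set1 aQ (G2 aA aI aK))
           (Seq (For aC (V aM) aN (put2 aA aI aC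
                   (Op Defs.Sub (G2 aA aI aC) (Op Mul (V aQ) (G2 aA aJ aC)))))
                (put1 aB aI (Op Defs.Sub (G1 aB aI) (Op Mul (V aQ) (G1 aB aJ))))))))
  (Seq (put1 aP aJ (G1 aP aK)) (put1 aU aJ (G1 aU aK)))))).

(** The last row takes the place of row [aJ] together with its basic variable. Columns to the left
    of the new [aM] stay, since the basic block remains the identity. [aK] marks the freed position
    for [drop_column]. *)
Definition delete_row : cmd :=
  Seq (Set1 aM (Op Defs.Sub (V aM) (Cst 1)))
  (Seq (For aC (V aM) aN (put2 aA aJ aC (G2 aA aM aC)))
  (Seq (put1 aB aJ (G1 aB aM))
  (Seq (put1 aP aJ (G1 aP aM))
  (Seq (put1 aU aJ (G1 aU aM)) (Set1 aK (V aM)))))).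

(** The value 0 signals that the row vanishes off the basis. It cannot be a nonbasic position,
    because [search] runs only for a basic [aJ], hence with [0 < m]. *)
Definition search : cmd :=
  Seq (Set1 aK (Cst 0))
    (For aC (V aM) aN (If (Cmp Eq (G2 aA aJ aC) (Cst 0)) Skip (Set1 aK (V aC)))).

Ltac ev_tac :=
  lazymatch goal with
  | |- ev _ (Cst _) _ => apply: ev_N; done
  | |- ev _ (V _) _ => apply: ev_V; first [eassumption | reflexivity]
  | |- ev _ (G1 _ _) _ => apply: ev_G1; [eassumption | first [eassumption | reflexivity]]
  | |- ev _ (G2 _ _ _) _ =>
      apply: ev_G2; [eassumption | eassumption | first [eassumption | reflexivity]]
  | |- ev _ (Op Add _ _) _ => apply: ev_add; ev_tac
  | |- ev _ (Op Defs.Sub _ _) _ => apply: ev_sub; ev_tac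
  | |- ev _ (Op Mul _ _) _ => apply: ev_mul; ev_tac
  end.

(** * Specifications of the tableau operations *)

Section Specs.
Variables (B : cmd) (S : nat).
Hypothesis S3 : (3 <= S)%N.

Lemma natrB1 (n : nat) : (0 < n)%N -> n%:R - 1%N%:R = n.-1%:R :> rat.
Proof. by move=> n0; rewrite -natrB // subn1. Qed.

Lemma wp_put1 a x e i q o l s (Q : nat -> nat -> memory -> Prop) :
  s x 0%N 0%N = i%:R -> ev s e q -> (ewidth e <= 8)%N ->
  (bounded S s -> (hgt q <= 2 ^ S)%N) ->
  Q (o + eops e)%N l (upd s a i 0 q) -> wp B S (put1 a x e) o l s Q.
Proof.
move=> hx he we hq HQ.
by apply: (wp_assign S3 (ev_V hx) (@ev_N s 0 isT) he); rewrite // geq_max we.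
Qed.

Lemma wp_put2 a x y e i j q o l s (Q : nat -> nat -> memory -> Prop) :
  s x 0%N 0%N = i%:R -> s y 0%N 0%N = j%:R -> ev s e q -> (ewidth e <= 8)%N ->
  (bounded S s -> (hgt q <= 2 ^ S)%N) ->
  Q (o + eops e)%N l (upd s a i j q) -> wp B S (put2 a x y e) o l s Q.
Proof.
move=> hx hy he we hq HQ.
by apply: (wp_assign S3 (ev_V hx) (ev_V hy) he); rewrite // geq_max we.
Qed.

Lemma wp_frame c o l (s : memory) Q :
  wp B S c o l s (fun o' l' s' => frame (mods c) s s' -> Q o' l' s') -> wp B S c o l s Q.
Proof. by apply: wp_conseq => o' l' s' _ fr; apply. Qed.

Lemma wp_drop m n k o l (s : memory) (Q : nat -> nat -> memory -> Prop) :
  s aM 0%N 0%N = m%:R -> s aN 0%N 0%N = n%:R -> s aK 0%N 0%N = k%:R ->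
  (0 < n)%N -> (n < 2 ^ S)%N -> (m < 2 ^ S)%N ->
  (forall o' (s' : memory), (o' <= o + 2 * m + 2)%N -> s' aN 0%N 0%N = n.-1%:R ->
    (forall i j, s' aA i j = if (i < m)%N then s aA i (moved k n.-1 j) else s aA i j) ->
    (forall j, s' aP j 0%N = s aP (moved k n.-1 j) 0%N) ->
    (forall j, s' aU j 0%N = s aU (moved k n.-1 j) 0%N) ->
    frame (mods drop_column) s s' -> Q o' l s') ->
  wp B S drop_column o l s Q.
Proof.
move=> hm hn hk n0 nS mS HQ; apply: wp_frame; rewrite /drop_column.
apply: wp_seq; apply: (wp_set S3); [ev_tac | by [] | |].
  by move=> _; rewrite natrB1 // hgt_nat; lia.
rewrite natrB1 //; set s1 := upd _ _ _ _ _.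
apply: wp_seq; pose I i (s' : memory) := forall i' j,
  s' aA i' j = if (i' < i)%N then s aA i' (moved k n.-1 j) else s aA i' j.
apply: (wp_for S3 (I := I) (i0 := 0) (n := m) (K := 0)) => //.
  move=> i s2 /andP[_ im] hi Ii bs fr.
  apply: (wp_put2 (i := i) (j := k) (q := s aA i n.-1)) => //.
  - by rewrite fr.
  - apply: (ev_G2 (i := i) (j := n.-1)) => //; first by rewrite fr.
    by rewrite Ii ltnn.
  - by move=> _; have := bs aA i n.-1; rewrite Ii ltnn.
  split=> // _ i' j; rewrite !updE /= Ii ltnS.
  have [->|ii] := eqVneq i' i; rewrite /= /moved ?ltnn ?leqnn; first by case: eqP.
  by rewrite [(i' <= i)%N]leq_eqVlt (negPf ii).
move=> o1 s2 ho1 I2 hi fr.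
have hk2 : s2 aK 0%N 0%N = k%:R by rewrite fr.
have hn2 : s2 aN 0%N 0%N = n.-1%:R by rewrite fr.
apply: wp_seq; apply: wp_put1; [eassumption | ev_tac | by [] | by [] |].
apply: wp_put1; [eassumption | ev_tac | by [] | by [] |].
move=> fr3; apply: HQ fr3.
- by move: ho1 => /=; lia.
- exact: hn2.
- by move=> i j; apply: I2.
- by move=> j; rewrite !updE /= /moved fr //; case: eqP.
- by move=> j; rewrite !updE /= /moved fr //; case: eqP.
Qed.

Lemma wp_search m n j o l (s : memory) (Q : nat -> nat -> memory -> Prop) :
  s aM 0%N 0%N = m%:R -> s aN 0%N 0%N = n%:R -> s aJ 0%N 0%N = j%:R ->
  (j < m)%N -> (m <= n)%N -> (n < 2 ^ S)%N ->
  (forall o' (s' : memory) k, (o' <= o + 3 * n + 1)%N -> s' aK 0%N 0%N = k%:R ->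
    (k = 0%N /\ forall c, (m <= c < n)%N -> s aA j c = 0) \/
    ((m <= k < n)%N /\ s aA j k != 0) ->
    frame (mods search) s s' -> Q o' l s') ->
  wp B S search o l s Q.
Proof.
move=> hm hn hj jm mn nS HQ; apply: wp_frame; rewrite /search.
apply: wp_seq; apply: (wp_set S3); [ev_tac | by [] | by move=> _; rewrite hgt_nat; lia |].
set s1 := upd _ _ _ _ _.
pose I c (s' : memory) := exists2 k, s' aK 0%N 0%N = k%:R &
    (k = 0%N /\ forall c', (m <= c' < c)%N -> s aA j c' = 0) \/
    ((m <= k < n)%N /\ s aA j k != 0).
apply: (wp_for S3 (I := I) (i0 := m) (n := n) (K := 1)) => //.
- by exists 0%N => //; left; split=> // c'; lia.
- move=> c s2 /andP[mc cn] hc [k hk hkP] bs fr.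
  have hj2 : s2 aJ 0%N 0%N = j%:R by rewrite fr.
  have hA2 : s2 aA j c = s aA j c by rewrite fr.
  apply: (wp_if S3); [ev_tac | ev_tac | by [] |].
  rewrite /=; case: eqP => h0.
    apply: wp_skip; split=> // _; exists k => //.
    case: hkP => [[k0 hk0]|]; [left; split=> // c' /andP[h1 h2] | by right].
    by case: (ltngtP c' c) => h3; [apply: hk0; lia | lia | rewrite h3].
  apply: (wp_set S3); [ev_tac | by [] | by move=> _; rewrite hgt_nat; lia |].
  split=> // _; exists c => //; right; split; [lia | exact/eqP].
- move=> o1 s2 ho1 [k hk hkP] hc fr fr2; apply: (HQ _ _ k) => //.
  by move: ho1 => /=; lia.
Qed.

Lemma wp_delete_row m n j o l (s : memory) (Q : nat -> nat -> memory -> Prop) :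
  s aM 0%N 0%N = m%:R -> s aN 0%N 0%N = n%:R -> s aJ 0%N 0%N = j%:R ->
  (j < m)%N -> (m <= n)%N -> (n < 2 ^ S)%N ->
  (forall o' (s' : memory), (o' <= o + 2 * n + 2)%N -> s' aM 0%N 0%N = m.-1%:R ->
    s' aK 0%N 0%N = m.-1%:R ->
    (forall i c, s' aA i c = if (i == j) && (m.-1 <= c < n)%N then s aA m.-1 c else s aA i c) ->
    (forall i, s' aB i 0%N = s aB (moved j m.-1 i) 0%N) ->
    (forall i, s' aP i 0%N = s aP (moved j m.-1 i) 0%N) ->
    (forall i, s' aU i 0%N = s aU (moved j m.-1 i) 0%N) ->
    frame (mods delete_row) s s' -> Q o' l s') ->
  wp B S delete_row o l s Q.
Proof.
move=> hm hn hj jm mn nS HQ; apply: wp_frame; rewrite /delete_row.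
have m0 : (0 < m)%N by lia.
apply: wp_seq; apply: (wp_set S3); [ev_tac | by [] | |].
  by move=> _; rewrite natrB1 // hgt_nat; lia.
rewrite natrB1 //; set s1 := upd _ _ _ _ _.
have hm1 : s1 aM 0%N 0%N = m.-1%:R by [].
apply: wp_seq; pose I c (s' : memory) := forall i' c',
  s' aA i' c' = if (i' == j) && (m.-1 <= c' < c)%N then s aA m.-1 c' else s aA i' c'.
apply: (wp_for S3 (I := I) (i0 := m.-1) (n := n) (K := 0)) => //.
- by lia.
- by move=> i c; case: ifP => //; lia.
- move=> c s2 /andP[mc cn] hc Ic bs fr.
  have hj2 : s2 aJ 0%N 0%N = j%:R by rewrite fr.
  have hm2 : s2 aM 0%N 0%N = m.-1%:R by rewrite fr.
  have hA2 : s2 aA m.-1 c = s aA m.-1 c by rewrite Ic ltnn !andbF.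
  apply: wp_put2; [eassumption | eassumption | ev_tac | by [] | by rewrite -hA2 |].
  split=> // _ i' c'; rewrite !updE /= Ic.
  have [->|ii] := eqVneq i' j; rewrite //=.
  have [->|cc] := eqVneq c' c; first by rewrite mc ltnS leqnn.
  by rewrite ltnS [(c' <= c)%N]leq_eqVlt (negPf cc).
move=> o1 s2 ho1 I2 hc fr.
have hj2 : s2 aJ 0%N 0%N = j%:R by rewrite fr.
have hm2 : s2 aM 0%N 0%N = m.-1%:R by rewrite fr.
apply: wp_seq; apply: wp_put1; [eassumption | ev_tac | by [] | by [] |].
apply: wp_seq; apply: wp_put1; [eassumption | ev_tac | by [] | by [] |].
apply: wp_seq; apply: wp_put1; [eassumption | ev_tac | by [] | by [] |].
apply: (wp_set S3); [ev_tac | by [] | by move=> _; rewrite hgt_nat; lia |].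
move=> fr3; apply: HQ fr3 => //.
- by move: ho1 => /=; lia.
- by move=> i; rewrite !updE /= /moved fr //; case: eqP.
- by move=> i; rewrite !updE /= /moved fr //; case: eqP.
- by move=> i; rewrite !updE /= /moved fr //; case: eqP.
Qed.

(** A new entry [x - y * (z / t)] has height at most [2 ^ (4 * S1)]. The growth does not accumulate:
    [tab_hgt] brings the entries of every tableau back below [2 ^ S1]. *)
Lemma wp_pivot S1 m n j k o l (s : memory) (Q : nat -> nat -> memory -> Prop) :
  s aM 0%N 0%N = m%:R -> s aN 0%N 0%N = n%:R -> s aJ 0%N 0%N = j%:R ->
  s aK 0%N 0%N = k%:R -> (j < m)%N -> (m <= k < n)%N -> (n < 2 ^ S)%N ->
  s aA j k != 0 -> (4 * S1 <= S)%N ->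
  (forall i c, (i < m)%N -> (c < n)%N -> (hgt (s aA i c) <= 2 ^ S1)%N) ->
  (forall i, (i < m)%N -> (hgt (s aB i 0) <= 2 ^ S1)%N) ->
  (forall o' (s' : memory), (o' <= o + 16 + 15 * (n * n))%N ->
    (forall i c, (i < m)%N -> s' aA i c =
      if (m <= c < n)%N then pivoted (s aA) j k (s aA ^~ c) i else s aA i c) ->
    (forall i, (i < m)%N -> s' aB i 0%N = pivoted (s aA) j k (s aB ^~ 0%N) i) ->
    (forall i, s' aP i 0%N = s aP (moved j k i) 0%N) ->
    (forall i, s' aU i 0%N = s aU (moved j k i) 0%N) ->
    frame (mods pivot) s s' -> Q o' l s') ->
  wp B S pivot o l s Q.
Proof.
move=> hm hn hj hk jm /andP[mk kn] nS T0 S14 hA hB HQ; apply: wp_frame; rewrite /pivot.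
have le4 h : (h <= 2 ^ (4 * S1) -> h <= 2 ^ S)%N.
  by move=> h1; apply: leq_trans h1 _; rewrite leq_exp2l.
have hdiv x y : (hgt x <= 2 ^ S1 -> hgt y <= 2 ^ S1 -> hgt (x / y) <= 2 ^ (2 * S1))%N.
  move=> h1 h2; apply: leq_trans (hgt_div _ _) _.
  by rewrite mul2n -addnn expnD leq_mul.
have hmsub x y z : (hgt x <= 2 ^ S1 -> hgt y <= 2 ^ S1 -> hgt z <= 2 ^ (2 * S1) ->
    hgt (x - y * z) <= 2 ^ S)%N.
  move=> h1 h2 h3; apply: le4; apply: leq_trans (hgtB _ _) _.
  rewrite (_ : 4 * S1 = S1 + (S1 + 2 * S1))%N; last lia.
  rewrite 2!expnD; apply: leq_mul h1 _; apply: leq_trans (hgtM _ _) _.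
  exact: leq_mul h2 h3.
set q := s aA j k in T0 *.
apply: wp_seq; apply: (wp_set S3); [ev_tac | by [] | by [] |].
set s1 := upd _ _ _ _ _.
apply: wp_seq; pose I c (s' : memory) := forall i' c',
  s' aA i' c' = if (i' == j) && (m <= c' < c)%N then s aA j c' / q else s aA i' c'.
apply: (wp_for S3 (I := I) (i0 := m) (n := n) (K := 1)) => //.
- by lia.
- by move=> i c; case: ifP => //; lia.
- move=> c s2 /andP[mc cn] hc Ic bs fr.
  have hj2 : s2 aJ 0%N 0%N = j%:R by rewrite fr.
  have hq2 : s2 aQ 0%N 0%N = q by rewrite fr.
  have hA2 : s2 aA j c = s aA j c by rewrite Ic ltnn !andbF.
  apply: wp_put2; [eassumption | eassumption | apply: (ev_div T0); ev_tac | by [] | |].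
    by move=> _; apply: le4; apply: leq_trans (hdiv _ _ (hA _ _ jm cn) (hA _ _ jm kn)) _;
       rewrite leq_exp2l //; lia.
  split=> // _ i' c'; rewrite !updE /= Ic.
  have [->|ii] := eqVneq i' j; rewrite //=.
  have [->|cc] := eqVneq c' c; first by rewrite mc ltnS leqnn.
  by rewrite ltnS [(c' <= c)%N]leq_eqVlt (negPf cc).
move=> o1 s2 ho1 I2 hc fr2.
have hj2 : s2 aJ 0%N 0%N = j%:R by rewrite fr2.
have hq2 : s2 aQ 0%N 0%N = q by rewrite fr2.
have hm2 : s2 aM 0%N 0%N = m%:R by rewrite fr2.
have hn2 : s2 aN 0%N 0%N = n%:R by rewrite fr2.
have hk2 : s2 aK 0%N 0%N = k%:R by rewrite fr2.
have hB2 i : s2 aB i 0%N = s aB i 0%N by rewrite fr2.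
apply: wp_seq; apply: wp_put1; [eassumption | apply: (ev_div T0); ev_tac | by [] | |].
  move=> _; rewrite hB2; apply: le4; apply: leq_trans (hdiv _ _ (hB _ jm) (hA _ _ jm kn)) _.
  by rewrite leq_exp2l //; lia.
set s3 := upd _ _ _ _ _; rewrite hB2 in s3 *.
apply: wp_seq; pose I' i (s' : memory) :=
  (forall i' c', s' aA i' c' = if (m <= c' < n)%N && ((i' < i)%N || (i' == j))
    then pivoted (s aA) j k (s aA ^~ c') i' else s aA i' c') /\
  (forall i', s' aB i' 0%N = if (i' < i)%N || (i' == j)
    then pivoted (s aA) j k (s aB ^~ 0%N) i' else s aB i' 0%N).
apply: (wp_for S3 (I := I') (i0 := 0) (n := m) (K := 6 + 5 * n)) => //.
- by lia.
- split=> [i c|i].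
    rewrite updE /= /s3 updE /= I2 /pivoted /=.
    by case: eqP => [->|_]; rewrite ?andbT ?andbF.
  rewrite updE /= /s3 updE /= /pivoted andbT; case: eqP => _ //=; exact: hB2.
- move=> i s4 /andP[_ im] hi [IA IB] bs4 fr4.
  have hj4 : s4 aJ 0%N 0%N = j%:R by rewrite fr4.
  apply: (wp_if S3); [ev_tac | ev_tac | by [] |].
  rewrite /= eqr_nat; case: eqP => [ij|/eqP ij].
    have le_lt i' : ((i' < i.+1) || (i' == j) = (i' < i) || (i' == j))%N.
      by rewrite ij ltnS; lia.
    by apply: wp_skip; split=> // _; split=> [i' c'|i']; rewrite updE /= ?IA ?IB le_lt.
  have hk4 : s4 aK 0%N 0%N = k%:R by rewrite fr4.
  have hm4 : s4 aM 0%N 0%N = m%:R by rewrite fr4.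
  have hn4 : s4 aN 0%N 0%N = n%:R by rewrite fr4.
  have hA4 c : s4 aA i c = s aA i c by rewrite IA ltnn (negPf ij) andbF.
  have hAj4 c : (m <= c < n)%N -> s4 aA j c = s aA j c / q.
    by move=> h; rewrite IA h eqxx orbT /= /pivoted eqxx.
  have hB4 : s4 aB i 0%N = s aB i 0%N by rewrite IB ltnn (negPf ij).
  have hBj4 : s4 aB j 0%N = s aB j 0%N / q by rewrite IB eqxx orbT /pivoted eqxx.
  apply: wp_seq; apply: (wp_set S3); [ev_tac | by [] | by [] |].
  rewrite hA4; set s5 := upd _ _ _ _ _.
  apply: wp_seq; pose J c (s' : memory) := forall i' c',
    s' aA i' c' = if (i' == i) && (m <= c' < c)%N
      then pivoted (s aA) j k (s aA ^~ c') i else s4 aA i' c'.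
  apply: (wp_for S3 (I := J) (i0 := m) (n := n) (K := 2)) => //.
  + by lia.
  + by move=> i' c; case: ifP => //; lia.
  + move=> c s6 /andP[mc cn] hc6 Jc bs fr6.
    have hi6 : s6 aI 0%N 0%N = i%:R by rewrite fr6.
    have hj6 : s6 aJ 0%N 0%N = j%:R by rewrite fr6.
    have hq6 : s6 aQ 0%N 0%N = s aA i k by rewrite fr6.
    have hA6 : s6 aA i c = s aA i c by rewrite Jc ltnn !andbF hA4.
    have hAj6 : s6 aA j c = s aA j c / q.
      by rewrite Jc eq_sym (negPf ij) hAj4 // mc.
    apply: wp_put2; [eassumption | eassumption | ev_tac | by [] | |].
      by move=> _; apply: hmsub; rewrite ?hA // hdiv ?hA.
    split=> // _ i' c'; rewrite !updE /= Jc.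
    have [->|ii] := eqVneq i' i; rewrite //=.
    have [->|cc] := eqVneq c' c.
      by rewrite mc ltnS leqnn /= /pivoted (negPf ij).
    by rewrite ltnS [(c' <= c)%N]leq_eqVlt (negPf cc).
  move=> o6 s6 ho6 J6 hc6 fr6.
  have hi6 : s6 aI 0%N 0%N = i%:R by rewrite fr6.
  have hj6 : s6 aJ 0%N 0%N = j%:R by rewrite fr6.
  have hq6 : s6 aQ 0%N 0%N = s aA i k by rewrite fr6.
  have hB6 i' : s6 aB i' 0%N = s4 aB i' 0%N by rewrite fr6.
  have hBi6 : s6 aB i 0%N = s aB i 0%N by rewrite hB6.
  have hBj6 : s6 aB j 0%N = s aB j 0%N / q by rewrite hB6.
  apply: wp_put1; [eassumption | ev_tac | by [] | |].
    by move=> _; apply: hmsub; rewrite ?hB ?hA // hdiv ?hA ?hB.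
  split=> //; first by move: ho6 => /=; nia.
  move=> _; split=> [i' c'|i']; rewrite !updE /= ltnS.
    rewrite J6 IA; have [->|ii] := eqVneq i' i.
      by rewrite ltnn leqnn (negPf ij) andbF andbT.
    by rewrite [(i' <= i)%N]leq_eqVlt (negPf ii).
  rewrite hB6 IB; have [->|ii] := eqVneq i' i.
    by rewrite leqnn /= /pivoted (negPf ij).
  by rewrite [(i' <= i)%N]leq_eqVlt (negPf ii).
move=> o4 s4 ho4 [IA IB] hi4 fr4.
have hj4 : s4 aJ 0%N 0%N = j%:R by rewrite fr4.
have hk4 : s4 aK 0%N 0%N = k%:R by rewrite fr4.
apply: wp_seq; apply: wp_put1; [eassumption | ev_tac | by [] | by [] |].
apply: wp_put1; [eassumption | ev_tac | by [] | by [] |].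
move=> fr5; apply: HQ fr5.
- move: ho4 ho1 => /=; nia.
- by move=> i c im; rewrite !updE /= IA im andbT.
- by move=> i im; rewrite !updE /= IB im.
- by move=> i; rewrite !updE /= /moved !fr4 // /s3 !updE /= !fr2 //; case: eqP.
- by move=> i; rewrite !updE /= /moved !fr4 // /s3 !updE /= !fr2 //; case: eqP.
Qed.

End Specs.
Arguments wp_put1 {B S} S3 [a x e i q o l s Q].
Arguments wp_put2 {B S} S3 [a x y e i j q o l s Q].
Arguments wp_drop {B S} S3 [m n k o l s Q].
Arguments wp_search {B S} S3 [m n j o l s Q].
Arguments wp_delete_row {B S} S3 [m n j o l s Q].
Arguments wp_pivot {B S} S3 [S1 m n j k o l s Q].

(** * Deletion of the variables that vanish at all good solutions *)

Definition delete_column : cmd :=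
  If (Cmp Le (V aM) (V aJ)) (Seq (Set1 aK (V aJ)) drop_column)
    (Seq search
      (If (Cmp Eq (V aK) (Cst 0))
        (If (Cmp Eq (G1 aB aJ) (Cst 0)) (Seq delete_row drop_column)
          (Seq (Set1 aRun (Cst 0)) (Seq (Set1 aAns (Cst 0)) (Set1 aJ (V aN)))))
        (Seq pivot drop_column))).

(** After a deletion [aJ] stays, because its position may now hold another variable. *)
Definition sweep : cmd :=
  Seq (Set1 aJ (Cst 0))
    (While (Cmp Lt (V aJ) (V aN))
      (If (Cmp Lt (Op Mul (Op Mul (Cst 3) (V aTop)) (G1 aU aJ)) (Cst 4))
        delete_column (Set1 aJ (Op Add (V aJ) (Cst 1))))).

Lemma moved_swap j k d : d != k -> moved j k d = swap j k d.
Proof. by rewrite /moved /swap => /negPf ->. Qed.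

Lemma moved_neq k n c : (c < n.-1)%N -> moved k n.-1 c != k.
Proof. by rewrite /moved; case: (eqVneq c k) => [->|//]; lia. Qed.

Lemma moved_lt k n c : (c < n.-1)%N -> (moved k n.-1 c < n)%N.
Proof. by rewrite /moved; case: eqP; lia. Qed.

Section Invariant.
Variables (m0 n0 : nat) (ai : nat -> nat -> int) (bi : nat -> int) (U E S1 : nat).
Let Z := (n0 + m0)%N.
Let a r c : rat := (ai r c)%:~R.
Let b r : rat := (bi r)%:~R.

(* Solutions with the size bounds of a vertex. *)
Definition good (x : nat -> rat) : Prop :=
  [/\ forall r, (r < m0)%N -> \sum_(c < n0) a r c * x c = b r,
      forall c, (c < n0)%N -> 0 <= x c <= U%:R,
      forall c, (c < n0)%N -> x c != 0 -> 4 <= U%:R * x c &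
      forall c, (n0 <= c)%N -> x c = 0].

(** Columns from [n0] on are slack columns; the bound 0 makes them dead from the start. *)
Definition ubound (e : nat -> nat) (c : nat) : rat :=
  if (c < n0)%N then U%:R * (3 / 4) ^+ e c else 0.

(** The exponents [e] belong to columns, not positions, and outlive their columns, so that the
    potential is a sum over a fixed set. Only good solutions are required to solve the tableau,
    since columns were removed on the ground that good solutions vanish there. *)
Record tab_invariant (s : memory) (m n : nat) (p e : nat -> nat) : Prop := Invariant {
  inv_m : s aM 0%N 0%N = m%:R;
  inv_n : s aN 0%N 0%N = n%:R;
  inv_top : s aTop 0%N 0%N = U%:R;
  inv_nZ : (n <= Z)%N;
  inv_p : forall j, (j < n)%N -> s aP j 0%N = (p j)%:R;
  inv_u : forall j, (j < n)%N -> s aU j 0%N = ubound e (p j);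
  inv_tab : tableau m0 Z a b m n (s aA) (fun i => s aB i 0%N) p;
  inv_sol : forall x, good x ->
    solves m n (s aA) (fun i => s aB i 0%N) (fun j => x (p j));
  inv_alive : forall c, (c < n0)%N -> (e c < E)%N -> exists2 j, (j < n)%N & p j = c;
  inv_y : forall c, s aY c 0%N = 0 }.

Record valid_exponents (e : nat -> nat) : Prop := ValidExponents {
  exp_le : forall c, (c < n0)%N -> (e c <= E)%N;
  exp_good : forall x, good x -> forall c, (c < n0)%N -> x c <= ubound e c }.

Hypothesis hE : forall k, (k < E)%N = (4 <= 3 * U%:R * (U%:R * (3 / 4) ^+ k) :> rat).

Lemma alive_ubound e c : (4 <= 3 * U%:R * ubound e c :> rat) = (c < n0)%N && (e c < E)%N.
Proof.
rewrite /ubound; case: ifP => _; rewrite ?hE // mulr0.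
by apply/negbTE; rewrite -ltNge ltr0n.
Qed.

(** A nonzero [x c] would give [4 <= U * x c <= U * ubound e c < 4 / 3]. *)
Lemma good_dead x e c : valid_exponents e -> good x -> 3 * U%:R * ubound e c < 4 -> x c = 0.
Proof.
move=> ve gx; case: (ltnP c n0) => cn; last by case: gx => _ _ _ ->.
have := exp_good ve gx cn; case: gx => _ _ h4 _.
have := h4 _ cn; set X := x c; set Y := ubound e c; set W : rat := U%:R => h hx hd.
have W0 : 0 <= W by rewrite ler0n.
apply/eqP; apply: contraT => /h h1.
have h2 : W * X <= W * Y by rewrite ler_wpM2l.
have h3 : 3 * 4 <= 3 * (W * Y) by rewrite ler_wpM2l ?ler0n // (le_trans h1 h2).
rewrite -mulrA in hd; have := le_lt_trans h3 hd.
by rewrite -natrM ltr_nat.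
Qed.

Variables (B : cmd) (S : nat).
Hypothesis S3 : (3 <= S)%N.
Hypothesis S14 : (4 * S1 <= S)%N.
Hypothesis ZS : (Z < 2 ^ S)%N.
Hypothesis S1U : (2 * entry_bound (\matrix_(r < m0, c < Z) ai r c) (\col_(r < m0) bi r) ^ 2
  <= 2 ^ S1)%N.

(** A basic variable leaves by a pivot on any nonzero entry of its row; there is no ratio test, as
    the basic solution need not be nonnegative. If the row vanishes off the basis, it reads
    [x_j = be_j], while [x_j = 0] at good solutions: the row is redundant or refutes them all. In
    the latter case [aJ] is set to [aN], which ends the sweep. *)
Lemma wp_delete_column m n p e j o l (s : memory) (Q : nat -> nat -> memory -> Prop) :
  tab_invariant s m n p e -> valid_exponents e -> s aJ 0%N 0%N = j%:R -> (j < n)%N ->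
  3 * U%:R * ubound e (p j) < 4 ->
  (forall o' (s' : memory) m' p', (o' <= o + 50 + 50 * (Z * Z))%N ->
     tab_invariant s' m' n.-1 p' e -> s' aJ 0%N 0%N = j%:R ->
     s' aRun 0%N 0%N = s aRun 0%N 0%N ->
     (forall i, (i < j)%N -> p' i = p i) -> Q o' l s') ->
  (forall o' (s' : memory), (o' <= o + 50 + 50 * (Z * Z))%N ->
     s' aRun 0%N 0%N = 0 -> s' aAns 0%N 0%N = 0 ->
     s' aJ 0%N 0%N = n%:R -> s' aN 0%N 0%N = n%:R ->
     (forall x, ~ good x) -> Q o' l s') ->
  wp B S delete_column o l s Q.
Proof.
case=> hm hn hU nZ hp hu tab sol cov hy ve hj jn dead HQ1 HQ2.
have mn := tab_mn tab.
have nS : (n < 2 ^ S)%N by apply: leq_ltn_trans ZS.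
have mS : (m < 2 ^ S)%N by apply: leq_ltn_trans nS.
have n1 : (0 < n)%N by lia.
have xj x : good x -> x (p j) = 0 by move=> gx; apply: good_dead ve gx dead.
(* Here [q] is the renaming of positions made before position [k] is dropped. The only column lost
   is that of [j], which is dead. *)
have cov' (q : nat -> nat) k : (k < n)%N -> (forall c, (c < n)%N -> (q c < n)%N) ->
    involutive q -> q k = j ->
    forall c, (c < n0)%N -> (e c < E)%N -> exists2 i, (i < n.-1)%N & p (q (moved k n.-1 i)) = c.
  move=> kn qn qK qk c cn ce; have [i im pi] := cov c cn ce.
  have ij : i != j.
    by apply: contraTneq dead => e1; rewrite -e1 pi -leNgt alive_ubound cn.
  have qik : q i != k by apply: contraNneq ij => e1; rewrite -[i]qK e1 qk.
  have qin := qn i im.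
  case: (eqVneq (q i) n.-1) => h.
    exists k; first by move: qik; rewrite h; lia.
    by rewrite /moved eqxx -h qK.
  exists (q i); first lia.
  by rewrite /moved (negPf qik) qK.
rewrite /delete_column; apply: (wp_if S3); [ev_tac | ev_tac | by [] |].
rewrite /= ler_nat; case: leqP => mj.
  apply: wp_seq; apply: (wp_set S3); [ev_tac | by [] | by move=> _; rewrite hgt_nat; lia |].
  apply: (wp_drop S3 (m := m) (n := n) (k := j)) => // o' s' ho' hn' hA hP hU' fr.
  have frm : s' aM 0%N 0%N = m%:R by rewrite fr.
  have mjn : (m <= j < n)%N by rewrite mj.
  have sB i : s' aB i 0%N = s aB i 0%N by rewrite fr.
  apply: (HQ1 o' s' m (fun c => p (moved j n.-1 c))) => //.
  - by move: ho'; rewrite /=; nia.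
  - split=> //.
    + by rewrite fr.
    + by lia.
    + by move=> c cn; rewrite hP updE /= hp // moved_lt.
    + by move=> c cn; rewrite hU' updE /= hu // moved_lt.
    + apply: tab_ext (tab_drop tab mjn) _ _ _ => // i c im cn.
      by rewrite hA im.
    + move=> x gx; apply: solves_ext (solves_drop (sol x gx) jn (xj x gx)) _ _ _ => // i c im cn.
      by rewrite hA im.
    + by apply: (cov' id j jn).
    + by move=> c; rewrite fr // updE /= hy.
  - by rewrite fr.
  - by rewrite fr.
  - by move=> i ij; rewrite /moved ltn_eqF.
apply: wp_seq; apply: (wp_search S3 (m := m) (n := n) (j := j)) => //.
move=> o1 s1 k ho1 hk hkP fr1.
have hb1 : s1 aB j 0%N = s aB j 0%N by rewrite fr1.
have hj1 : s1 aJ 0%N 0%N = j%:R by rewrite fr1.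
have hn1 : s1 aN 0%N 0%N = n%:R by rewrite fr1.
have hm1 : s1 aM 0%N 0%N = m%:R by rewrite fr1.
have hA1 : s1 aA = s aA by rewrite fr1.
have hB1 : s1 aB = s aB by rewrite fr1.
have hP1 : s1 aP = s aP by rewrite fr1.
have hU1 : s1 aU = s aU by rewrite fr1.
apply: (wp_if S3); [ev_tac | ev_tac | by [] |].
rewrite /= (eqr_nat _ k 0).
case: hkP => [[-> T0]|[/andP[mk kn] T0]].
  rewrite eqxx; apply: (wp_if S3); [ev_tac | ev_tac | by [] |].
  rewrite /=; case: eqP => b0.
    have m1 : (0 < m)%N by lia.
    have lm : (m.-1 < m)%N by lia.
    have lmn : (m.-1 < n)%N by lia.
    have swm : swap j m.-1 m.-1 = j by rewrite /swap eqxx; case: eqP.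
    apply: wp_seq; apply: (wp_delete_row S3 (m := m) (n := n) (j := j)) => //.
    move=> o2 s2 ho2 hm2 hk2 hA2 hB2 hP2 hU2 fr2.
    have hn2 : s2 aN 0%N 0%N = n%:R by rewrite fr2.
    have mS' : (m.-1 < 2 ^ S)%N by lia.
    apply: (wp_drop S3 (m := m.-1) (n := n) (k := m.-1)) => // o3 s3 ho3 hn3 hA3 hP3 hU3 fr3.
    (* Overwriting row [j] by the last row amounts to an exchange of two basis positions followed by
       the deletion of the last one. *)
    pose T2 i c := s aA (swap j m.-1 i) (swap j m.-1 c).
    have tab2 := tab_swap_basis tab mj lm.
    have T2m c : (m <= c < n)%N -> T2 m.-1 c = 0.
      move=> /andP[mc cn]; rewrite /T2 swm /swap.
      by rewrite (gtn_eqF (leq_trans mj mc)) (gtn_eqF (leq_trans lm mc)) T0 ?mc.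
    have tab3 := tab_delete_last_row tab2 m1 T2m _.
    have TE i c : (i < m.-1)%N -> (c < n.-1)%N ->
        s3 aA i c = T2 i (moved m.-1 n.-1 c).
      move=> im cn; rewrite hA3 im hA2 /T2 hA1.
      have dn := moved_lt m.-1 cn; have dm := moved_neq m.-1 cn.
      set d := moved _ _ _ in dn dm *.
      have im' : (i < m)%N by lia.
      rewrite dn andbT; case: (leqP m.-1 d) => h.
        have dj : d != j by apply: contraNneq dm => dj; lia.
        by rewrite /swap (negPf dj) (negPf dm) (ltn_eqF im) andbT; case: eqP.
      have hd : (d < m)%N by lia.
      by rewrite andbF (tab_id tab) // (tab_id tab2).
    have BE i : (i < m.-1)%N -> s3 aB i 0%N = s aB (swap j m.-1 i) 0%N.
      by move=> im; rewrite fr3 // hB2 hB1 moved_swap // ltn_eqF.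
    apply: (HQ1 o3 s3 m.-1 (fun c => p (swap j m.-1 (moved m.-1 n.-1 c)))).
    - by move: ho1 ho2 ho3; rewrite /=; nia.
    - split=> //.
      + by rewrite fr3.
      + by rewrite fr3 // fr2 // fr1.
      + by lia.
      + move=> c cn; rewrite hP3 hP2 hP1 moved_swap ?moved_neq // hp // swap_lt ?moved_lt //.
      + move=> c cn; rewrite hU3 hU2 hU1 moved_swap ?moved_neq // hu // swap_lt ?moved_lt //.
      + apply: tab_ext (tab3 _) _ _ _ => //.
        by rewrite swm b0.
      + move=> x gx.
        have sol2 := solves_swap_basis (sol x gx) mj lm mn.
        have sol3 := solves_delete_last_row sol2 _ _.
        apply: solves_ext (sol3 _ _) _ _ _ => //; first by rewrite m1.
        move=> i im; have im' : (i < m)%N by lia.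
        by have := tab_id tab2 im' lm; rewrite (ltn_eqF im).
      + by apply: cov' => //; [move=> c cn; apply: swap_lt | apply: swapK].
      + by move=> c; rewrite fr3 // fr2 // fr1 // hy.
    - by rewrite fr3 // fr2.
    - by rewrite fr3 // fr2 // fr1.
    - move=> i ij; rewrite /moved ltn_eqF; last lia.
      by rewrite /swap !ltn_eqF //; lia.
  apply: wp_seq; apply: (wp_set S3); [ev_tac | by [] | by move=> _; rewrite hgt_nat; lia |].
  apply: wp_seq; apply: (wp_set S3); [ev_tac | by [] | by move=> _; rewrite hgt_nat; lia |].
  apply: (wp_set S3); [ev_tac | by [] | by move=> _; rewrite hgt_nat; lia |].
  apply: HQ2 => //.
    by move: ho1; rewrite /=; nia.
  move=> x gx; apply: b0.
  exact: (solves_zero_row tab (sol x gx) mj T0 (xj x gx)).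
have k0 : (k == 0%N) = false by lia.
rewrite k0.
have mkn : (m <= k < n)%N by rewrite mk.
have [hA hB] := tab_hgt tab.
apply: wp_seq; apply: (wp_pivot S3 (S1 := S1) (m := m) (n := n) (j := j) (k := k)) => //.
- by rewrite hA1.
- by move=> i c im cn; rewrite hA1; apply: leq_trans (hA i c im cn) S1U.
- by move=> i im; rewrite hB1; apply: leq_trans (hB i im) S1U.
move=> o2 s2 ho2 hA2 hB2 hP2 hU2 fr2.
rewrite hA1 in hA2 hB2; rewrite hB1 in hB2.
have hn2 : s2 aN 0%N 0%N = n%:R by rewrite fr2.
have hm2 : s2 aM 0%N 0%N = m%:R by rewrite fr2.
have hk2 : s2 aK 0%N 0%N = k%:R by rewrite fr2.
apply: (wp_drop S3 (m := m) (n := n) (k := k)) => // o3 s3 ho3 hn3 hA3 hP3 hU3 fr3.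
have tab2 := tab_pivot tab mj mkn T0.
have TE i c : (i < m)%N -> (c < n.-1)%N -> s3 aA i c =
    pivoted (s aA) j k (s aA ^~ (swap j k (moved k n.-1 c))) i.
  move=> im cn; rewrite hA3 im hA2 //.
  have dn := moved_lt k cn; have dk := moved_neq k cn.
  set d := moved _ _ _ in dn dk *.
  rewrite dn andbT; case: (leqP m d) => h.
    have dj : d != j by apply: contraTneq h => ->; rewrite -ltnNge.
    by rewrite /swap (negPf dj) (negPf dk).
  (* Below [m] the program changed nothing, and both sides are entries of the identity. *)
  by rewrite (tab_id tab) // (tab_id tab2).
apply: (HQ1 o3 s3 m (fun c => p (swap j k (moved k n.-1 c)))).
- by move: ho1 ho2 ho3; rewrite /=; nia.
- split=> //.
  + by rewrite fr3.
  + by rewrite fr3 // fr2 // fr1.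
  + by lia.
  + by move=> c cn; rewrite hP3 hP2 hP1 moved_swap ?moved_neq // hp // swap_lt ?moved_lt.
  + by move=> c cn; rewrite hU3 hU2 hU1 moved_swap ?moved_neq // hu // swap_lt ?moved_lt.
  + apply: tab_ext (tab_drop tab2 mkn) _ _ _ => // i im.
    by rewrite fr3 // hB2.
  + move=> x gx.
    have sol2 := solves_pivot (sol x gx) mj jn kn.
    apply: solves_ext (solves_drop sol2 kn _) _ _ _ => //.
      rewrite /swap eqxx; have -> : (k == j) = false by lia.
      exact: xj.
    by move=> i im; rewrite fr3 // hB2.
  + apply: cov' => //; first by move=> c cn; apply: swap_lt.
      exact: swapK.
    by rewrite /swap eqxx; have -> : (k == j) = false by lia.
  + by move=> c; rewrite fr3 // fr2 // fr1 // hy.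
- by rewrite fr3 // fr2.
- by rewrite fr3 // fr2 // fr1.
- move=> i ij; rewrite /moved ltn_eqF; last lia.
  by rewrite /swap !ltn_eqF //; lia.
Qed.

End Invariant.
Arguments wp_delete_column [m0 n0 ai bi U E S1] hE {B S} S3 S14 ZS S1U [m n p e j o l s Q].

Section Sweep.
Variables (m0 n0 : nat) (ai : nat -> nat -> int) (bi : nat -> int) (U E S1 : nat).
Let Z := (n0 + m0)%N.
Notation inv := (tab_invariant m0 n0 ai bi U E).
Notation good := (good m0 n0 ai bi U).
Notation ubound := (ubound n0 U).
Hypothesis hE : forall k, (k < E)%N = (4 <= 3 * U%:R * (U%:R * (3 / 4) ^+ k) :> rat).
Variables (B : cmd) (S : nat).
Hypothesis S3 : (3 <= S)%N.
Hypothesis S14 : (4 * S1 <= S)%N.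
Hypothesis ZS : (Z < 2 ^ S)%N.
Hypothesis S1U : (2 * entry_bound (\matrix_(r < m0, c < Z) ai r c) (\col_(r < m0) bi r) ^ 2
  <= 2 ^ S1)%N.

Lemma wp_sweep m n p e o l (s : memory) (Q : nat -> nat -> memory -> Prop) :
  inv s m n p e -> valid_exponents m0 n0 ai bi U E e -> s aRun 0%N 0%N = 1 ->
  (forall o' (s' : memory) m' n' p', (o' <= o + 5 + (Z + 1) * (60 + 50 * (Z * Z)))%N ->
     inv s' m' n' p' e -> s' aRun 0%N 0%N = 1 ->
     (forall j, (j < n')%N -> (p' j < n0)%N && (e (p' j) < E)%N) -> Q o' l s') ->
  (forall o' (s' : memory), (o' <= o + 5 + (Z + 1) * (60 + 50 * (Z * Z)))%N ->
     s' aRun 0%N 0%N = 0 -> s' aAns 0%N 0%N = 0 -> (forall x, ~ good x) -> Q o' l s') ->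
  wp B S sweep o l s Q.
Proof.
move=> iv ve run1 HQ1 HQ2; rewrite /sweep.
apply: wp_seq; apply: (wp_set S3); [ev_tac | by [] | by move=> _; rewrite hgt_nat; lia |].
set s1 := upd _ _ _ _ _.
have [K KE] : exists K, K = (60 + 50 * (Z * Z))%N by eexists.
rewrite -/Z -KE in HQ1 HQ2.
(* The variant [n' - j] drops by one both when a position is deleted and when [j] advances, so
   [Z - v] bounds the number of rounds made. *)
pose I v o' l' (s' : memory) := l' = l /\
  ((exists m' n' p' j, [/\ inv s' m' n' p' e, s' aJ 0%N 0%N = j%:R /\ s' aRun 0%N 0%N = 1,
      (j <= n')%N /\ v = (n' - j)%N,
      forall i, (i < j)%N -> (p' i < n0)%N && (e (p' i) < E)%N &
      (v <= Z)%N /\ (o' <= o + (Z - v) * K)%N]) \/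
   (exists n', [/\ s' aJ 0%N 0%N = n'%:R /\ s' aN 0%N 0%N = n'%:R,
      s' aRun 0%N 0%N = 0, s' aAns 0%N 0%N = 0, forall x, ~ good x &
      (o' <= o + Z * K)%N])).
apply: (wp_while S3 (I := I) (v := n)) => //; last first.
  split=> //; left; exists m, n, p, 0%N; split=> //.
  - by case: iv => *; split.
  - by rewrite subn0.
  - by split; [case: iv | rewrite addn0 leq_addr].
move=> v o' l' s2 [-> [[m' [n' [p' [j [iv2 [hj2 run2] [jn ->] al [vZ ho]]]]]]|]] bs.
  exists j%:R, n'%:R; split; [by ev_tac | by apply: ev_V (inv_n iv2) |].
  rewrite /= ltr_nat; case: ltnP => jn'; last first.
    apply: (HQ1 _ s2 m' n' p') => //.
    - by move: ho; rewrite (_ : n' - j = 0)%N /=; last lia; rewrite subn0; nia.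
    - by move=> i ii; apply: al; apply: leq_trans jn'.
  have hu : s2 aU j 0%N = ubound e (p' j) by apply: (inv_u iv2 jn').
  have ht := inv_top iv2.
  apply: (wp_if S3); [ev_tac | ev_tac | by [] |].
  rewrite /=; case: ltP => hd.
    apply: (wp_delete_column hE S3 S14 ZS S1U iv2 ve hj2 jn' hd) => [o3 s3 m3 p3 ho3 iv3 hj3 run3 hp3|].
      exists (n'.-1 - j)%N; first lia.
      split=> //; left; exists m3, n'.-1, p3, j; split=> //.
      + by rewrite run3.
      + by split=> //; lia.
      + by move=> i ij; rewrite hp3 // al.
      + split; first lia.
        have -> : (Z - (n'.-1 - j) = (Z - (n' - j)) + 1)%N by lia.
        by move: ho ho3; rewrite /= -/Z mulnDl mul1n; lia.
    move=> o3 s3 ho3 run3 ans3 hj3 hn3 ng.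
    exists 0%N; first lia.
    split=> //; right; exists n'; split=> //.
    have h : ((Z - (n' - j)) * K + K <= Z * K)%N.
      by rewrite -mulSnr leq_mul2r; apply/orP; right; lia.
    by move: ho ho3 h; rewrite /= -/Z; lia.
  apply: (wp_set S3); [ev_tac | by [] | |].
    by move=> _; rewrite natr1 hgt_nat; have := inv_nZ iv2; rewrite -/Z; lia.
  exists (n' - j.+1)%N; first lia.
  split=> //; left; exists m', n', p', j.+1; split=> //.
  - by case: iv2 => *; split.
  - by split=> //; rewrite updE /= natr1.
  - move=> i; rewrite ltnS leq_eqVlt => /predU1P[->|/al //].
    by rewrite -(@alive_ubound n0 U E hE).
  - split; first lia.
    have -> : (Z - (n' - j.+1) = (Z - (n' - j)) + 1)%N by lia.
    by move: ho; rewrite /= mulnDl mul1n; lia.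
case: bs => [n' [[hj hn] run2 ans2 ng ho]] _.
exists n'%:R, n'%:R; split; [ev_tac | ev_tac |].
rewrite /= ltr_nat ltnn; apply: HQ2 => //.
by move: ho; rewrite /=; nia.
Qed.

End Sweep.
Arguments wp_sweep [m0 n0 ai bi U E S1] hE {B S} S3 S14 ZS S1U [m n p e o l s Q].

(** * Lowering the upper bounds *)

Definition shrink : cmd :=
  Seq (Set1 aQ (Cst 0))
  (Seq (For aJ (Cst 0) aN (Set1 aQ (Op Add (V aQ) (Op Mul (G1 aW aJ) (G1 aU aJ)))))
  (Seq (Set1 aQ (Op Div (V aQ) (Op Mul (Cst 2) (V aN))))
  (For aJ (Cst 0) aN
    (If (Cmp Eq (G1 aW aJ) (Cst 0)) Skip
      (Seq (Set1 aT (Op Div (V aQ) (G1 aW aJ)))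
      (Seq (If (Cmp Lt (Op Mul (V aTop) (V aT)) (Cst 1))
              (Set1 aT (Op Div (Cst 1) (V aTop))) Skip)
        (While (Cmp Le (Op Mul (V aT) (Cst 4)) (Op Mul (G1 aU aJ) (Cst 3)))
          (put1 aU aJ (Op Div (Op Mul (G1 aU aJ) (Cst 3)) (Cst 4)))))))))).

Lemma three_quarters (F : realFieldType) (t u : F) : (t * 4 <= u * 3) = (t <= u * (3 / 4)).
Proof. by apply/idP/idP => h; lra. Qed.

Lemma three_quarters_threshold (F : realFieldType) (x y : F) :
  (1 <= x * (y * (3 / 4))) = (4 <= 3 * x * y).
Proof.
have -> : x * (y * (3 / 4)) = x * y * (3 / 4) by ring.
by rewrite -mulrA; move: (x * y) => z; apply/idP/idP => h; lra.
Qed.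

(** A step is made only if the bound stays at least [t >= 1 / U]. Then it was at least [4 / (3 U)]
    before, so its exponent was below [E]. A step costs 5 operations: two multiplications and a
    comparison in the test, a multiplication and a division in the body. *)
Lemma wp_shrink_variable (B : cmd) (S U E : nat) (w q : rat) j n e o l (s : memory)
    (Q : nat -> nat -> memory -> Prop) :
  (3 <= S)%N -> (0 < U)%N -> 0 < w ->
  (forall k, (k < E)%N = (4 <= 3 * U%:R * (U%:R * (3 / 4) ^+ k) :> rat)) ->
  (forall k, (k <= E)%N -> (hgt (U%:R * (3 / 4) ^+ k) <= 2 ^ S)%N) ->
  (2 * U.+1 <= 2 ^ S)%N -> (hgt (q / w) <= 2 ^ S)%N ->
  s aJ 0%N 0%N = j%:R -> s aQ 0%N 0%N = q -> s aW j 0%N = w ->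
  s aTop 0%N 0%N = U%:R -> s aN 0%N 0%N = n%:R ->
  s aU j 0%N = U%:R * (3 / 4) ^+ e -> (e < E)%N ->
  (forall o' (s' : memory) d t, (o' <= o + 10 + 5 * d)%N -> (e + d <= E)%N ->
     s' aU j 0%N = U%:R * (3 / 4) ^+ (e + d) ->
     (forall i, i != j -> s' aU i 0%N = s aU i 0%N) ->
     q / w <= t -> t = q / w \/ t = U%:R^-1 ->
     (d = 0%N \/ t <= U%:R * (3 / 4) ^+ (e + d)) ->
     U%:R * (3 / 4) ^+ (e + d).+1 < t -> Q o' l s') ->
  wp B S (If (Cmp Eq (G1 aW aJ) (Cst 0)) Skip
      (Seq (Set1 aT (Op Div (V aQ) (G1 aW aJ)))
      (Seq (If (Cmp Lt (Op Mul (V aTop) (V aT)) (Cst 1))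
              (Set1 aT (Op Div (Cst 1) (V aTop))) Skip)
        (While (Cmp Le (Op Mul (V aT) (Cst 4)) (Op Mul (G1 aU aJ) (Cst 3)))
          (put1 aU aJ (Op Div (Op Mul (G1 aU aJ) (Cst 3)) (Cst 4))))))) o l s Q.
Proof.
move=> S3 U0 w0 hE hk hU hqw hj hq hw ht hn hu eE HQ.
have w1 : w != 0 by rewrite gt_eqF.
have U1 : U%:R != 0 :> rat by rewrite pnatr_eq0 -lt0n.
have Up : 0 < U%:R :> rat by rewrite ltr0n.
apply: (wp_if S3); [ev_tac | ev_tac | by [] |].
rewrite /= (negPf w1).
apply: wp_seq; apply: (wp_set S3); [apply: (ev_div w1); ev_tac | by [] | by [] |].
set s1 := upd _ _ _ _ _.
have ht1 : s1 aTop 0%N 0%N = U%:R by [].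
have htt : s1 aT 0%N 0%N = q / w by [].
pose t := if U%:R * (q / w) < 1 then U%:R^-1 else q / w.
have [hqt tP Ut] : [/\ q / w <= t, t = q / w \/ t = U%:R^-1 & 1 <= U%:R * t].
  rewrite /t; have [h|h] := ltP (U%:R * (q / w)) 1.
    split; [| by right | by rewrite divff].
    by rewrite -(ler_pM2l Up) divff // ltW.
  by split=> //; left.
have main o2 (s2 : memory) : (o2 <= o + 5)%N -> s2 aT 0%N 0%N = t ->
    s2 aJ 0%N 0%N = j%:R -> (forall i, s2 aU i 0%N = s aU i 0%N) ->
  wp B S (While (Cmp Le (Op Mul (V aT) (Cst 4)) (Op Mul (G1 aU aJ) (Cst 3)))
          (put1 aU aJ (Op Div (Op Mul (G1 aU aJ) (Cst 3)) (Cst 4)))) o2 l s2 Q.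
  move=> ho2 ht2 hj2 hu2.
  pose I v o' l' (s' : memory) := exists d, [/\ l' = l /\ v = (E - (e + d))%N,
    (e + d <= E)%N /\ (o' <= o2 + 5 * d)%N,
    s' aU j 0%N = U%:R * (3 / 4) ^+ (e + d) /\
      (forall i, i != j -> s' aU i 0%N = s aU i 0%N),
    s' aT 0%N 0%N = t /\ s' aJ 0%N 0%N = j%:R &
    d = 0%N \/ t <= U%:R * (3 / 4) ^+ (e + d)].
  apply: (wp_while S3 (I := I) (v := E - e)) => //; last first.
    exists 0%N; rewrite !addn0; split=> //; last by left.
    - by split=> //; apply: ltnW.
    - by rewrite hu2.
  move=> v o' l' s3 [d [[-> ->] [hd ho] [hu3 hu3'] [ht3 hj3] dP]] bs.
  exists (t * 4%:R), (U%:R * (3 / 4) ^+ (e + d) * 3%:R); split; [ev_tac | ev_tac |].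
  rewrite /= three_quarters -mulrA -exprSr; case: ifP => [h|/negbT]; last first.
    rewrite -ltNge => h; apply: (HQ _ s3 d t) => //.
    by move: ho ho2; clear; lia.
  have hdE : (e + d < E)%N.
    rewrite hE; have h1 := le_trans Ut (ler_wpM2l (ltW Up) h).
    by rewrite exprSr [X in U%:R * X]mulrA in h1; rewrite -three_quarters_threshold.
  have e4 : 4%:R != 0 :> rat by rewrite pnatr_eq0.
  have uE : U%:R * (3 / 4) ^+ (e + d) * 3%:R / 4%:R = U%:R * (3 / 4) ^+ (e + d).+1 :> rat.
    by rewrite exprSr !mulrA.
  apply: (wp_put1 S3); [eassumption | apply: (ev_div e4); ev_tac | by [] | |].
    by move=> _; rewrite uE hk.
  rewrite uE -addnS in hdE *.
  exists (E - (e + d.+1))%N; first by clear - hdE; lia.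
  exists d.+1; split=> //.
  - by split=> //; move: ho; clear; rewrite /=; lia.
  - rewrite updE !eqxx; split=> // i ij.
    by rewrite updE (negPf ij) hu3'.
  - by right; rewrite addnS.
apply: wp_seq; apply: (wp_if S3); [ev_tac | ev_tac | by [] |].
rewrite /=; case: ifP => h.
  apply: (wp_set S3); [apply: (ev_div U1); ev_tac | by [] | |].
    move=> _; apply: leq_trans (hgt_div _ _) _; apply: leq_trans hU.
    by rewrite !hgt_nat.
  apply: main => //; first by rewrite /=; lia.
  by rewrite updE /= /t h mul1r.
apply: wp_skip; apply: main => //; first by rewrite /=; lia.
by rewrite /t h.
Qed.

(* [d] is the number of times that a bound [U (3/4)^e] was multiplied by [3/4]
   during a round with weight [w]. *)
Definition shrunk (U E : nat) (q w : rat) (e d : nat) : Prop :=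
  (e + d <= E)%N /\
  ((w = 0 /\ d = 0%N) \/ (0 < w /\ exists t, [/\ q / w <= t, t = q / w \/ t = U%:R^-1,
     d = 0%N \/ t <= U%:R * (3 / 4) ^+ (e + d) &
     U%:R * (3 / 4) ^+ (e + d).+1 < t])).

Section Shrink.
Variables (Z U E S1 SB : nat).
Hypothesis U0 : (0 < U)%N.
Hypothesis hE : forall k, (k < E)%N = (4 <= 3 * U%:R * (U%:R * (3 / 4) ^+ k) :> rat).
Hypothesis hU : forall k, (k <= E)%N -> (hgt (U%:R * (3 / 4) ^+ k) <= 2 ^ S1)%N.
Variables (B : cmd) (S : nat).
Hypothesis S3 : (3 <= S)%N.
Hypothesis hS : ((SB + S1 + 1) * (Z + 1) <= S)%N.

(** The value [q] comes from a sum of up to [Z] products of height at most [2 ^ (SB + S1)]; this sum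
    dictates the size of [S]. *)
Lemma wp_shrink n (e : nat -> nat) o l (s : memory) (Q : nat -> nat -> memory -> Prop) :
  s aN 0%N 0%N = n%:R -> s aTop 0%N 0%N = U%:R -> (0 < n <= Z)%N ->
  (forall j, (j < n)%N -> (hgt (s aW j 0) <= 2 ^ SB)%N) ->
  (forall j, (j < n)%N -> 0 <= s aW j 0%N) ->
  (forall j, (j < n)%N -> s aU j 0%N = U%:R * (3 / 4) ^+ e j) ->
  (forall j, (j < n)%N -> (e j < E)%N) ->
  let q := (\sum_(j < n) s aW j 0%N * s aU j 0%N) / (2%:R * n%:R) in
  (forall o' (s' : memory) (d : nat -> nat), (o' <= o + 8 + 16 * n + 5 * \sum_(j < n) d j)%N ->
    (forall j, (j < n)%N -> s' aU j 0%N = U%:R * (3 / 4) ^+ (e j + d j)) ->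
    (forall j, (j < n)%N -> shrunk U E q (s aW j 0%N) (e j) (d j)) ->
    frame (mods shrink) s s' -> Q o' l s') ->
  wp B S shrink o l s Q.
Proof.
move=> hn ht /andP[n0 nZ] hw w0 hu he q HQ; apply: wp_frame; rewrite /shrink.
have ZS : (Z < 2 ^ S)%N.
  apply: leq_ltn_trans (ltn_expl S (isT : 1 < 2)%N).
  by move: hS; rewrite mulnDr mulnDl; clear; nia.
have nS : (n < 2 ^ S)%N by apply: leq_ltn_trans ZS.
have hwu j : (j < n)%N -> (hgt (s aW j 0%N * s aU j 0%N) <= 2 ^ (SB + S1))%N.
  move=> jn; apply: leq_trans (hgtM _ _) _; rewrite expnD leq_mul ?hw //.
  by rewrite hu // hU // ltnW // he.
have leS x : (x <= (SB + S1 + 1) * (Z + 1))%N -> (2 ^ x <= 2 ^ S)%N.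
  by move=> hx; rewrite leq_exp2l // (leq_trans hx).
have hsum i : (i <= n)%N ->
    (hgt (\sum_(j < i) s aW j 0%N * s aU j 0%N) <= 2 ^ ((SB + S1) * i))%N.
  by move=> hi; apply: (hgt_sum (F := fun j => s aW j 0%N * s aU j 0%N)) => j ji;
     apply: hwu; apply: leq_trans hi.
apply: wp_seq; apply: (wp_set S3); [ev_tac | by [] | by move=> _; rewrite hgt_nat; lia |].
set s1 := upd _ _ _ _ _.
apply: wp_seq; pose I i (s' : memory) := s' aQ 0%N 0%N = \sum_(j < i) s aW j 0%N * s aU j 0%N.
apply: (wp_for S3 (I := I) (i0 := 0) (n := n) (K := 2)) => //.
  by rewrite /I updE /= big_ord0.
  move=> i s2 /andP[_ im] hi Ii bs fr.
  have hwi : s2 aW i 0%N = s aW i 0%N by rewrite fr.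
  have hui : s2 aU i 0%N = s aU i 0%N by rewrite fr.
  have sumE : \sum_(j < i) s aW j 0%N * s aU j 0%N + s aW i 0%N * s aU i 0%N =
      \sum_(j < i.+1) s aW j 0%N * s aU j 0%N by rewrite big_ord_recr.
  apply: (wp_set S3); [ev_tac | by [] | |].
    move=> _; rewrite sumE; apply: leq_trans (hsum _ im) _; apply: leS.
    by move: im nZ; clear; nia.
  by split=> // _; rewrite /I updE /= sumE.
move=> o2 s2 ho2 hq2 hi2 fr2; rewrite /I in hq2.
have hn2 : s2 aN 0%N 0%N = n%:R by rewrite fr2.
have n20 : 2%:R * n%:R != 0 :> rat by rewrite -natrM pnatr_eq0; lia.
have hq : (hgt q <= 2 ^ ((SB + S1) * n + (n + 1)))%N.
  apply: leq_trans (hgt_div _ _) _; rewrite expnD; apply: leq_mul; first exact: hsum.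
  rewrite -natrM hgt_nat addn1 expnS; have := ltn_expl n (isT : 1 < 2)%N; clear; lia.
apply: wp_seq; apply: (wp_set S3); [apply: (ev_div n20); ev_tac | by [] | |].
  move=> _; apply: leq_trans hq _; apply: leS; move: nZ; clear; nia.
rewrite -/q; set s3 := upd _ _ _ _ _.
pose J i t (s' : memory) := exists d : nat -> nat, [/\ t = (5 * \sum_(j < i) d j)%N,
  forall j, (j < i)%N -> s' aU j 0%N = U%:R * (3 / 4) ^+ (e j + d j),
  forall j, (j < i)%N -> shrunk U E q (s aW j 0%N) (e j) (d j) &
  forall j, (i <= j)%N -> s' aU j 0%N = s aU j 0%N].
have hn3 : s3 aN 0%N 0%N = n%:R by [].
apply: (wp_for_amortized S3 (I := J) (i0 := 0) (n := n) (K := 10)) => //.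
- exists (fun=> 0%N); split=> //; first by rewrite big_ord0.
  by move=> j _; rewrite updE /s3 updE fr2.
- move=> i t s4 /andP[_ im] hi [d [td dU dP dR]] bs fr.
  have hw4 : s4 aW i 0%N = s aW i 0%N by rewrite fr // /s3 updE fr2.
  have hu4 : s4 aU i 0%N = U%:R * (3 / 4) ^+ e i by rewrite dR // hu.
  have hq4 : s4 aQ 0%N 0%N = q by rewrite fr.
  have ht4 : s4 aTop 0%N 0%N = U%:R by rewrite fr // /s3 updE fr2.
  have hn4 : s4 aN 0%N 0%N = n%:R by rewrite fr.
  have ext (s' : memory) di :
      s' aU i 0%N = U%:R * (3 / 4) ^+ (e i + di) ->
      (forall j, j != i -> s' aU j 0%N = s4 aU j 0%N) ->
      shrunk U E q (s aW i 0%N) (e i) di -> J i.+1 (t + 5 * di)%N s'.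
    move=> h1 h2 h3; exists (fun j => if j == i then di else d j); split.
    - rewrite td big_ord_recr /= eqxx mulnDr; congr (5 * _ + _)%N.
      by apply: eq_bigr => j _; rewrite ltn_eqF.
    - move=> j; rewrite ltnS; case: (eqVneq j i) => [-> //|ji ji'].
      by rewrite h2 // dU // ltn_neqAle ji.
    - move=> j; rewrite ltnS; case: (eqVneq j i) => [-> //|ji ji'].
      by apply: dP; rewrite ltn_neqAle ji.
    - by move=> j ij; rewrite h2 ?dR //; [apply: ltnW | rewrite gtn_eqF].
  case: (eqVneq (s aW i 0%N) 0) => [wi0|wi0].
    apply: (wp_if S3); [ev_tac | ev_tac | by [] |].
    rewrite wi0 /=; apply: wp_skip; exists 0%N; split=> // _.
    apply: (ext _ 0%N); rewrite ?addn0 //.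
    by split; [rewrite addn0 ltnW // he | left].
  have wp0 : 0 < s aW i 0%N by rewrite lt_neqAle eq_sym wi0 w0.
  apply: (@wp_shrink_variable B S U E (s aW i 0%N) q i n (e i)) => //.
  + move=> k /hU h; apply: leq_trans h _; apply: leS; clear; nia.
  + have := hU (leq0n E); rewrite expr0 mulr1 hgt_nat => h.
    apply: (@leq_trans (2 ^ S1.+1)); first by rewrite expnS leq_mul2l.
    apply: leS; clear; nia.
  + apply: leq_trans (hgt_div _ _) _.
    apply: (@leq_trans (2 ^ ((SB + S1) * n + (n + 1)) * 2 ^ SB)).
      by apply: leq_mul => //; apply: hw.
    rewrite -expnD; apply: leS; move: nZ; clear; nia.
  + exact: he.
  move=> o5 s5 di t5 ho5 hdi hu5 hu5' h1 h2 h3 h4.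
  exists (5 * di)%N; split=> // hi5.
  apply: ext => //.
  by split=> //; right; split=> //; exists t5.
move=> o5 t s5 ho5 [d [td dU dP dR]] hi5 fr5 fr6.
apply: (HQ _ _ d) => //.
by move: ho2 ho5; rewrite td !subn0 /=; clear; nia.
Qed.

End Shrink.
Arguments wp_shrink [Z U E S1 SB] U0 hE hU {B S} S3 hS [n e o l s Q].

Section ShrinkProgress.
Variables (m0 n0 : nat) (ai : nat -> nat -> int) (bi : nat -> int) (U E : nat).
Hypothesis U0 : (0 < U)%N.
Hypothesis hE : forall k, (k < E)%N = (4 <= 3 * U%:R * (U%:R * (3 / 4) ^+ k) :> rat).
Notation good := (good m0 n0 ai bi U).
Notation ubound := (ubound n0 U).

(** The certificate gives [w_j x_j <= w^T x < q], so the targets are upper bounds and the new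
    exponents are valid. If no exponent reaches [E], no target was raised to [1 / U], and
    [shrink_progress] shows that the steps made exceed the logarithm of the number of variables. *)
Lemma shrink_exponents n (p e d : nat -> nat) (w : nat -> rat) :
  (0 < n)%N ->
  (forall i j, (i < n)%N -> (j < n)%N -> p i = p j -> i = j) ->
  (forall j, (j < n)%N -> (p j < n0)%N && (e (p j) < E)%N) ->
  (forall c, (c < n0)%N -> (e c < E)%N -> exists2 j, (j < n)%N & p j = c) ->
  valid_exponents m0 n0 ai bi U E e ->
  (forall j, (j < n)%N -> 0 <= w j) -> (exists2 j, (j < n)%N & w j != 0) ->
  let q := (\sum_(j < n) w j * ubound e (p j)) / (2%:R * n%:R) in
  (forall x, good x -> \sum_(j < n) w j * x (p j) < q) ->
  (forall j, (j < n)%N -> shrunk U E q (w j) (e (p j)) (d j)) ->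
  exists e', [/\ valid_exponents m0 n0 ai bi U E e', forall c, (e c <= e' c)%N,
    forall j, (j < n)%N -> e' (p j) = (e (p j) + d j)%N,
    (steps n0 E e' + \sum_(j < n) d j = steps n0 E e)%N &
    forall rho q', (rho <= 2 * q')%N ->
    (potential n0 E rho q' e' + rho <= potential n0 E rho q' e)%N].
Proof.
move=> npos pinj pal pcov [ve vg] w0 [j1 jn1 wj1] q hx hd.
have pn0 j : (j < n)%N -> (p j < n0)%N by case/pal/andP.
have peE j : (j < n)%N -> (e (p j) < E)%N by case/pal/andP.
pose e' c := (e c + \sum_(j < n | p j == c) d j)%N.
have e'p j : (j < n)%N -> e' (p j) = (e (p j) + d j)%N.
  move=> jn; rewrite /e' (bigD1 (Ordinal jn)) //= big1 ?addn0 // => i /andP[/eqP h1 /eqP h2].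
  by case: h2; apply: val_inj; apply: pinj h1.
have e'c c : (forall j, (j < n)%N -> p j != c) -> e' c = e c.
  by move=> h; rewrite /e' big1 ?addn0 // => i /eqP h1; have := h _ (ltn_ord i); rewrite h1 eqxx.
have ee' c : (e c <= e' c)%N by apply: leq_addr.
have dE j : (j < n)%N -> (e (p j) + d j <= E)%N by case/hd.
have e'E c : (c < n0)%N -> (e' c <= E)%N.
  move=> cn; have [[j jn <-]|h] := pselect (exists2 j, (j < n)%N & p j = c).
    by rewrite e'p // dE.
  rewrite e'c ?ve // => j jn; apply/eqP => h1; apply: h; by exists j.
have uE j : (j < n)%N -> ubound e (p j) = U%:R * (3 / 4) ^+ e (p j).
  by move=> jn; rewrite /ubound pn0.
have ve' : valid_exponents m0 n0 ai bi U E e'.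
  split=> // x gx c cn.
  have [[j jn jc]|h] := pselect (exists2 j, (j < n)%N & p j = c); last first.
    rewrite /ubound cn e'c; first by have := vg x gx c cn; rewrite /ubound cn.
    by move=> j jn; apply/eqP => h1; apply: h; exists j.
  rewrite -jc /ubound pn0 // e'p //.
  have old : x (p j) <= U%:R * (3 / 4) ^+ e (p j).
    by have := vg x gx _ (pn0 _ jn); rewrite uE.
  have [_ [[_ ->]|[wp [t [h1 _ h2 _]]]]] := hd j jn; first by rewrite addn0.
  case: h2 => [->|]; first by rewrite addn0.
  apply: le_trans; apply: le_trans h1; rewrite ler_pdivlMr // mulrC.
  apply: le_trans (ltW (hx x gx)); rewrite (sumD1 (fun i => w i * x (p i)) jn) lerDl.
  apply: sumr_ge0 => i _; rewrite mulr_ge0 ?w0 //.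
  by case: gx => _ g2 _ _; have /andP[] := g2 _ (pn0 _ (ltn_ord i)).
have sumc (f : nat -> nat) : (forall c, (e c <= f c)%N) ->
    steps n0 E f = (\sum_(j < n) (E - f (p j)))%N.
  move=> ef; apply: (sum_position (F := fun c => (E - f c)%N)) => // c cn h.
  apply/eqP; rewrite subn_eq0; apply: leq_trans (ef c); rewrite leqNgt.
  by apply/negP => /(pcov _ cn)[j jn pj]; have := h j jn; rewrite pj eqxx.
have stepsE : (steps n0 E e' + \sum_(j < n) d j = steps n0 E e)%N.
  rewrite !sumc // -big_split /=; apply: eq_bigr => j _.
  have h := dE _ (ltn_ord j); rewrite e'p //; clear - h; lia.
exists e'; split=> // rho q' rq.
apply: (potential_decrease rq (d := \sum_(j < n) d j)) => //.
have [[j jn hj]|h] := pselect (exists2 j, (j < n)%N & (E <= e' (p j))%N).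
  by left; exists (p j); [apply: pn0 | rewrite peE].
right.
have aliveE : alive n0 E e = n.
  rewrite /alive (sum_position (F := fun c => nat_of_bool (e c < E)%N) (n := n) (p := p)) //.
    under eq_bigr => j _ do rewrite peE //.
    by rewrite sum1_card card_ord.
  move=> c cn hc; case: ltnP => // /(pcov _ cn)[j jn pj].
  by have := hc j jn; rewrite pj eqxx.
rewrite aliveE; split=> //.
have n20 : 2%:R * n%:R != 0 :> rat by rewrite -natrM pnatr_eq0; lia.
have Up : 0 < U%:R :> rat by rewrite ltr0n.
have upos j : (j < n)%N -> 0 < ubound e (p j).
  move=> jn; rewrite uE //; apply: (mulr_gt0 Up); apply: exprn_gt0.
  by apply: divr_gt0; rewrite ltr0n.
have q0 : 0 < q.
  rewrite divr_gt0 ?mulr_gt0 ?ltr0n //.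
  rewrite (sumD1 (fun j => w j * ubound e (p j)) jn1) ltr_pwDl //.
    by rewrite mulr_gt0 ?upos // lt_neqAle eq_sym wj1 w0.
  by apply: sumr_ge0 => i _; rewrite mulr_ge0 ?w0 // ltW // upos.
apply: (shrink_progress (u := fun j => ubound e (p j)) (w := w) (q := q)) => //.
  by rewrite /q mulfVK.
move=> j jn; have [_ [[-> _]|[wp [t [h1 h2 _ h4]]]]] := hd j jn; first by rewrite !mul0r.
have e'l : (e (p j) + d j < E)%N.
  by rewrite -e'p // ltnNge; apply/negP => h5; apply: h; exists j.
(* A loop with target [1 / U] would have ended with a bound below the threshold, that is, with an
   exponent at least [E]. *)
have tq : t = q / w j.
  case: h2 => // tU; move: e'l; rewrite hE => h6; move: h4; rewrite tU.
  move=> h7; have : U%:R * (U%:R * (3 / 4) ^+ (e (p j) + d j).+1) < 1 :> rat.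
    by rewrite -(ltr_pM2l Up) divff ?gt_eqF // in h7.
  rewrite exprSr [U%:R * (_ * (3 / 4))]mulrA ltNge.
  by rewrite three_quarters_threshold h6.
rewrite uE // -mulrA -[X in w j * X]mulrA -exprD addnS mulrC -ltr_pdivlMr //.
by rewrite -tq.
Qed.

End ShrinkProgress.

(** * Calls of the subroutine *)

Lemma exec_cells call c s k s' : (forall s k s', ~ call s k s') ->
  exec call c s k s' ->
  forall a i j, s' a i j = s a i j \/ (rat_size (s' a i j) <= bits k)%N.
Proof.
move=> nc; elim => {c s k s'}.
- by move=> s a i j; left.
- move=> a e1 e2 e i j q k1 k2 k s _ _ He a' i' j'; rewrite updE; case: ifP => _; last by left.
  (* A written cell holds the value of an evaluated expression, and [bits] counts the size of that
     value. *)
  right; rewrite /= leq_max; apply/orP; right.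
  by case: He => * /=; rewrite ?leq_max ?leqnn ?orbT.
- move=> c1 c2 s1 s2 s3 k1 k2 _ IH1 _ IH2 a i j; rewrite /= leq_max.
  case: (IH2 a i j) => [->|->]; last by right; rewrite orbT.
  by case: (IH1 a i j) => [->|->]; [left | right].
- move=> t c1 c2 r s s' k1 k2 _ _ IH a i j; rewrite /= leq_max.
  by case: (IH a i j) => [->|->]; [left | right; rewrite orbT].
- by move=> t c s k _ a i j; left.
- move=> t c s1 s2 s3 k1 k2 k3 _ _ IH1 _ IH2 a i j; rewrite /= !leq_max.
  case: (IH2 a i j) => [->|->]; last by right; rewrite orbT.
  by case: (IH1 a i j) => [->|->]; [left | right; rewrite orbT].
- by move=> s k s' /nc.
Qed.

Lemma entry_block s a m n i j :
  entry (block s a m n) i j = s a i j \/ entry (block s a m n) i j = 0.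
Proof.
rewrite /entry; case: insubP => [i' _ <-|_]; last by right.
by case: insubP => [j' _ <-|_]; [left; rewrite mxE | right].
Qed.

Lemma entry_scalar (q : rat) i j :
  entry (q%:M : 'M_1) i j = q \/ entry (q%:M : 'M_1) i j = 0.
Proof.
rewrite /entry; case: insubP => [i' _ _|_]; last by right.
by case: insubP => [j' _ _|_]; [left; rewrite !ord1 mxE eqxx | right].
Qed.

Lemma mx_size_le m n (M : 'M[rat]_(m, n)) t :
  (forall i j, (rat_size (M i j) <= t)%N) -> (mx_size rat_size M <= m * (n * t))%N.
Proof.
move=> h; rewrite /mx_size; apply: leq_trans (_ : \sum_(i < m) (n * t) <= _)%N.
  apply: leq_sum => i _; apply: leq_trans (_ : \sum_(j < n) t <= _)%N.
    exact: leq_sum.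
  by rewrite sum_nat_const card_ord.
by rewrite sum_nat_const card_ord.
Qed.

Section Call.
Variables (R : realType) (B : cmd) (C cB dB Z S1 S : nat).
Hypothesis hB : forall m n (A : 'M[rat]_(m, n)) (b : 'cV[rat]_m) (u : 'cV[rat]_n),
    (0 < m)%N -> (0 < n)%N -> row_free A -> (forall j, 0 < u j 0) ->
    exists k s,
      [/\ exec no_call B (input_mem A b u) k s,
          subroutine_output R A b u s,
          (ops k <= C * n ^ 4)%N &
          (bits k <= cB * (mx_size rat_size (row_mx A b) + mx_size rat_size u) ^ dB)%N].
Let SB := (cB * (Z * (Z + 2) * (2 * S1 + 2)) ^ dB)%N.
Hypothesis SBS : (SB <= S)%N.
Hypothesis ZS : (Z < 2 ^ S)%N.

(** The identity block gives full row rank. The size of the results of [B] is not specified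
    directly; [exec_cells] extracts it from the bound on the bits of the run. *)
Lemma wp_call m n o l (s : memory) (Q : nat -> nat -> memory -> Prop) :
  s aM 0%N 0%N = m%:R -> s aN 0%N 0%N = n%:R -> (0 < m)%N -> (m <= n)%N -> (n <= Z)%N ->
  (forall i j, (i < m)%N -> (j < m)%N -> s aA i j = (i == j)%:R) ->
  (forall i j, (i < m)%N -> (j < n)%N -> (hgt (s aA i j) <= 2 ^ S1)%N) ->
  (forall i, (i < m)%N -> (hgt (s aB i 0) <= 2 ^ S1)%N) ->
  (forall j, (j < n)%N -> (hgt (s aU j 0) <= 2 ^ S1)%N) ->
  (forall j, (j < n)%N -> 0 < s aU j 0%N) ->
  (forall o' (s' : memory), (o' <= o + C * n ^ 4)%N -> frame (mods Call) s s' ->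
    (s' aAns 0%N 0%N = 1 /\ (forall j, (j < n)%N -> 0 <= s' aX j 0%N) /\
       solves m n (s aA) (fun i => s aB i 0%N) (fun j => s' aX j 0%N)) \/
    (s' aAns 0%N 0%N = 0 /\
     [/\ forall j, (j < n)%N -> 0 <= s' aW j 0%N,
         exists2 j, (j < n)%N & s' aW j 0%N != 0,
         forall j, (j < n)%N -> (hgt (s' aW j 0%N) <= 2 ^ SB)%N &
         forall x, solves m n (s aA) (fun i => s aB i 0%N) x ->
           (forall j, (j < n)%N -> 0 <= x j <= s aU j 0%N) ->
           \sum_(j < n) s' aW j 0%N * x j <
             (\sum_(j < n) s' aW j 0%N * s aU j 0%N) / (2%:R * n%:R)]) ->
    Q o' l.+1 s') ->
  wp B S Call o l s Q.
Proof.
move=> hm hn m0 mn nZ hid hA hb hu u0 HQ bs.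
pose A := block s in_A m n; pose b := block s in_b m 1; pose u := block s in_u n 1.
have n0 : (0 < n)%N by apply: leq_trans mn.
have Afree : row_free A.
  apply: inj_row_free => v hv; apply/matrixP => i0 i; rewrite ord1 [RHS]mxE.
  have := congr1 (fun M : 'rV_n => M 0 (widen_ord mn i)) hv; rewrite !mxE => h.
  rewrite -[RHS]h (bigD1 i) //= big1 ?addr0 => [|l' hl].
    by rewrite mxE /= hid // eqxx mulr1.
  rewrite mxE /= hid //; have -> : (l' == i :> nat) = false by apply: negbTE.
  by rewrite mulr0.
have up j : 0 < u j 0 by rewrite mxE u0.
have [k [s0 [ek so hops hbits]]] := hB b m0 n0 Afree up.
have kb : (bits k <= SB)%N.
  apply: leq_trans hbits _; rewrite leq_mul2l; apply/orP; right.
  have h1 : (mx_size rat_size (row_mx A b) <= m * ((n + 1) * (2 * S1 + 2)))%N.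
    apply: mx_size_le => i j; apply: rat_size_hgt; rewrite mxE.
    by case: splitP => j' _; rewrite mxE ?ord1; [apply: hA | apply: hb].
  have h2 : (mx_size rat_size u <= n * (1 * (2 * S1 + 2)))%N.
    by apply: mx_size_le => i j; apply: rat_size_hgt; rewrite mxE ord1; apply: hu.
  have h3 : (mx_size rat_size (row_mx A b) + mx_size rat_size u <=
      Z * (Z + 2) * (2 * S1 + 2))%N.
    apply: leq_trans (leq_add h1 h2) _; rewrite mulnA mul1n -mulnDl leq_mul2r.
    apply/orP; right; move: mn nZ; clear; nia.
  case: (dB) => [|d]; first by rewrite !expn0.
  by rewrite leq_exp2r.
have cells := exec_cells (fun _ _ _ h => h) ek.
have in0 a i j : (hgt (input_mem A b u a i j) <= 2 ^ S)%N.
  have z0 : (hgt 0 <= 2 ^ S)%N by rewrite (hgt_nat 0) expn_gt0.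
  rewrite /input_mem; do 5?[case: ifP => _].
  - by case: (entry_scalar m%:R i j) => ->; rewrite ?hgt_nat //; apply: leq_ltn_trans ZS; lia.
  - by case: (entry_scalar n%:R i j) => ->; rewrite ?hgt_nat //; apply: leq_ltn_trans ZS; lia.
  - by case: (entry_block s in_A m n i j) => ->.
  - by case: (entry_block s in_b m 1 i j) => ->.
  - by case: (entry_block s in_u n 1 i j) => ->.
  - by [].
exists (Cost (ops k) 1 (bits k)), (return_mem s s0); split.
- by apply: exec_Call; apply: call_of_intro ek.
- by apply: leq_trans kb _; apply: leq_trans SBS _; clear; lia.
- move=> a i j; rewrite /return_mem; case: ifP => _ //.
  case: (cells a i j) => [->|h]; first exact: in0.
  apply: leq_trans (hgt_rat_size _) _; rewrite leq_exp2l //.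
  by apply: leq_trans h _; apply: leq_trans kb SBS.
rewrite addn1; apply: HQ; first by rewrite leq_add2l.
  by move=> a /negPf; rewrite /return_mem => ->.
case: so => [[ans [Ax x0]]|[ans [w0 wn lt]]].
  left; split=> //; split=> [j jn|i im].
    by have := x0 (Ordinal jn); rewrite mxE.
  have := congr1 (fun M : 'cV_m => M (Ordinal im) 0) Ax; rewrite !mxE => h.
  by rewrite -[RHS]h; apply: eq_bigr => j _; rewrite !mxE.
right; split=> //; split.
- by move=> j jn; have := w0 (Ordinal jn); rewrite mxE.
- have /matrix0Pn[j [j' wj]] := wn.
  by exists j => //; rewrite mxE ord1 in wj.
- move=> j jn; rewrite /return_mem /=; case: (cells aW j 0%N) => [->|h].
    by rewrite /input_mem /= (hgt_nat 0) expn_gt0.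
  by apply: leq_trans (hgt_rat_size _) _; rewrite leq_exp2l // (leq_trans h kb).
- move=> x sx xu; pose X : 'cV[rat]_n := \col_j x j.
  have AX : A *m X = b.
    apply/matrixP => i j; rewrite ord1 !mxE -(sx _ (ltn_ord i)).
    by apply: eq_bigr => c _; rewrite !mxE.
  (* As [A *m X = b], the terms with [v] cancel on both sides, so only [w] matters to the caller. *)
  have := lt (map_mx ratr X) _.
  rewrite -map_mxM [X in X < _]mxE ltr_rat mulmxDl -mulmxA AX [X in X < _]mxE ltrD2l => h.
  have := h _; rewrite !mxE.
  rewrite (eq_bigr (fun j : 'I_n => s0 aW j 0%N * x j)); last by move=> j _; rewrite !mxE.
  rewrite [X in _ < _ * X](eq_bigr (fun j : 'I_n => s0 aW j 0%N * s aU j 0%N)); last first.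
    by move=> j _; rewrite !mxE.
  rewrite mulrC; apply => j; rewrite !mxE ler0q ler_rat; exact: xu.
Qed.

End Call.
Arguments wp_call [R] {B} [C cB dB Z S1] {S} hB SBS ZS [m n o l s Q].

(** * The main loop *)

Definition scatter : cmd :=
  For aJ (Cst 0) aN (Assign aY (G1 aP aJ) (Cst 0) (G1 aX aJ)).

(** The sweep may clear [aRun], which is why it is tested again. With no equation left the zero
    vector is a solution, and the subroutine, specified for [0 < m], is not called. *)
Definition main_loop : cmd :=
  While (Cmp Lt (Cst 0) (V aRun))
    (Seq sweep
      (If (Cmp Lt (Cst 0) (V aRun))
        (If (Cmp Eq (V aM) (Cst 0))
          (Seq (Set1 aRun (Cst 0)) (Set1 aAns (Cst 1)))
          (Seq Call
            (If (Cmp Eq (V aAns) (Cst 1))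
              (Seq (Set1 aRun (Cst 0)) scatter)
              shrink)))
        Skip)).

Lemma wp_scatter B S n p o l (s : memory) (Q : nat -> nat -> memory -> Prop) :
  (3 <= S)%N -> (n < 2 ^ S)%N ->
  s aN 0%N 0%N = n%:R ->
  (forall j, (j < n)%N -> s aP j 0%N = (p j)%:R) ->
  (forall i j, (i < n)%N -> (j < n)%N -> p i = p j -> i = j) ->
  (forall c, s aY c 0%N = 0) ->
  (forall o' (s' : memory), (o' <= o + 1 + 2 * n)%N ->
    (forall j, (j < n)%N -> s' aY (p j) 0%N = s aX j 0%N) ->
    (forall c, (forall j, (j < n)%N -> p j != c) -> s' aY c 0%N = 0) ->
    frame (mods scatter) s s' -> Q o' l s') ->
  wp B S scatter o l s Q.
Proof.
move=> S3 nS hn hp pinj hy HQ; apply: wp_frame; rewrite /scatter.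
pose I i (s' : memory) := (forall j, (j < i)%N -> s' aY (p j) 0%N = s aX j 0%N) /\
  (forall c, (forall j, (j < i)%N -> p j != c) -> s' aY c 0%N = 0).
apply: (wp_for S3 (I := I) (i0 := 0) (n := n) (K := 0)) => //.
- by split=> // c _; rewrite updE hy.
- move=> i s1 /andP[_ im] hi [I1 I2] bs fr.
  have hp1 : s1 aP i 0%N = (p i)%:R by rewrite fr // hp.
  have hx1 : s1 aX i 0%N = s aX i 0%N by rewrite fr.
  apply: (wp_assign S3); [by apply: ev_G1 hi hp1 | by apply: ev_N | ev_tac | by [] | by rewrite -hx1 |].
  split=> // _; split=> [j|c].
    rewrite ltnS => ji; rewrite !updE /= andbT.
    have [e|ne] := eqVneq (p j) (p i).
      by have -> : j = i by apply: pinj e => //; apply: leq_ltn_trans im.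
    have ij : j != i by apply: contraNneq ne => ->.
    by rewrite I1 // ltn_neqAle ij.
  move=> hc; rewrite !updE /= andbT.
  have -> : (c == p i) = false by rewrite eq_sym; apply/negbTE/hc.
  by apply: I2 => j ji; apply: hc; apply: ltnW.
move=> o1 s1 ho1 [I1 I2] hj fr fr2; apply: HQ => //.
by move: ho1; rewrite /=; clear; lia.
Qed.

(** The last round need not lower the potential; its cost is paid by the extra [K * rho]. *)
Lemma final_round rho o o1 o2 K P P1 t t1 :
  (rho * o1 + K * P1 + rho * (5 * t1) <= rho * o + K * P + rho * (5 * t))%N ->
  (o2 <= o1 + K)%N -> (rho * o2 <= rho * o + K * (P + rho) + rho * (5 * t))%N.
Proof.
move=> h h2; have : (rho * o2 <= rho * (o1 + K))%N by rewrite leq_mul2l h2 orbT.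
by rewrite !mulnDr [(K * rho)%N]mulnC; move: h; lia.
Qed.

(** Everything is multiplied by [rho] because a round lowers the potential by [rho]: the fixed cost
    [K] is paid from [K * P1], and the [d] multiplications by [3/4], at 5 operations each, from the
    term in the number of steps left. *)
Lemma inner_round rho o o1 o2 K P P1 P2 t t1 t2 d :
  (rho * o1 + K * P1 + rho * (5 * t1) <= rho * o + K * P + rho * (5 * t))%N ->
  (o2 <= o1 + K + 5 * d)%N -> (P2 + rho <= P1)%N -> (t2 + d = t1)%N ->
  (rho * o2 + K * P2 + rho * (5 * t2) <= rho * o + K * P + rho * (5 * t))%N.
Proof.
move=> h h2 h3 ht; rewrite -ht in h.
have h4 : (rho * o2 <= rho * (o1 + K + 5 * d))%N by rewrite leq_mul2l h2 orbT.
have h5 : (K * (P2 + rho) <= K * P1)%N by rewrite leq_mul2l h3 orbT.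
apply: leq_trans h; move: h4 h5; rewrite !mulnDr [(K * rho)%N]mulnC; lia.
Qed.

Section MainLoop.
Variables (R : realType) (B : cmd) (C cB dB : nat).
Hypothesis hB : forall m n (A : 'M[rat]_(m, n)) (b : 'cV[rat]_m) (u : 'cV[rat]_n),
    (0 < m)%N -> (0 < n)%N -> row_free A -> (forall j, 0 < u j 0) ->
    exists k s,
      [/\ exec no_call B (input_mem A b u) k s,
          subroutine_output R A b u s,
          (ops k <= C * n ^ 4)%N &
          (bits k <= cB * (mx_size rat_size (row_mx A b) + mx_size rat_size u) ^ dB)%N].
Variables (m0 n0 : nat) (ai : nat -> nat -> int) (bi : nat -> int) (U E S1 : nat).
Let Z := (n0 + m0)%N.
Let SB := (cB * (Z * (Z + 2) * (2 * S1 + 2)) ^ dB)%N.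
Variables (rho q' : nat).
Hypothesis rq : (rho <= 2 * q')%N.
Hypothesis r0 : (0 < rho)%N.
Hypothesis U0 : (0 < U)%N.
Hypothesis hE : forall k, (k < E)%N = (4 <= 3 * U%:R * (U%:R * (3 / 4) ^+ k) :> rat).
Hypothesis hU : forall k, (k <= E)%N -> (hgt (U%:R * (3 / 4) ^+ k) <= 2 ^ S1)%N.
Hypothesis S1U : (2 * entry_bound (\matrix_(r < m0, c < Z) ai r c) (\col_(r < m0) bi r) ^ 2
  <= 2 ^ S1)%N.
Variable S : nat.
Hypothesis hS : ((SB + S1 + 1) * (Z + 1) + 4 * S1 + 3 <= S)%N.
Let a r c : rat := (ai r c)%:~R.
Let b r : rat := (bi r)%:~R.
Notation inv := (tab_invariant m0 n0 ai bi U E).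
Notation good := (good m0 n0 ai bi U).
Notation valid := (valid_exponents m0 n0 ai bi U E).
Notation pot := (potential n0 E rho q').

Definition round_cost : nat :=
  (100 + (Z + 1) * (60 + 50 * (Z * Z)) + C * Z ^ 4 + 30 * Z)%N.

Definition answered (s : memory) : Prop :=
  (s aAns 0%N 0%N = 1 /\ (forall c, 0 <= s aY c 0%N) /\
     forall r, (r < m0)%N -> \sum_(c < n0) a r c * s aY c 0%N = b r) \/
  (s aAns 0%N 0%N = 0 /\ forall x, ~ good x).

Lemma wp_main_loop m n p e o l (s : memory) (Q : nat -> nat -> memory -> Prop) :
  inv s m n p e -> valid e -> s aRun 0%N 0%N = 1 ->
  (forall o' l' (s' : memory),
     (rho * o' <= rho * o + round_cost * (pot e + rho) + rho * (5 * steps n0 E e) + rho)%N ->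
     (rho * l' <= rho * l + pot e + rho)%N ->
     answered s' -> Q o' l' s') ->
  wp B S main_loop o l s Q.
Proof.
move=> iv ve run1 HQ.
have [K1 K1E] : exists K1, K1 = round_cost by eexists.
rewrite -K1E in HQ.
have S3 : (3 <= S)%N by move: hS; clear; lia.
have S14 : (4 * S1 <= S)%N by move: hS; clear; lia.
have hS' : ((SB + S1 + 1) * (Z + 1) <= S)%N by move: hS; clear; lia.
have ZS0 : (Z < S)%N by move: hS; clear; nia.
have ZS : (Z < 2 ^ S)%N by apply: ltn_trans ZS0 _; apply: (ltn_expl S (isT : 1 < 2)%N).
have S8 : (2 ^ 3 <= 2 ^ S)%N by rewrite leq_exp2l.
have SBS : (SB <= S)%N by move: hS; clear; nia.
(* Variant 0 is kept for the finished state, hence the successor while the loop is running. *)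
pose I v o' l' (s' : memory) :=
  (exists m' n' p' e', [/\ inv s' m' n' p' e', valid e', s' aRun 0%N 0%N = 1,
     v = (pot e').+1 &
     (rho * l' + pot e' <= rho * l + pot e)%N /\
     (rho * o' + K1 * pot e' + rho * (5 * steps n0 E e') <=
        rho * o + K1 * pot e + rho * (5 * steps n0 E e))%N]) \/
  [/\ v = 0%N, s' aRun 0%N 0%N = 0, answered s',
     (rho * l' <= rho * l + pot e + rho)%N &
     (rho * o' <= rho * o + K1 * (pot e + rho) + rho * (5 * steps n0 E e))%N].
apply: (wp_while S3 (I := I) (v := (pot e).+1)) => //; last first.
  by left; exists m, n, p, e; split=> //; split.
move=> v o1 l1 s1 [[m1 [n1 [p1 [e1 [iv1 ve1 run1' -> [hl1 ho1]]]]]]|] bs; last first.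
  case: bs => v0 run0 ans hl ho _.
  exists 0%:R, 0; split; [ev_tac | ev_tac |].
  rewrite /= ?ltxx; apply: HQ => //; rewrite mulnDr.
  by move: ho; clear; lia.
exists 0%:R, 1; split; [ev_tac | ev_tac |].
rewrite /= ?ltr01; apply: wp_seq.
apply: (wp_sweep hE S3 S14 ZS S1U iv1 ve1 run1') => [o2 s2 m2 n2 p2 ho2 iv2 run2 al2|o2 s2 ho2 run2 ans2 ng]; last first.
  apply: (wp_if S3 (x := 0%:R) (y := 0)); [ev_tac | ev_tac | by [] |].
  rewrite /= ?ltxx; apply: wp_skip; exists 0%N => //; right; split=> //.
  - by right.
  - by move: hl1; clear; lia.
  - apply: final_round ho1 _.
    by move: ho2; rewrite K1E /round_cost -/Z /=; clear; lia.
case: (iv2) => hm2 hn2 ht2 nZ2 hp2 hu2 tab2 sol2 cov2 hy2.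
have mn2 := tab_mn tab2.
have nS2 : (n2 < 2 ^ S)%N by apply: leq_ltn_trans ZS.
apply: (wp_if S3 (x := 0%:R) (y := 1)); [ev_tac | ev_tac | by [] |].
rewrite /= ?ltr01; apply: (wp_if S3 (x := m2%:R) (y := 0%:R)); [ev_tac | ev_tac | by [] |].
rewrite /comparison_sem eqr_nat; case: eqP => [m20|/eqP m20].
  apply: wp_seq; apply: (wp_set S3); [ev_tac | by [] | by move=> _; rewrite hgt_nat; move: S8; clear; lia |].
  apply: (wp_set S3); [ev_tac | by [] | by move=> _; rewrite hgt_nat; move: S8; clear; lia |].
  exists 0%N => //; right; split=> //.
  (* With an empty basis [tab_decb] says that [b] is 0, so the zero vector in [aY] solves the
     original system. *)
  - left; split=> //; split=> [c|r hr]; first by rewrite !updE /= hy2.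
    rewrite -[RHS](tab_decb tab2 hr) m20 big_ord0 big1 // => c _.
    by rewrite !updE /= hy2 mulr0.
  - by move: hl1; clear; lia.
  - apply: final_round ho1 _.
    by move: ho2; rewrite K1E /round_cost -/Z /=; clear; lia.
have m2p : (0 < m2)%N by rewrite lt0n.
have n2p : (0 < n2)%N by apply: leq_trans mn2.
have [hA hb] := tab_hgt tab2.
have al2u j : (j < n2)%N -> s2 aU j 0%N = U%:R * (3 / 4) ^+ e1 (p2 j).
  by move=> jn; have /andP[h _] := al2 j jn; rewrite hu2 // /ubound h.
have al2E j : (j < n2)%N -> (e1 (p2 j) < E)%N by move=> /al2/andP[].
have Up : 0 < U%:R :> rat by rewrite ltr0n.
have hn4 : (C * n2 ^ 4 <= C * Z ^ 4)%N by rewrite leq_mul2l leq_exp2r // nZ2 orbT.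
apply: wp_seq; apply: (wp_call hB SBS ZS (m := m2) (n := n2)) => //.
- exact: tab_id tab2.
- by move=> i j im jn; apply: leq_trans (hA i j im jn) S1U.
- by move=> i im; apply: leq_trans (hb i im) S1U.
- by move=> j jn; rewrite al2u // hU // ltnW // al2E.
- move=> j jn; rewrite al2u //; apply: (mulr_gt0 Up); apply: exprn_gt0.
  by apply: divr_gt0; rewrite ltr0n.
move=> o3 s3 ho3 fr3 [[ans3 [x0 sx]]|[ans3 [w0 [jw jwn wj] hw lt]]].
  apply: (wp_if S3 (x := 1) (y := 1%:R)); [ev_tac | ev_tac | by [] |].
  rewrite /comparison_sem eqxx.
  apply: wp_seq; apply: (wp_set S3); [ev_tac | by [] | by move=> _; rewrite hgt_nat; move: S8; clear; lia |].
  apply: (@wp_scatter B S n2 p2) => //.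
  - by rewrite updE /= fr3.
  - by move=> j jn; rewrite updE /= fr3 // hp2.
  - exact: tab_inj tab2.
  - by move=> c; rewrite updE /= fr3 // hy2.
  move=> o4 s4 ho4 y1 y2 fr4.
  exists 0%N => //; right; split=> //.
  - by rewrite fr4 // updE /=.
  - left; split; first by rewrite fr4.
    (* Deleted columns keep the initial value 0 of [aY]. *)
    split=> [c|r hr].
      have [[j jn <-]|h] := pselect (exists2 j, (j < n2)%N & p2 j = c).
        by rewrite y1 // updE /= x0.
      by rewrite y2 // => j jn; apply/eqP => h1; apply: h; exists j.
    rewrite (sum_position (F := fun c => a r c * s4 aY c 0%N) (n := n2) (p := p2)).
    + rewrite -[RHS](tab_solves tab2 sx hr); apply: eq_bigr => j _.
      by rewrite y1 // updE.
    + by move=> j /al2/andP[].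
    + exact: tab_inj tab2.
    + by move=> c _ hc; rewrite y2 // mulr0.
  - by move: hl1; rewrite mulnS; clear; lia.
  - apply: final_round ho1 _.
    by move: ho2 ho3 ho4 hn4 nZ2; rewrite K1E /round_cost -/Z /=; clear; lia.
apply: (wp_if S3 (x := 0) (y := 1%:R)); [ev_tac | ev_tac | by [] |].
have -> : comparison_sem Eq 0 1%:R = false by rewrite /= eq_sym oner_eq0.
have u32 j : s3 aU j 0%N = s2 aU j 0%N by rewrite fr3.
have hq : (\sum_(j < n2) s3 aW j 0%N * s3 aU j 0%N) / (2%:R * n2%:R) =
   (\sum_(j < n2) s3 aW j 0%N * ubound n0 U e1 (p2 j)) / (2%:R * n2%:R).
  by congr (_ / _); apply: eq_bigr => j _; rewrite u32 hu2.
apply: (wp_shrink U0 hE hU S3 hS' (n := n2) (e := fun j => e1 (p2 j))) => //.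
- by rewrite fr3.
- by rewrite fr3.
- by rewrite n2p.
- by move=> j jn; rewrite u32 al2u.
move=> o4 s4 d ho4 u4 d4 fr4; rewrite hq in d4.
have [|e2 [ve2 ee2 e2p steps2 pot2]] := shrink_exponents U0 hE n2p (tab_inj tab2) al2 cov2 ve1 w0
  (ex_intro2 _ _ jw jwn wj) _ d4.
  move=> x gx; rewrite -hq.
  have <- : \sum_(j < n2) s3 aW j 0%N * s2 aU j 0%N =
      \sum_(j < n2) s3 aW j 0%N * s3 aU j 0%N.
    by apply: eq_bigr => j _; rewrite u32.
  apply: (lt (fun j => x (p2 j))); first exact: sol2.
  move=> j jn; have /andP[pn _] := al2 j jn.
  rewrite hu2 // (exp_good ve1 gx pn) andbT.
  by case: gx => _ g2 _ _; have /andP[] := g2 _ pn.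
have {}pot2 := pot2 rho q' rq.
have ee c : (c < n0)%N -> (e2 c < E)%N -> (e1 c < E)%N.
  by move=> _; apply: leq_ltn_trans.
exists (pot e2).+1; first by move: pot2 r0; clear; lia.
left; exists m2, n2, p2, e2; split=> //.
- split=> //.
  + by rewrite fr4 // fr3.
  + by rewrite fr4 // fr3.
  + by rewrite fr4 // fr3.
  + by move=> j jn; rewrite fr4 // fr3 // hp2.
  + by move=> j jn; have /andP[h _] := al2 j jn; rewrite u4 // /ubound h e2p.
  + by rewrite !fr4 // !fr3.
  + by move=> x gx; rewrite !fr4 // !fr3 //; apply: sol2.
  + by move=> c cn ce; apply: cov2 => //; apply: ee.
  + by move=> c; rewrite fr4 // fr3 // hy2.
- by rewrite fr4 // fr3.
- split; first by move: hl1 pot2; rewrite mulnS; clear; lia.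
  apply: inner_round ho1 _ pot2 steps2.
  by move: ho2 ho3 ho4 hn4 nZ2; rewrite K1E /round_cost -/Z /=; clear; lia.
Qed.

End MainLoop.

(** * Initialization *)

Definition multiply_bound : cmd :=
  Seq (If (Cmp Lt (V aQ) (Cst 0)) (Set1 aQ (Op Defs.Sub (Cst 0) (V aQ))) Skip)
      (Set1 aTop (Op Mul (V aTop) (Op Add (Cst 1) (V aQ)))).

(** A copy of [A] is saved in [aS] in passing, because [fill_tableau] shifts the columns within [aA]
    to make room for the slack basis. *)
Definition compute_bound : cmd :=
  For aI (Cst 0) aM0
    (Seq (Set1 aTop (Op Mul (V aTop) (Cst 2)))
    (Seq (Set1 aQ (G1 aB aI))
    (Seq multiply_bound
      (For aC (Cst 0) aN0
        (Seq (put2 aS aI aC (G2 aA aI aC))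
        (Seq (Set1 aQ (G2 aA aI aC)) multiply_bound)))))).

Definition fill_tableau : cmd :=
  For aI (Cst 0) aM0
    (Seq (For aC (Cst 0) aM0 (put2 aA aI aC (Cst 0)))
    (Seq (put2 aA aI aI (Cst 1))
      (For aC (Cst 0) aN0 (Assign aA (V aI) (Op Add (V aM0) (V aC)) (G2 aS aI aC))))).

Definition fill_columns : cmd :=
  Seq (For aC (Cst 0) aM0 (Seq (put1 aP aC (Op Add (V aN0) (V aC))) (put1 aU aC (Cst 0))))
      (For aC (Cst 0) aN0
        (Seq (Assign aP (Op Add (V aM0) (V aC)) (Cst 0) (V aC))
             (Assign aU (Op Add (V aM0) (V aC)) (Cst 0) (V aTop)))).

(* The slack basis [I] is put in front of the columns of [A], with upper bounds
   [0], so that the first sweep removes it and brings the tableau into shape. *)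
Definition initialize : cmd :=
  Seq (Set1 aN0 (V aN)) (Seq (Set1 aM0 (V aM))
  (Seq (Set1 aTot (Op Add (V aN) (V aM))) (Seq (Set1 aTop (Cst 1))
  (Seq compute_bound
  (Seq (Set1 aTop (Op Mul (Op Mul (Cst 2) (V aTop)) (Op Mul (Cst 2) (V aTop))))
  (Seq fill_tableau (Seq fill_columns
  (Seq (Set1 aN (V aTot)) (Set1 aRun (Cst 1)))))))))).

Definition solver : cmd :=
  Seq initialize (Seq main_loop (For aC (Cst 0) aN0 (put1 aX aC (G1 aY aC)))).

Lemma prod_prefix_le (f : nat -> nat) i n : (i <= n)%N -> (forall r, (0 < f r)%N) ->
  (\prod_(r < i) f r <= \prod_(r < n) f r)%N.
Proof.
move=> + f0; elim: n => [|n IH]; first by rewrite leqn0 => /eqP ->.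
rewrite leq_eqVlt => /predU1P[-> //|]; rewrite ltnS => /IH h.
by rewrite big_ord_recr /=; apply: leq_trans h _; rewrite leq_pmulr.
Qed.

Section Initialize.
Variables (B : cmd) (S m0 n0 : nat) (A : nat -> nat -> int) (b : nat -> int).
Hypothesis S3 : (3 <= S)%N.

(** The factor 2 is the contribution of the slack entry 1 in the row, so that the product over the
    rows is the entry bound of the extended system. *)
Definition row_bound (r : nat) : nat :=
  (2 * (`|b r|.+1 * \prod_(c < n0) `|A r c|.+1))%N.
Definition system_bound : nat := (\prod_(r < m0) row_bound r)%N.
Let U := ((2 * system_bound) ^ 2)%N.
Hypothesis hU : (U.+1 <= 2 ^ S)%N.
Hypothesis ZS : (n0 + m0 < 2 ^ S)%N.

Lemma row_bound_gt0 r : (0 < row_bound r)%N.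
Proof. by rewrite !muln_gt0 /= prodn_gt0. Qed.

Lemma system_bound_gt0 : (0 < system_bound)%N.
Proof. by apply: prodn_gt0 => r; apply: row_bound_gt0. Qed.

Let small k : (k <= system_bound)%N -> (hgt k%:R <= 2 ^ S)%N.
Proof.
move=> h; rewrite hgt_nat; apply: leq_trans hU; rewrite ltnS (leq_trans h) //.
by rewrite /U; have := system_bound_gt0; nia.
Qed.

Lemma wp_multiply_bound (z : int) (k : nat) o l (s : memory) (Q : nat -> nat -> memory -> Prop) :
  s aQ 0%N 0%N = z%:~R -> s aTop 0%N 0%N = k%:R -> (k * `|z|.+1 <= system_bound)%N ->
  (forall o' (s' : memory), (o' <= o + 4)%N -> s' aTop 0%N 0%N = (k * `|z|.+1)%:R ->
    frame (mods multiply_bound) s s' -> Q o' l s') ->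
  wp B S multiply_bound o l s Q.
Proof.
move=> hq ht hk HQ; apply: wp_frame; rewrite /multiply_bound; apply: wp_seq.
have main o1 (s1 : memory) : (o1 <= o + 2)%N -> s1 aQ 0%N 0%N = `|z|%:R ->
    s1 aTop 0%N 0%N = k%:R ->
    wp B S (Set1 aTop (Op Mul (V aTop) (Op Add (Cst 1) (V aQ)))) o1 l s1
      (fun o' l' s' => frame (mods multiply_bound) s s' -> Q o' l' s').
  move=> ho1 hq1 ht1.
  have E : k%:R * (1%:R + `|z|%:R) = (k * `|z|.+1)%:R :> rat.
    by rewrite [RHS]natrM -[`|z|.+1]add1n [in RHS]natrD.
  apply: (wp_set S3); [ev_tac | by [] | by move=> _; rewrite E small |].
  rewrite E => fr; apply: HQ fr => //.
  by move: ho1; rewrite /=; clear; lia.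
apply: (wp_if S3); [ev_tac | ev_tac | by [] |].
rewrite /comparison_sem (_ : 0%:R = 0%:~R :> rat) // ltr_int; case: ltP => hz.
  have E : 0%:R - z%:~R = `|z|%:R :> rat.
    by rewrite sub0r -rmorphN /= -(ltz0_abs hz).
  apply: (wp_set S3); [ev_tac | by [] | |].
    by move=> bs; rewrite sub0r hgtN -hq.
  by rewrite E; apply: main => //=; clear; lia.
apply: wp_skip; apply: main => //=; first by clear; lia.
by rewrite hq -{1}(gez0_abs hz).
Qed.

Lemma wp_compute_bound o l (s : memory) (Q : nat -> nat -> memory -> Prop) :
  s aM0 0%N 0%N = m0%:R -> s aN0 0%N 0%N = n0%:R -> s aTop 0%N 0%N = 1%:R ->
  (forall r c, (r < m0)%N -> (c < n0)%N -> s aA r c = (A r c)%:~R) ->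
  (forall r, (r < m0)%N -> s aB r 0%N = (b r)%:~R) ->
  (forall o' (s' : memory), (o' <= o + 1 + 9 * m0 + 6 * (m0 * n0))%N ->
    s' aTop 0%N 0%N = system_bound%:R ->
    (forall r c, (r < m0)%N -> (c < n0)%N -> s' aS r c = (A r c)%:~R) ->
    frame (mods compute_bound) s s' -> Q o' l s') ->
  wp B S compute_bound o l s Q.
Proof.
move=> hm hn ht hA hb HQ; apply: wp_frame; rewrite /compute_bound.
have m0S : (m0 < 2 ^ S)%N by apply: leq_ltn_trans ZS; apply: leq_addl.
have n0S : (n0 < 2 ^ S)%N by apply: leq_ltn_trans ZS; apply: leq_addr.
have pre i k : (i < m0)%N -> (k <= row_bound i)%N ->
    ((\prod_(r < i) row_bound r) * k <= system_bound)%N.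
  move=> im hk; apply: (@leq_trans (\prod_(r < i.+1) row_bound r)).
    by rewrite big_ord_recr /= leq_mul2l hk orbT.
  by apply: prod_prefix_le => //; apply: row_bound_gt0.
have inner i c : (c <= n0)%N ->
    (2 * (`|b i|.+1 * \prod_(c' < c) `|A i c'|.+1) <= row_bound i)%N.
  move=> hc; rewrite leq_mul2l leq_mul2l /=.
  exact: (@prod_prefix_le (fun c => `|A i c|.+1)).
pose I i (s' : memory) := s' aTop 0%N 0%N = (\prod_(r < i) row_bound r)%:R /\
  (forall r c, (r < i)%N -> (c < n0)%N -> s' aS r c = (A r c)%:~R).
apply: (wp_for S3 (I := I) (i0 := 0) (n := m0) (K := 7 + 6 * n0)) => //.
- by rewrite /I big_ord0.
- move=> i s1 /andP[_ im] hi [I1 I2] bs fr.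
  have hb1 : s1 aB i 0%N = (b i)%:~R by rewrite fr // hb.
  set P := (\prod_(r < i) row_bound r)%N in I1 *.
  have h1 : (P * 2 <= system_bound)%N.
    apply: pre => //; apply: leq_trans (inner i 0%N isT); rewrite big_ord0; clear; lia.
  apply: wp_seq; apply: (wp_set S3); [ev_tac | by [] | by rewrite -natrM => _; apply: small |].
  rewrite -natrM; apply: wp_seq; apply: (wp_set S3); [ev_tac | by [] | by rewrite -hb1 |].
  set s2 := upd _ _ _ _ _.
  apply: wp_seq; apply: (wp_multiply_bound (z := b i) (k := (P * 2)%N)) => //.
    rewrite -mulnA; apply: pre => //; apply: leq_trans (inner i 0%N isT).
    by rewrite big_ord0 muln1.
  move=> o3 s3 ho3 ht3 fr3.
  have hi3 : s3 aI 0%N 0%N = i%:R by rewrite fr3.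
  have hn3 : s3 aN0 0%N 0%N = n0%:R by rewrite fr3 // /s2 updE updE fr.
  pose J c (s' : memory) :=
    s' aTop 0%N 0%N = (P * (2 * (`|b i|.+1 * \prod_(c' < c) `|A i c'|.+1)))%:R /\
    (forall r c', (r < i)%N || (r == i) && (c' < c)%N -> (c' < n0)%N ->
       s' aS r c' = (A r c')%:~R).
  apply: (wp_for S3 (I := J) (i0 := 0) (n := n0) (K := 4)) => //.
  + split; first by rewrite updE /= ht3 big_ord0 muln1 mulnA.
    move=> r c' /orP[ri cn|/andP[//]].
    by rewrite updE fr3 // /s2 !updE /= I2.
  + move=> c s4 /andP[_ cn] hc [J1 J2] bs4 fr4.
    have hi4 : s4 aI 0%N 0%N = i%:R by rewrite fr4.
    have hA4 : s4 aA i c = (A i c)%:~R.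
      by rewrite fr4 // fr3 // /s2 updE updE fr // hA.
    apply: wp_seq; apply: (wp_put2 S3); [eassumption | eassumption | ev_tac | by [] | by rewrite -hA4 |].
    set s5 := upd _ _ _ _ _.
    apply: wp_seq; apply: (wp_set S3); [ev_tac | by [] | by rewrite -hA4 |].
    set s6 := upd _ _ _ _ _.
    apply: (wp_multiply_bound (z := A i c)
       (k := (P * (2 * (`|b i|.+1 * \prod_(c' < c) `|A i c'|.+1)))%N)) => //.
      rewrite -!mulnA; apply: pre => //; apply: leq_trans (inner i c.+1 cn).
      by rewrite big_ord_recr /= !mulnA.
    move=> o7 s7 ho7 ht7 fr7; split=> // hc7; split.
      by rewrite updE /= ht7 big_ord_recr /= !mulnA.
    move=> r c' hr cn'; rewrite updE fr7 // /s6 updE /= /s5 updE /=.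
    case: (eqVneq r i) hr => [->|ri] /=; last first.
      by rewrite orbF => hr; apply: J2; rewrite ?hr.
    rewrite ltnn /= ltnS leq_eqVlt; case: (eqVneq c' c) => [-> //|cc] /= hc'.
    by apply: J2 => //; rewrite eqxx hc' orbT.
  move=> o4 s4 ho4 [J1 J2] hc4 fr4; split=> //.
    by move: ho3 ho4; rewrite /=; clear; lia.
  move=> hi4; split; first by rewrite updE /= J1 big_ord_recr.
  move=> r c; rewrite ltnS leq_eqVlt updE /= => hr cn; apply: J2 => //.
  by rewrite cn andbT orbC.
move=> o1 s1 ho1 [I1 I2] hi fr fr2; apply: HQ => //.
by move: ho1; rewrite /= subn0; clear; nia.
Qed.

Lemma wp_fill_tableau o l (s : memory) (Q : nat -> nat -> memory -> Prop) :
  s aM0 0%N 0%N = m0%:R -> s aN0 0%N 0%N = n0%:R ->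
  (forall o' (s' : memory), (o' <= o + 1 + 4 * m0 + 4 * (m0 * (n0 + m0)))%N ->
    (forall r c, (r < m0)%N -> (c < n0 + m0)%N -> s' aA r c =
       if (c < m0)%N then (r == c)%:R else s aS r (c - m0)%N) ->
    frame (mods fill_tableau) s s' -> Q o' l s') ->
  wp B S fill_tableau o l s Q.
Proof.
move=> hm hn HQ; apply: wp_frame; rewrite /fill_tableau.
have m0S : (m0 < 2 ^ S)%N by apply: leq_ltn_trans ZS; apply: leq_addl.
have n0S : (n0 < 2 ^ S)%N by apply: leq_ltn_trans ZS; apply: leq_addr.
have S8 : (2 ^ 3 <= 2 ^ S)%N by rewrite leq_exp2l.
pose I i (s' : memory) := forall r c, (r < i)%N -> (c < n0 + m0)%N -> s' aA r c =
       if (c < m0)%N then (r == c)%:R else s aS r (c - m0)%N.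
apply: (wp_for S3 (I := I) (i0 := 0) (n := m0) (K := 2 + 2 * m0 + 3 * n0)) => //.
- move=> i s1 /andP[_ im] hi Ii bs fr.
  have hm1 : s1 aM0 0%N 0%N = m0%:R by rewrite fr.
  pose J c (s' : memory) := forall r c', (r != i)  || (c' < c)%N ->
    s' aA r c' = if r == i then 0 else s1 aA r c'.
  apply: wp_seq; apply: (wp_for S3 (I := J) (i0 := 0) (n := m0) (K := 0)) => //.
  + by move=> r c; rewrite orbF updE /= => /negPf ->.
  + move=> c s2 /andP[_ cm] hc Jc bs2 fr2.
    have hi2 : s2 aI 0%N 0%N = i%:R by rewrite fr2.
    apply: (wp_put2 S3); [eassumption | eassumption | ev_tac | by [] | by move=> _; rewrite hgt_nat; move: S8; clear; lia |].
    split=> // _ r c' hr; rewrite !updE /=; case: (eqVneq r i) hr => [->|ri] /= hr; last first.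
      by rewrite Jc ?ri // (negPf ri).
    case: (eqVneq c' c) => [//|cc]; rewrite Jc ?eqxx //=.
    by move: hr; rewrite ltnS leq_eqVlt (negPf cc).
  move=> o2 s2 ho2 J2 hc2 fr2.
  have hi2 : s2 aI 0%N 0%N = i%:R by rewrite fr2.
  apply: wp_seq; apply: (wp_put2 S3); [eassumption | eassumption | ev_tac | by [] | by move=> _; rewrite hgt_nat; move: S8; clear; lia |].
  set s3 := upd _ _ _ _ _.
  have hn3 : s3 aN0 0%N 0%N = n0%:R by rewrite /s3 updE fr2 // fr.
  pose J' c (s' : memory) := forall r c', (c' < m0 + c)%N || (r != i) ->
    s' aA r c' = if r == i then (if (c' < m0)%N then (r == c')%:R else s aS r (c' - m0)%N)
       else s1 aA r c'.
  apply: (wp_for S3 (I := J') (i0 := 0) (n := n0) (K := 1)) => //.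
  + move=> r c'; rewrite addn0 updE /s3 updE /=.
    case: (eqVneq r i) => [->|ri] /=; last by rewrite J2 ?ri // (negPf ri).
    rewrite orbF => hc'; rewrite hc' eq_sym; case: (eqVneq i c') => //= ic.
    by rewrite J2 ?eqxx ?hc' ?orbT.
  + move=> c s4 /andP[_ cn] hc Jc bs4 fr4.
    have hi4 : s4 aI 0%N 0%N = i%:R by rewrite fr4.
    have hm4 : s4 aM0 0%N 0%N = m0%:R by rewrite fr4 // /s3 updE fr2.
    have hS4 : s4 aS i c = s aS i c by rewrite fr4 // /s3 updE fr2 // fr.
    have hmc : ev s4 (Op Add (V aM0) (V aC)) (m0 + c)%:R by rewrite natrD; ev_tac.
    apply: (wp_assign S3 (ev_V hi4) hmc); [ev_tac | by [] | by rewrite -hS4 |].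
    split=> // _ r c' hr; rewrite !updE /=.
    case: (eqVneq r i) hr => [->|ri] /= hr; last by rewrite Jc ?ri ?orbT // (negPf ri).
    case: (eqVneq c' (m0 + c)%N) => [->|cc] /=.
      by rewrite ltnNge leq_addr /= addKn.
    rewrite Jc ?eqxx //; move: hr; rewrite !orbF addnS ltnS leq_eqVlt (negPf cc).
    by [].
  move=> o4 s4 ho4 J4 hc4 fr4; split=> //.
    by move: ho2 ho4; rewrite /= !subn0; clear; lia.
  move=> _ r c; rewrite ltnS updE /= => ri cn.
  rewrite J4; last by rewrite addnC cn.
  case: (eqVneq r i) => // ri'; apply: Ii => //.
  by rewrite ltn_neqAle ri'.
move=> o1 s1 ho1 I1 hi fr fr2; apply: HQ => //.
by move: ho1; rewrite /= subn0; clear; nia.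
Qed.

Lemma wp_fill_columns k o l (s : memory) (Q : nat -> nat -> memory -> Prop) :
  s aM0 0%N 0%N = m0%:R -> s aN0 0%N 0%N = n0%:R -> s aTop 0%N 0%N = k ->
  (forall o' (s' : memory), (o' <= o + 2 + 3 * m0 + 4 * n0)%N ->
    (forall c, (c < n0 + m0)%N -> s' aP c 0%N =
       (if (c < m0)%N then n0 + c else c - m0)%N%:R) ->
    (forall c, (c < n0 + m0)%N -> s' aU c 0%N = if (c < m0)%N then 0 else k) ->
    frame (mods fill_columns) s s' -> Q o' l s') ->
  wp B S fill_columns o l s Q.
Proof.
move=> hm hn ht HQ; apply: wp_frame; rewrite /fill_columns.
have m0S : (m0 < 2 ^ S)%N by apply: leq_ltn_trans ZS; apply: leq_addl.
have n0S : (n0 < 2 ^ S)%N by apply: leq_ltn_trans ZS; apply: leq_addr.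
pose I i (s' : memory) := forall c, (c < i)%N ->
  s' aP c 0%N = (n0 + c)%:R /\ s' aU c 0%N = 0.
apply: wp_seq; apply: (wp_for S3 (I := I) (i0 := 0) (n := m0) (K := 1)) => //.
- move=> i s1 /andP[_ im] hi Ii bs fr.
  have hn1 : s1 aN0 0%N 0%N = n0%:R by rewrite fr.
  apply: wp_seq; apply: (wp_put1 S3); [eassumption | ev_tac | by [] | |].
    by move=> _; rewrite -natrD hgt_nat; apply: leq_ltn_trans ZS; rewrite leq_add2l ltnW.
  apply: (wp_put1 S3); [eassumption | ev_tac | by [] | by move=> _; rewrite hgt_nat; move: ZS; clear; lia |].
  split=> // _ c; rewrite ltnS !updE /= andbT.
  case: (eqVneq c i) => [->|ci] hc; first by rewrite natrD.
  by apply: Ii; rewrite ltn_neqAle ci.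
move=> o1 s1 ho1 I1 hi1 fr1.
have hm1 : s1 aM0 0%N 0%N = m0%:R by rewrite fr1.
have hn1 : s1 aN0 0%N 0%N = n0%:R by rewrite fr1.
pose J i (s' : memory) := forall c, (c < m0 + i)%N ->
  s' aP c 0%N = (if (c < m0)%N then n0 + c else c - m0)%N%:R /\
  s' aU c 0%N = if (c < m0)%N then 0 else k.
apply: (wp_for S3 (I := J) (i0 := 0) (n := n0) (K := 2)) => //.
- by move=> c; rewrite addn0 => cm; rewrite cm !updE; apply: I1.
- move=> i s2 /andP[_ im] hi Ji bs fr.
  have hm2 : s2 aM0 0%N 0%N = m0%:R by rewrite fr.
  have ht2 : s2 aTop 0%N 0%N = k by rewrite fr // fr1.
  have hmc : ev s2 (Op Add (V aM0) (V aC)) (m0 + i)%:R by rewrite natrD; ev_tac.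
  apply: wp_seq; apply: (wp_assign S3 hmc (@ev_N s2 0 isT)); [ev_tac | by [] | |].
    by move=> _; rewrite hgt_nat; apply: ltn_trans n0S.
  set s3 := upd _ _ _ _ _.
  have hmc3 : ev s3 (Op Add (V aM0) (V aC)) (m0 + i)%:R by rewrite natrD; ev_tac.
  have ht3 : s3 aTop 0%N 0%N = k by [].
  apply: (wp_assign S3 hmc3 (@ev_N s3 0 isT)); [ev_tac | by [] | by rewrite -ht3 |].
  split=> // _ c; rewrite addnS ltnS !updE /= /s3 updE /= andbT.
  case: (eqVneq c (m0 + i)%N) => [->|ci] hc.
    by rewrite ltnNge leq_addr /= addKn.
  by apply: Ji; rewrite ltn_neqAle ci.
move=> o2 s2 ho2 J2 hi2 fr2 fr3; apply: HQ => //.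
- by move: ho1 ho2; rewrite /= !subn0; clear; lia.
- by move=> c cn; have [] := J2 c; rewrite ?[(m0 + _)%N]addnC.
- by move=> c cn; have [] := J2 c; rewrite ?[(m0 + _)%N]addnC.
Qed.

End Initialize.
Arguments wp_compute_bound {B S m0 n0 A b} S3 hU ZS [o l s Q].
Arguments wp_fill_tableau {B S m0 n0} S3 ZS [o l s Q].
Arguments wp_fill_columns {B S m0 n0} S3 ZS [k o l s Q].

(** Slack columns are numbered from [n0] on although they occupy the first positions, so that the
    original columns keep their numbers. *)
Definition extended (n0 : nat) (A : nat -> nat -> int) (r c : nat) : int :=
  if (c < n0)%N then A r c else (r == c - n0)%N.

Lemma entry_bound_extended m0 n0 (A : nat -> nat -> int) (b : nat -> int) :
  entry_bound (\matrix_(r < m0, c < n0 + m0) extended n0 A r c) (\col_(r < m0) b r) =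
  system_bound m0 n0 A b.
Proof.
apply: eq_bigr => r _; rewrite !mxE /row_bound big_split_ord /= [RHS]mulnCA.
congr (_ * _)%N; rewrite [LHS]mulnC; congr (_ * _)%N.
  rewrite (bigD1 r) //= big1 => [|c /negPf cr].
    by rewrite muln1 mxE /extended /= ltnNge leq_addr /= addKn eqxx.
  rewrite mxE /extended /= ltnNge leq_addr /= addKn.
  by have -> : (r == c :> nat) = false by rewrite eq_sym.
by apply: eq_bigr => c _; rewrite mxE /extended /= ltn_ord.
Qed.

Lemma wp_initialize B S m0 n0 (A : nat -> nat -> int) (b : nat -> int) E o l (s : memory)
    (Q : nat -> nat -> memory -> Prop) :
  (3 <= S)%N -> (((2 * system_bound m0 n0 A b) ^ 2).+1 <= 2 ^ S)%N ->
  (n0 + m0 < 2 ^ S)%N ->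
  s aM 0%N 0%N = m0%:R -> s aN 0%N 0%N = n0%:R ->
  (forall r c, (r < m0)%N -> (c < n0)%N -> s aA r c = (A r c)%:~R) ->
  (forall r, (r < m0)%N -> s aB r 0%N = (b r)%:~R) ->
  (forall c, s aY c 0%N = 0) ->
  let U := ((2 * system_bound m0 n0 A b) ^ 2)%N in
  (forall o' (s' : memory) p, (o' <= o + 8 + 20 * (n0 + m0) + 20 * (m0 * (n0 + m0)))%N ->
    tab_invariant m0 n0 (extended n0 A) b U E s' m0 (n0 + m0) p (fun=> 0%N) ->
    s' aRun 0%N 0%N = 1 -> s' aN0 0%N 0%N = n0%:R -> Q o' l s') ->
  wp B S initialize o l s Q.
Proof.
move=> S3 hU ZS hm hn hA hb hy U HQ; rewrite /initialize.
have m0S : (m0 < 2 ^ S)%N by apply: leq_ltn_trans ZS; apply: leq_addl.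
have n0S : (n0 < 2 ^ S)%N by apply: leq_ltn_trans ZS; apply: leq_addr.
have S8 : (2 ^ 3 <= 2 ^ S)%N by rewrite leq_exp2l.
apply: wp_seq; apply: (wp_set S3); [ev_tac | by [] | by move=> _; rewrite hgt_nat |].
set s1 := upd _ _ _ _ _; have hm1 : s1 aM 0%N 0%N = m0%:R by [].
apply: wp_seq; apply: (wp_set S3); [ev_tac | by [] | by move=> _; rewrite hgt_nat |].
set s2 := upd _ _ _ _ _; have hn2 : s2 aN 0%N 0%N = n0%:R by [].
have hm2 : s2 aM 0%N 0%N = m0%:R by [].
apply: wp_seq; apply: (wp_set S3); [ev_tac | by [] | by move=> _; rewrite -natrD hgt_nat |].
rewrite -natrD; set s3 := upd _ _ _ _ _.
apply: wp_seq; apply: (wp_set S3); [ev_tac | by [] | by move=> _; rewrite hgt_nat; move: S8; clear; lia |].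
set s4 := upd _ _ _ _ _.
have s4B : s4 aB = s aB by [].
have s4Y : s4 aY = s aY by [].
apply: wp_seq; apply: (wp_compute_bound S3 hU ZS) => //.
move=> o5 s5 ho5 ht5 hS5 fr5.
have hUE : 2%:R * (system_bound m0 n0 A b)%:R * (2%:R * (system_bound m0 n0 A b)%:R) = U%:R :> rat.
  by rewrite -!natrM /U.
apply: wp_seq; apply: (wp_set S3); [ev_tac | by [] | by move=> _; rewrite hUE hgt_nat |].
rewrite hUE; set s6 := upd _ _ _ _ _.
have hm6 : s6 aM0 0%N 0%N = m0%:R by rewrite /s6 updE fr5.
have hn6 : s6 aN0 0%N 0%N = n0%:R by rewrite /s6 updE fr5.
apply: wp_seq; apply: (wp_fill_tableau S3 ZS) => //.
move=> o7 s7 ho7 hA7 fr7.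
apply: wp_seq; apply: (wp_fill_columns S3 ZS (k := U%:R)) => //.
- by rewrite fr7.
- by rewrite fr7.
- by rewrite fr7.
move=> o8 s8 ho8 hp8 hu8 fr8.
have htot : s8 aTot 0%N 0%N = (n0 + m0)%:R by rewrite fr8 // fr7 // /s6 updE fr5.
apply: wp_seq; apply: (wp_set S3); [ev_tac | by [] | by move=> _; rewrite hgt_nat |].
apply: (wp_set S3); [ev_tac | by [] | by move=> _; rewrite hgt_nat; move: S8; clear; lia |].
set s9 := upd _ _ _ _ _.
pose p c := (if c < m0 then n0 + c else c - m0)%N.
have A9 r c : (r < m0)%N -> (c < n0 + m0)%N -> s9 aA r c =
    if (c < m0)%N then (r == c)%:R else (A r (c - m0)%N)%:~R.
  move=> hr hc; rewrite /s9 !updE /= fr8 // hA7 //; case: ltnP => // mc.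
  by rewrite /s6 updE hS5 //; lia.
have B9 r : (r < m0)%N -> s9 aB r 0%N = (b r)%:~R.
  by move=> hr; rewrite /s9 !updE /= fr8 // fr7 // /s6 updE fr5 // s4B hb.
have extp r c : (c < n0 + m0)%N -> (r < m0)%N -> (extended n0 A r (p c))%:~R = s9 aA r c.
  move=> hc hr; rewrite A9 // /extended /p; case: (ltnP c m0) => mc.
    by rewrite ltnNge leq_addr /= addKn.
  by have -> : (c - m0 < n0)%N by lia.
have sum1 r (y : nat -> rat) : (r < m0)%N ->
    \sum_(i < m0) (extended n0 A r (p i))%:~R * y i = y r.
  move=> hr; rewrite (sumD1 (fun i => (extended n0 A r (p i))%:~R * y i) hr).
  rewrite big1 ?addr0 => [|i ir].
    by rewrite extp ?ltn_addl // A9 ?ltn_addl // hr eqxx mul1r.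
  rewrite extp ?ltn_addl // A9 ?ltn_addl // ltn_ord.
  by rewrite eq_sym (negPf ir) mul0r.
apply: (HQ _ s9 p) => //.
- by move: ho5 ho7 ho8; rewrite /=; clear; nia.
- split=> //.
  + by rewrite /s9 !updE /= fr8 // fr7 // /s6 updE fr5.
  + by rewrite /s9 !updE /= fr8 // fr7.
  + move=> c hc; rewrite /s9 !updE /= hu8 // /ubound /p.
    case: (ltnP c m0) => mc; first by rewrite ltnNge leq_addr.
    have -> : (c - m0 < n0)%N by lia.
    by rewrite expr0 mulr1.
  + split.
    * exact: leq_addl.
    * by move=> c; rewrite /p; case: (ltnP c m0); lia.
    * by move=> i j; rewrite /p; case: (ltnP i m0); case: (ltnP j m0); lia.
    * by move=> i j hi hj; rewrite A9 ?ltn_addl // hj.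
    * by move=> r j hr hj; rewrite (sum1 r (s9 aA ^~ j)) // extp.
    * by move=> r hr; rewrite (sum1 r (fun i => s9 aB i 0%N)) // B9.
    * by move=> y h i hi; rewrite -[LHS](sum1 i y hi) h.
  (* A good solution vanishes on the slack columns, so the tableau row reduces to the original
     equation. *)
  + move=> x [gx _ _ x0] i hi; rewrite B9 // -(gx _ hi).
    rewrite (_ : \sum_(j < n0 + m0) s9 aA i j * x (p j) =
      \sum_(j < m0 + n0) s9 aA i j * x (p j)); last by rewrite addnC.
    rewrite big_split_ord /= big1 ?add0r => [|c _].
      apply: eq_bigr => c _; rewrite A9 //; last by rewrite addnC ltn_add2r.
      by rewrite /p ltnNge leq_addr /= addKn /extended ltn_ord.
    by rewrite /p ltn_ord x0 ?mulr0 // leq_addr.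
  + move=> c hc _; exists (m0 + c)%N; first by rewrite addnC ltn_add2r.
    by rewrite /p ltnNge leq_addr /= addKn.
  + by move=> c; rewrite /s9 !updE /= fr8 // fr7 // /s6 updE fr5 // s4Y hy.
- by rewrite /s9 !updE /= fr8 // fr7.
Qed.

(** * Input sizes, constants and the final bounds *)

Lemma entry_ord m n (M : 'M[rat]_(m, n)) (i : 'I_m) (j : 'I_n) : entry M i j = M i j.
Proof. by rewrite /entry !valK. Qed.

Definition nat_matrix m n (A : 'M[int]_(m, n)) (r c : nat) : int :=
  if insub r is Some r' then if insub c is Some c' then A r' c' else 0 else 0.

Lemma nat_matrix_ord m n (A : 'M[int]_(m, n)) (i : 'I_m) (j : 'I_n) :
  nat_matrix A i j = A i j.
Proof. by rewrite /nat_matrix !valK. Qed.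

Lemma entry_intr m n (A : 'M[int]_(m, n)) r c :
  entry (map_mx intr A) r c = (nat_matrix A r c)%:~R.
Proof.
rewrite /entry /nat_matrix; case: insub => // r'; case: insub => // c'.
by rewrite mxE.
Qed.

Lemma intz_size (z : int) : (`|z|.+1 <= 2 ^ int_size z)%N.
Proof.
apply: leq_trans (@up_logP 2 `|z|.+1 isT) _.
by rewrite leq_exp2l.
Qed.

Lemma system_sizeE m n (A : 'M[int]_(m, n)) (b : 'cV[int]_m) :
  system_size A b = (\sum_(i < m) (\sum_(j < n) int_size (A i j) + int_size (b i 0%R)))%N.
Proof.
apply: eq_bigr => i _; rewrite big_split_ord /= big_ord1 row_mxEr.
by congr (_ + _)%N; apply: eq_bigr => j _; rewrite row_mxEl.
Qed.

(** Every entry takes at least its sign bit. For [0 < m] this yields [n <= L]. *)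
Lemma system_size_ge m n (A : 'M[int]_(m, n)) (b : 'cV[int]_m) :
  (m * n.+1 <= system_size A b)%N.
Proof.
rewrite system_sizeE -[leqLHS]mul1n mulnA -{1}[m]card_ord mul1n -sum_nat_const.
apply: leq_sum => i _; rewrite -addn1 leq_add //.
rewrite -[leqLHS]muln1 -{1}[n]card_ord -sum_nat_const.
exact: leq_sum.
Qed.

Lemma system_bound_size m n (A : 'M[int]_(m, n)) (b : 'cV[int]_m) :
  (system_bound m n (nat_matrix A) (fun r => nat_matrix b r 0) <= 2 ^ (m + system_size A b))%N.
Proof.
rewrite /system_bound system_sizeE.
have -> : (m + \sum_(i < m) (\sum_(j < n) int_size (A i j) + int_size (b i 0%R)) =
  \sum_(i < m) (1 + (\sum_(j < n) int_size (A i j) + int_size (b i 0%R))))%N.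
  by rewrite [RHS]big_split /= sum_nat_const card_ord muln1.
elim/big_rec2: _ => // i x y _ h; rewrite expnD leq_mul //.
rewrite /row_bound expnD leq_mul // addnC expnD leq_mul //.
  by rewrite (nat_matrix_ord b i ord0) intz_size.
rewrite (eq_bigr (fun c : 'I_n => `|A i c|.+1)); last first.
  by move=> c _; rewrite nat_matrix_ord.
elim/big_rec2: _ => // j x' y' _ h'; rewrite expnD leq_mul //.
exact: intz_size.
Qed.

Lemma entry_bound_le_system_bound m n (A : 'M[int]_(m, n)) (b : 'cV[int]_m) :
  (entry_bound A b <= system_bound m n (nat_matrix A) (fun r => nat_matrix b r 0))%N.
Proof.
apply: leq_prod => i _; rewrite /row_bound (nat_matrix_ord b i ord0).
rewrite (eq_bigr (fun c : 'I_n => `|nat_matrix A i c|.+1)); last first.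
  by move=> c _; rewrite nat_matrix_ord.
by rewrite leq_pmull.
Qed.

(** With [D] the system bound and [U = (2 D)^2], a vertex coordinate is at most [D^2 <= U], and a
    nonzero one is at least [1 / D], so that [U x >= 4 D >= 4]. *)
Lemma feasible_good (R : realType) m n (A : 'M[int]_(m, n)) (b : 'cV[int]_m) :
  (exists x : 'cV[R]_n, feasible (map_mx intr A) (map_mx intr b) x) ->
  exists x, good m n (extended n (nat_matrix A)) (fun r => nat_matrix b r 0)
    ((2 * system_bound m n (nat_matrix A) (fun r => nat_matrix b r 0)) ^ 2) x.
Proof.
move=> /rational_vertex[x [[Ax x0] hx]].
set U := system_bound _ _ _ _.
have UU : (entry_bound A b <= U)%N by apply: entry_bound_le_system_bound.
have U1 : (0 < U)%N by apply: system_bound_gt0.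
pose y c := if insub c is Some c' then x c' 0 else 0.
have yE (c : 'I_n) : y c = x c 0 by rewrite /y valK.
exists y; split.
- move=> r hr; have := congr1 (fun M : 'cV_m => M (Ordinal hr) 0) Ax; rewrite !mxE.
  rewrite -(nat_matrix_ord b (Ordinal hr) 0) => <-.
  apply: eq_bigr => c _; rewrite yE /extended ltn_ord mxE.
  by rewrite -(nat_matrix_ord A (Ordinal hr) c).
- move=> c hc; rewrite -[c]/(val (Ordinal hc)) yE x0 /=.
  have [h _] := hx (Ordinal hc); apply: le_trans h _.
  by rewrite ler_nat; move: UU; clear; nia.
- move=> c hc; rewrite -[c]/(val (Ordinal hc)) yE => h.
  have [_ /(_ h) h1] := hx (Ordinal hc).
  have h2 : 1 <= U%:R * x (Ordinal hc) 0.
    by apply: le_trans h1 _; apply: ler_wpM2r; rewrite ?ler_nat.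
  have -> : ((2 * U) ^ 2)%N%:R = (4 * U)%N%:R * U%:R :> rat.
    by rewrite -natrM; congr (_%:R); ring.
  rewrite -mulrA; apply: le_trans (_ : (4 * U)%:R * 1 <= _).
    by rewrite mulr1 ler_nat; move: U1; clear; lia.
  by apply: ler_wpM2l.
- move=> c nc; rewrite /y; case: insubP => // c'; by rewrite ltnNge nc.
Qed.

Lemma wp_copy_solution B S n o l (s : memory) (Q : nat -> nat -> memory -> Prop) :
  (3 <= S)%N -> (n < 2 ^ S)%N -> s aN0 0%N 0%N = n%:R ->
  (forall o' (s' : memory), (o' <= o + 1 + 2 * n)%N ->
    (forall c, (c < n)%N -> s' aX c 0%N = s aY c 0%N) ->
    s' aAns 0%N 0%N = s aAns 0%N 0%N -> Q o' l s') ->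
  wp B S (For aC (Cst 0) aN0 (put1 aX aC (G1 aY aC))) o l s Q.
Proof.
move=> S3 nS hn HQ.
pose I i (s' : memory) := forall c, (c < i)%N -> s' aX c 0%N = s aY c 0%N.
apply: (wp_for S3 (I := I) (i0 := 0) (n := n) (K := 0)) => //.
- move=> i s1 /andP[_ im] hi Ii bs fr.
  have hy : s1 aY i 0%N = s aY i 0%N by rewrite fr.
  apply: (wp_put1 S3); [eassumption | ev_tac | by [] | by rewrite -hy |].
  split=> // _ c; rewrite ltnS !updE /= andbT.
  case: (eqVneq c i) => [-> //|ci] hc; apply: Ii.
  by rewrite ltn_neqAle ci.
- move=> o1 s1 ho1 I1 hi fr; apply: HQ => //; last by rewrite fr.
  by move: ho1; rewrite /=; clear; lia.
Qed.

(** The 361 is 72 for twice the steps, 288 for the capped term and 1 for the living variables. *)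
Lemma potential_start n E L rho q : (E <= 36 * L)%N -> (0 < L)%N -> (rho <= L)%N ->
  (rho * 2 ^ q <= 8 * n)%N ->
  (steps n E (fun=> 0%N) <= 36 * (n * L))%N /\
  (potential n E rho q (fun=> 0%N) <= 361 * (n * L))%N.
Proof.
move=> hE L0 hr hq.
have -> : steps n E (fun=> 0%N) = (n * E)%N.
  by rewrite /steps sum_nat_const card_ord subn0.
have h1 : (n * E <= 36 * (n * L))%N.
  by apply: leq_trans (leq_mul (leqnn n) hE) _; rewrite mulnCA.
split=> //; rewrite /potential /steps sum_nat_const card_ord subn0.
have h2 : (alive n E (fun=> 0%N) <= n)%N.
  apply: leq_trans (_ : \sum_(c < n) 1 <= _)%N; first by apply: leq_sum => c _; case: (_ < _)%N.
  by rewrite sum_nat_const card_ord muln1.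
have h3 : (rho * (minn (n * E) (E * 2 ^ q) + alive n E (fun=> 0%N)) <=
    E * (8 * n) + L * n)%N.
  rewrite mulnDr leq_add //; last exact: leq_mul.
  apply: leq_trans (_ : rho * (E * 2 ^ q) <= _)%N; first by rewrite leq_mul2l geq_minr orbT.
  by rewrite mulnCA leq_mul2l hq orbT.
have h4 : (E * (8 * n) <= 36 * L * (8 * n))%N by rewrite leq_mul2r hE orbT.
by move: h1 h3 h4; clear; lia.
Qed.

Lemma round_cost_bound C m n : (m <= n)%N -> (2 <= n)%N ->
  (round_cost C m n <= (1000 + 16 * C) * n ^ 4)%N.
Proof.
move=> mn n2; rewrite /round_cost.
have [Z [ZE hZ]] : exists Z, Z = (n + m)%N /\ (Z <= 2 * n)%N by exists (n + m)%N; split=> //; lia.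
rewrite -ZE.
have h1 : (C * Z ^ 4 <= C * (16 * n ^ 4))%N.
  by rewrite leq_mul2l -[16%N]/(2 ^ 4)%N -expnMn leq_exp2r // hZ orbT.
have h2 : ((Z + 1) * (60 + 50 * (Z * Z)) <= 3 * n * (215 * (n * n)))%N.
  by apply: leq_mul; [lia | nia].
have h3 : (n * (n * n) * 2 <= n ^ 4)%N.
  by rewrite !expnS expn0 muln1; nia.
have h4 : (4 <= n * n)%N by nia.
have h5 : (n * 4 <= n * (n * n))%N by rewrite leq_mul2l h4 orbT.
move: h1 h2 h3 h5 hZ; rewrite mulnDl; clear -n2.
have -> : (3 * n * (215 * (n * n)) = 645 * (n * (n * n)))%N by ring.
have -> : (C * (16 * n ^ 4) = 16 * C * n ^ 4)%N by ring.
by move: (n * (n * n))%N (n ^ 4)%N => x y; lia.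
Qed.

(** The 3056 is [2 * 4 * 382], from [Z <= 2 N], [Z + 2 <= 4 N] and [2 S1 + 2 <= 382 N]. *)
Lemma bits_bound (cB dB Z N S1 SB : nat) : (0 < N)%N -> (Z <= 2 * N)%N ->
  (S1 <= 190 * N)%N -> (SB <= cB * (Z * (Z + 2) * (2 * S1 + 2)) ^ dB)%N ->
  (16 * ((SB + S1 + 1) * (Z + 1) + 4 * S1 + 3) + 2 <=
    (16 * (3 * (cB * 3056 ^ dB) + 1336) + 2) * N ^ (3 * dB + 2))%N.
Proof.
move=> N0 hZ hS1 hSB0; set al := (cB * 3056 ^ dB)%N.
have hSB : (SB <= al * N ^ (3 * dB))%N.
  apply: leq_trans hSB0 _; rewrite /al -[leqRHS]mulnA leq_mul2l; apply/orP; right.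
  rewrite expnM -expnMn; case: (dB) => [|d]; first by rewrite !expn0.
  rewrite leq_exp2r //.
  apply: (@leq_trans ((2 * N) * (4 * N) * (382 * N))).
    apply: leq_mul; [apply: leq_mul => //; lia | lia].
  by rewrite !expnS expn0; clear; lia.
set X := (N ^ (3 * dB))%N in hSB.
have X0 : (0 < X)%N by rewrite expn_gt0 N0.
have -> : (N ^ (3 * dB + 2) = X * (N * N))%N by rewrite expnD -mulnn.
have h1 : ((SB + S1 + 1) * (Z + 1) <= (al * X + 191 * N) * (3 * N))%N.
  by apply: leq_mul; lia.
have h2 : (N <= N * N)%N by rewrite leq_pmulr.
have h3 : (N * N <= X * (N * N))%N by rewrite leq_pmull.
have h4 : ((al * X) * N <= (al * X) * (N * N))%N by rewrite leq_mul2l h2 orbT.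
move: h1 h2 h3 h4 hS1.
have -> : ((al * X + 191 * N) * (3 * N) = 3 * ((al * X) * N) + 573 * (N * N))%N by ring.
have -> : ((16 * (3 * al + 1336) + 2) * (X * (N * N)) =
   48 * ((al * X) * (N * N)) + (2137 * 10 + 8) * (X * (N * N)))%N by ring.
have hN : (1 <= N * N)%N by rewrite muln_gt0 N0.
move: hN; clear.
move: (N * N)%N (X * (N * N))%N (al * X * (N * N))%N (al * X * N)%N ((SB + S1 + 1) * (Z + 1))%N.
move=> x1 x2 x3 x4 x5; lia.
Qed.

(** The 362 is the 361 of the initial potential plus 1 for the last round, since [rho <= n L]. *)
Lemma total_bound C m n L rho o0 o1 o2 l pot st rc :
  (m <= n)%N -> (2 <= n)%N -> (n <= L)%N -> (0 < rho <= n)%N ->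
  (o0 <= 8 + 20 * (n + m) + 20 * (m * (n + m)))%N ->
  (rc <= (1000 + 16 * C) * n ^ 4)%N -> (pot <= 361 * (n * L))%N -> (st <= 36 * (n * L))%N ->
  (rho * o1 <= rho * o0 + rc * (pot + rho) + rho * (5 * st) + rho)%N ->
  (rho * l <= pot + rho)%N ->
  (o2 <= o1 + 1 + 2 * n)%N ->
  (rho * o2 <= (362 * (1000 + 16 * C) + 300) * (n ^ 5 * L))%N /\
  (rho * l <= 362 * (n * L))%N.
Proof.
move=> mn n2 nL /andP[r0 rn] ho0 hrc hpot hst ho1 hl ho2.
have nn : (rho <= n * L)%N by apply: leq_trans rn _; rewrite leq_pmulr //; lia.
have h1 : (rc * (pot + rho) <= (1000 + 16 * C) * n ^ 4 * (362 * (n * L)))%N.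
  by apply: leq_mul => //; lia.
have h2 : (rho * o2 <= rho * o1 + rho * (1 + 2 * n))%N.
  by rewrite -mulnDr addnA leq_mul2l ho2 orbT.
have h3 : (rho * o0 <= n * (62 * (n * n)))%N.
  apply: leq_mul => //; apply: leq_trans ho0 _.
  have g1 : (m * (n + m) <= n * (2 * n))%N by apply: leq_mul => //; lia.
  have g2 : (2 * n <= n * n)%N by rewrite leq_mul2r n2 orbT.
  by move: g1 g2 mn n2; rewrite mulnCA; clear; lia.
have h4 : (rho * (5 * st) <= n * (180 * (n * L)))%N by apply: leq_mul => //; lia.
have h5 : (rho * (1 + 2 * n) <= n * (3 * n))%N by apply: leq_mul => //; lia.
split; last by lia.
have h6 : (n * n * n <= n * n * L)%N by rewrite leq_mul2l nL orbT.
have h7 : (n * n <= n * n * L)%N by rewrite leq_pmulr //; lia.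
have h8 : (n * n * L <= n ^ 5 * L)%N.
  by rewrite leq_mul2r; apply/orP; right; rewrite mulnn leq_pexp2l //; lia.
have e1 : ((1000 + 16 * C) * n ^ 4 * (362 * (n * L)) =
    362 * (1000 + 16 * C) * (n ^ 5 * L))%N by rewrite expnSr; ring.
rewrite e1 in h1; rewrite mulnDl.
move: h1 h2 h3 h4 h5 h6 h7 h8 ho1.
have -> : (n * (62 * (n * n)) = 62 * (n * n * n))%N by ring.
have -> : (n * (180 * (n * L)) = 180 * (n * n * L))%N by ring.
have -> : (n * (3 * n) = 3 * (n * n))%N by ring.
have h9 : (rho <= n * n)%N by apply: leq_trans rn _; rewrite leq_pmulr //; lia.
move: h9; clear.
move: (n * n)%N (n * n * L)%N (n * n * n)%N (n ^ 5 * L)%N (_ * (n ^ 5 * L))%N (rc * _)%N.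
move: (rho * (5 * st))%N (rho * o0)%N (rho * (1 + 2 * n))%N (rho * o1)%N (rho * o2)%N.
by move=> *; lia.
Qed.

(** The exponents are [6 L + 1] for [U] and [1 + 5 * 36 L] for the power, as [hgt (3 / 4) <= 2 ^ 5];
    together they are at most [190 L]. *)
Lemma column_bound_height U E L k : (U <= 2 ^ (6 * L))%N -> (0 < L)%N -> (E <= 36 * L)%N ->
  (k <= E)%N -> (hgt (U%:R * (3 / 4) ^+ k) <= 2 ^ (190 * L))%N.
Proof.
move=> hU L0 hE hk.
apply: leq_trans (hgtM _ _) _.
have h1 : (hgt U%:R <= 2 ^ (6 * L + 1))%N.
  by rewrite hgt_nat addn1 expnS; have := expn_gt0 2 (6 * L); move: hU; clear; lia.
have h2 : (hgt ((3 / 4) ^+ k) <= 2 ^ (1 + 5 * k))%N.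
  apply: leq_trans (hgtX _ _) _; rewrite expnD leq_mul2l /= expnM.
  have h3 : (hgt (3 / 4) <= 2 ^ 5)%N.
    by apply: leq_trans (hgt_div _ _) _; rewrite (hgt_nat 3) (hgt_nat 4).
  by case: (k) => [|k']; rewrite ?expn0 // leq_exp2r.
apply: leq_trans (leq_mul h1 h2) _; rewrite -expnD leq_exp2l //.
by move: hk hE L0; clear; lia.
Qed.

Lemma bounded_input m n (AM : 'M[int]_(m, n)) (b : 'cV[int]_m) S :
  (system_bound m n (nat_matrix AM) (fun r => nat_matrix b r 0) <= 2 ^ S)%N ->
  (n + m < 2 ^ S)%N ->
  bounded S (input_mem (map_mx intr AM) (map_mx intr b) 0).
Proof.
set f := row_bound n (nat_matrix AM) (fun r => nat_matrix b r 0).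
move=> hS ZS a i j.
have z0 : (hgt 0 <= 2 ^ S)%N by rewrite (hgt_nat 0) expn_gt0.
have fle r : (r < m)%N -> (f r <= 2 ^ S)%N.
  move=> rm; apply: leq_trans hS; rewrite /system_bound (bigD1 (Ordinal rm)) //=.
  by rewrite leq_pmulr // prodn_gt0 // => c; apply: row_bound_gt0.
rewrite /input_mem; do 5?[case: ifP => _].
- by case: (entry_scalar m%:R i j) => ->; rewrite ?hgt_nat //; apply: leq_ltn_trans ZS; lia.
- by case: (entry_scalar n%:R i j) => ->; rewrite ?hgt_nat //; apply: leq_ltn_trans ZS; lia.
- rewrite entry_intr /nat_matrix; case: insubP => [r rm ri|_]; last by [].
  case: insubP => [c cn ci|_]; last by [].
  rewrite hgt_int; apply: leq_trans (fle r (ltn_ord r)).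
  rewrite /f /row_bound mulnA (bigD1 c) //= nat_matrix_ord mulnCA.
  by rewrite leq_pmulr // !muln_gt0 /= prodn_gt0.
- rewrite entry_intr /nat_matrix; case: insubP => [r rm ri|_]; last by [].
  case: insubP => [c cn ci|_]; last by [].
  rewrite hgt_int; apply: leq_trans (fle r (ltn_ord r)).
  rewrite /f /row_bound ord1 (nat_matrix_ord b r ord0) mulnCA.
  by rewrite leq_pmulr // muln_gt0 /= prodn_gt0.
- rewrite /entry; case: insub => [r|] //; case: insub => [c|] //.
  by rewrite mxE.
- by [].
Qed.

Lemma answered_output (R : realType) m n (A : 'M[int]_(m, n)) (b : 'cV[int]_m) (s s' : memory) :
  answered m n (extended n (nat_matrix A)) (fun r => nat_matrix b r 0)
    ((2 * system_bound m n (nat_matrix A) (fun r => nat_matrix b r 0)) ^ 2) s ->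
  (forall c, (c < n)%N -> s' aX c 0%N = s aY c 0%N) ->
  s' aAns 0%N 0%N = s aAns 0%N 0%N -> solver_output R A b s'.
Proof.
move=> ans hx hans; case: ans => [[a1 [y0 ay]]|[a0 ng]].
  left; split; first by rewrite hans.
  split=> [|j]; last by rewrite mxE hx.
  apply/matrixP => i j; rewrite ord1 [LHS]mxE [RHS]mxE -(nat_matrix_ord b i ord0).
  rewrite -(ay i (ltn_ord i)); apply: eq_bigr => c _.
  by rewrite !mxE hx // /extended ltn_ord nat_matrix_ord.
right; split; first by rewrite hans.
by move=> /feasible_good[x gx]; apply: (ng x).
Qed.

Lemma entry_scalar00 (q : rat) : entry (q%:M : 'M_1) 0 0 = q.
Proof. by rewrite (entry_ord q%:M ord0 ord0) mxE. Qed.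

Lemma solver_correct (R : realType) (B : cmd) (C cB dB : nat) m n
    (A : 'M[int]_(m, n)) (b : 'cV[int]_m) :
  (forall m n (A : 'M[rat]_(m, n)) (b : 'cV[rat]_m) (u : 'cV[rat]_n),
    (0 < m)%N -> (0 < n)%N -> row_free A -> (forall j, 0 < u j 0) ->
    exists k s,
      [/\ exec no_call B (input_mem A b u) k s,
          subroutine_output R A b u s,
          (ops k <= C * n ^ 4)%N &
          (bits k <= cB * (mx_size rat_size (row_mx A b) + mx_size rat_size u) ^ dB)%N]) ->
  (0 < m)%N -> (m <= n)%N -> (2 <= n)%N ->
  let L := system_size A b in
  let rho := up_log 2 n in
  exists k s, [/\ exec (call_of B) solver (input_mem (map_mx intr A) (map_mx intr b) 0) k s,
    solver_output R A b s,
    (bits k <= (16 * (3 * (cB * 3056 ^ dB) + 1336) + 2) * (n + L) ^ (3 * dB + 2))%N,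
    (rho * ops k <= (362 * (1000 + 16 * C) + 300) * (n ^ 5 * L))%N &
    (rho * calls k <= 362 * (n * L))%N].
Proof.
move=> hB m0 mn n2 L rho.
have [r0 rn rq hr8] := sqrt_log_bound n2.
have hL := system_size_ge A b.
have nL : (n <= L)%N by apply: leq_trans hL; rewrite -[leqLHS]mul1n; apply: leq_mul.
have mL : (m <= L)%N by apply: leq_trans nL.
have L0 : (0 < L)%N by apply: leq_trans nL; apply: ltnW.
have sbL := system_bound_size A b; have sb0 := @system_bound_gt0 m n (nat_matrix A) (fun r => nat_matrix b r 0).
set sb := system_bound _ _ _ _ in sbL sb0.
have sbL2 : (sb <= 2 ^ (2 * L))%N.
  by apply: leq_trans sbL _; rewrite leq_exp2l // mul2n -addnn leq_add2r.
set U := ((2 * sb) ^ 2)%N.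
have UL : (U <= 2 ^ (6 * L))%N.
  apply: (@leq_trans ((2 * 2 ^ (2 * L)) ^ 2)); first by rewrite leq_exp2r // leq_mul2l sbL2 orbT.
  by rewrite -expnS -expnM leq_exp2l //; lia.
have U2 : (2 <= U)%N by rewrite /U -mulnn; move: sb0; clear; nia.
have U0 : (0 < U)%N by apply: ltnW.
have [E [/andP[E0 EL] hE]] := threshold_exponent rat U2 UL.
have {}EL : (E <= 36 * L)%N by apply: leq_trans EL _; lia.
have hU k : (k <= E)%N -> (hgt (U%:R * (3 / 4) ^+ k) <= 2 ^ (190 * L))%N.
  exact: column_bound_height.
set S1 := (190 * L)%N in hU.
have S1U : (2 * entry_bound (\matrix_(r < m, c < n + m) extended n (nat_matrix A) r c)
    (\col_(r < m) nat_matrix b r 0) ^ 2 <= 2 ^ S1)%N.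
  rewrite (@entry_bound_extended m n (nat_matrix A) (fun r => nat_matrix b r 0)) -/sb.
  apply: (@leq_trans (2 * (2 ^ (2 * L)) ^ 2)); first by rewrite leq_mul2l leq_exp2r // sbL2 orbT.
  by rewrite -expnM -expnS leq_exp2l // /S1; move: L0; clear; lia.
have [SB SBE] : exists SB, SB = (cB * ((n + m) * (n + m + 2) * (2 * S1 + 2)) ^ dB)%N by eexists.
(* [S] leaves room for the sums in [shrink], for a pivot ([4 * S1]) and for the constants (3). *)
have [S SE] : exists S, S = ((SB + S1 + 1) * (n + m + 1) + 4 * S1 + 3)%N by eexists.
have hS : ((SB + S1 + 1) * (n + m + 1) + 4 * S1 + 3 <= S)%N by rewrite SE.
have S3 : (3 <= S)%N by move: hS; clear; lia.
have S14 : (4 * S1 <= S)%N by move: hS; clear; lia.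
have ZS : (n + m < 2 ^ S)%N.
  by apply: ltn_trans (ltn_expl S (isT : 1 < 2)%N); move: hS; clear; nia.
have US : (U.+1 <= 2 ^ S)%N.
  apply: (@leq_trans (2 ^ (6 * L).+1)).
    by rewrite expnS; have := expn_gt0 2 (6 * L); move: UL; clear; lia.
  by rewrite leq_exp2l //; apply: leq_trans S14; rewrite /S1; move: L0; clear; lia.
pose s0 := input_mem (map_mx intr A) (map_mx intr b) 0.
have bs0 : bounded S s0.
  apply: bounded_input => //; apply: leq_trans sbL2 _; rewrite leq_exp2l //.
  by apply: leq_trans S14; rewrite /S1; clear; lia.
have ve : valid_exponents m n (extended n (nat_matrix A)) (fun r => nat_matrix b r 0) U E (fun=> 0%N).
  split=> // x [_ hx _ _] c cn; rewrite /ubound cn expr0 mulr1.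
  by have /andP[] := hx c cn.
have [hst hpot] := potential_start EL L0 (leq_trans rn nL) hr8.
rewrite SBE in hS.
have W : wp B S solver 0 0 s0 (fun o l s => [/\ solver_output R A b s,
    (rho * o <= (362 * (1000 + 16 * C) + 300) * (n ^ 5 * L))%N &
    (rho * l <= 362 * (n * L))%N]).
  apply: wp_seq.
  apply: (@wp_initialize B S m n (nat_matrix A) (fun r => nat_matrix b r 0) E) => //.
  - exact: entry_scalar00.
  - exact: entry_scalar00.
  - by move=> r c hr hc; rewrite /s0 /input_mem /= entry_intr.
  - by move=> r hr; rewrite /s0 /input_mem /= entry_intr.
  move=> o1 s1 p ho1 iv run1 hn1; apply: wp_seq.
  apply: wp_conseq (wp_main_loop hB rq r0 U0 hE hU S1U hS iv ve run1
    (Q := fun o' l' s' => [/\ (rho * o' <= rho * o1 + round_cost C m n * (potential n E rho (uphalf rho) (fun=> 0%N) + rho) +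
        rho * (5 * steps n E (fun=> 0%N)) + rho)%N,
        (rho * l' <= rho * 0 + potential n E rho (uphalf rho) (fun=> 0%N) + rho)%N &
      answered m n (extended n (nat_matrix A)) (fun r => nat_matrix b r 0) U s']) _); last by [].
  move=> o2 l2 s2 bs2 fr2 [ho2 hl2 ans].
  apply: (@wp_copy_solution B S n) => //.
  - by apply: leq_ltn_trans ZS; apply: leq_addr.
  - by rewrite fr2.
  move=> o3 s3 ho3 hx hans; rewrite muln0 add0n in hl2.
  have [] := total_bound mn n2 nL _ ho1 (round_cost_bound C mn n2) hpot hst ho2 hl2 ho3.
    by rewrite r0.
  by move=> h1 h2; split=> //; apply: answered_output ans hx hans.
have [k [s [ek bk _ [out hops hcalls]]]] := W bs0.
exists k, s; split=> //; apply: leq_trans bk _; rewrite SE.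
apply: bits_bound; [by rewrite addn_gt0 L0 orbT | by lia | | by rewrite SBE].
by rewrite /S1 leq_mul2l leq_addl.
Qed.

Theorem mainTheorem1 (R : realType) :
  exists P : cmd, forall B : cmd, basic_subroutine R B ->
  exists (C K : R) (c d : nat),
  forall (m n : nat) (A : 'M[int]_(m, n)) (b : 'cV[int]_m),
    (0 < m)%N -> (2 <= n)%N -> row_free (map_mx intr A : 'M[rat]_(m, n)) ->
    let L := system_size A b in
    exists (k : cost) (s : memory),
      [/\ exec (call_of B) P (input_mem (map_mx intr A) (map_mx intr b) 0) k s,
          solver_output R A b s,
          (ops k <= c * (n + L) ^ d)%N /\ (bits k <= c * (n + L) ^ d)%N,
          (ops k)%:R <= C * (n%:R ^+ 5 / ln n%:R * L%:R) &
          (calls k)%:R <= K * (n%:R / ln n%:R * L%:R)].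
Proof.
exists solver => B [C [cB [dB hB]]].
set co := (362 * (1000 + 16 * C) + 300)%N.
set cb := (16 * (3 * (cB * 3056 ^ dB) + 1336) + 2)%N.
(* The degree dominates both 6, needed for [n ^ 5 * L], and [3 * dB + 2], needed for the bits. *)
exists co%:R, 362%:R, (co + cb)%N, (3 * dB + 6)%N => m n A b m0 n2 free L.
have mn : (m <= n)%N by rewrite -(eqP free) rank_leq_col.
have [k [s [ek out hb ho hc]]] := solver_correct A b hB m0 mn n2.
rewrite -/L -/cb -/co in hb ho hc.
exists k, s; split=> //.
- have N0 : (0 < n + L)%N by rewrite addn_gt0 (ltnW n2).
  have r0 : (0 < up_log 2 n)%N by rewrite up_log_gt0.
  split.
    apply: leq_trans (leq_pmull _ r0) _; apply: leq_trans ho _.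
    apply: leq_mul; first exact: leq_addr.
    apply: (@leq_trans ((n + L) ^ 6)).
      rewrite [leqRHS]expnSr; apply: leq_mul; last exact: leq_addl.
      by rewrite leq_exp2r // leq_addr.
    by apply: leq_pexp2l => //; rewrite leq_addl.
  apply: leq_trans hb _; apply: leq_mul; first exact: leq_addl.
  by apply: leq_pexp2l => //; rewrite leq_add2l.
- apply: le_trans (div_ln_bound R n2 ho) _.
  by rewrite natrM [(n ^ 5 * L)%:R]natrM natrX -!mulrA [L%:R / _]mulrC.
- apply: le_trans (div_ln_bound R n2 hc) _.
  by rewrite natrM [(n * L)%:R]natrM -!mulrA [L%:R / _]mulrC.
Qed.
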